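(* Let $f,g\colon(\mathbb{R}^2,0)\to(\mathbb{R},0)$ be nonzero real analytic function germs, both regular in $x$, such that $0\in\{f=0\}\subset\{g=0\}$ (as germs at the origin). Let $\beta_1,\dots,\beta_k$ be the common real Newton--Puiseux roots of $f$ and $g$, and let $m_j$, $n_j$ be the multiplicities of $\beta_j$ as a root of $f$ and of $g$ respectively. Define $$\mathcal{L}^+_g(f):=\max\left\{\ell(\phi),\ \frac{m_j}{n_j}\ \Big|\ \phi\in\mathcal V_a(fg),\ j=1,\dots,k\right\},\qquad \mathcal{L}^-_g(f):=\mathcal{L}^+_{\bar g}(\bar f),$$ where $\bar f(x,y):=f(x,-y)$ and $\bar g(x,y):=g(x,-y)$. Then $$\mathscr{L}_g(f)=\max\{\mathcal{L}^+_g(f),\ \mathcal{L}^-_g(f)\}.$$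
   Context: A germ $f(x,y)=f_m(x,y)+f_{m+1}(x,y)+\cdots$ (with $f_k$ homogeneous of degree $k$, $f_m\not\equiv0$) is regular in $x$ (of order $m$) if $f_m(1,0)\neq0$. The Łojasiewicz exponent $\mathscr{L}_g(f)$ of $f$ with respect to $g$ is the infimum of all $\alpha>0$ for which there exist $C,r>0$ with $|f(x,y)|\ge C|g(x,y)|^\alpha$ for $|(x,y)|\le r$. A Puiseux series is an element $\phi(y)=\sum_i a_i y^{\alpha_i}\in\mathbb{C}\{y^{1/N}\}$ (some $N\ge1$, positive rational exponents $\alpha_1<\alpha_2<\cdots$); it is real if all coefficients are real. A Newton--Puiseux root of $f$ is a Puiseux series $\phi$ with $f(\phi(y),y)\equiv0$; its multiplicity is its multiplicity as a root of $f$ regarded as a polynomial-like function in $x$ (i.e. the largest $m$ with $f(x,y)=(x-\phi(y))^m h(x,y)$, $h(\phi(y),y)\not\equiv0$). For a Puiseux series $\phi(y)=\sum_i a_iy^{\alpha_i}$ and $\rho>0$, the $\rho$-approximation of $\phi$ is $\sum_{\alpha_i<\rho}a_iy^{\alpha_i}+cy^\rho$ with $c$ a generic real number. For two distinct Puiseux series $\phi_1,\phi_2$, their approximation is the $\rho$-approximation of $\phi_1$ with $\rho:=\mathrm{ord}(\phi_1-\phi_2)$. For an analytic $F$ regular in $x$, $\mathcal V_a(F)$ denotes the set of all approximations of pairs $\phi_1\neq\phi_2$ of Newton--Puiseux roots of $F$. For a Puiseux series $\phi$ (evaluated at real $y>0$) with $g(\phi(y),y)\not\equiv0$, $\ell(\phi):=\dfrac{\mathrm{ord}_y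 f(\phi(y),y)}{\mathrm{ord}_y g(\phi(y),y)}$.
   Formalization: In V_a(fg) only approximations that are real Puiseux series are counted; with non-real ones the claim fails: f=((x-y^2)^2+y^2)((x+y^2)^2+y^2), g=x has exponent 4, but the approximation iy+cy^2 gives ratio 6. *)

(* Defs.v *)
From HB Require Import structures.
From mathcomp Require Import all_boot all_order all_algebra.
From mathcomp Require Import all_classical all_reals.
From mathcomp Require Import topology normedtype sequences exp.
From mathcomp Require Import complex.

Set Implicit Arguments.
Unset Strict Implicit.
Unset Printing Implicit Defensive.

Import Order.TTheory GRing.Theory Num.Theory numFieldNormedType.Exports.
Local Open Scope ring_scope.

(* Real analytic germs at 0 in R^2, represented by their (convergent)   *)
(* Taylor coefficients a i j  (coefficient of x^i y^j).                 *)

Section Germs.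
Variable R : realType.

Definition cps (a : nat -> nat -> R) : Prop :=
  exists M s : R, 0 < s /\ forall i j, `|a i j| <= M * s ^+ (i + j).

Definition pseval (a : nat -> nat -> R) (x y : R) : R :=
  limn (series (fun n : nat =>
    \sum_(i < n.+1) a i (n - i)%N * x ^+ i * y ^+ (n - i)%N)).

Definition nonzero_germ (a : nat -> nat -> R) : Prop := exists i j, a i j != 0.

(* regular in x: f = f_m + f_{m+1} + ..., f_m <> 0, and f_m(1,0) <> 0 *)
Definition regular_x (a : nat -> nat -> R) : Prop :=
  exists m : nat, (forall i j, (i + j < m)%N -> a i j = 0) /\ a m 0%N != 0.

Definition zero_germ_incl (a b : nat -> nat -> R) : Prop :=
  exists r : R, 0 < r /\ forall x y : R, x ^+ 2 + y ^+ 2 < r ^+ 2 ->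
    pseval a x y = 0 -> pseval b x y = 0.

Definition flipy (a : nat -> nat -> R) : nat -> nat -> R :=
  fun i j => (-1) ^+ j * a i j.

Definition psmul (a b : nat -> nat -> R) : nat -> nat -> R :=
  fun i j => \sum_(i1 < i.+1) \sum_(j1 < j.+1) a i1 j1 * b (i - i1)%N (j - j1)%N.

Definition loj_admissible (a b : nat -> nat -> R) (al : R) : Prop :=
  0 < al /\ exists C r : R, 0 < C /\ 0 < r /\
    forall x y : R, Num.sqrt (x ^+ 2 + y ^+ 2) <= r ->
      C * (`|pseval b x y| `^ al) <= `|pseval a x y|.

Definition loj_exponent_is (a b : nat -> nat -> R) (L : R) : Prop :=
  (forall al, loj_admissible a b al -> L <= al) /\
  (forall e : R, 0 < e -> exists al, loj_admissible a b al /\ al < L + e).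

(* A representation (N, c) stands for  sum_k c k * y^(k/(N+1)).         *)

Local Open Scope complex_scope.
Notation C := (R[i]).

Record puiseux := Puiseux { pN : nat; pc : nat -> C }.

Definition pden (p : puiseux) : nat := (pN p).+1.

Definition is_puiseux (p : puiseux) : Prop :=
  pc p 0%N = 0 /\
  exists M s : R, 0 < s /\ forall k, Normc.normc (pc p k) <= M * s ^+ k.

Definition real_puiseux (p : puiseux) : Prop :=
  forall k, exists r : R, pc p k = r%:C.

Definition pcoef (p : puiseux) (q : rat) : C :=
  let k := q * (pden p)%:R in
  if (0 <= q) && (denq k == 1) then pc p `|numq k|%N else 0.

(* equality of Puiseux series (independent of the representation) *)
Definition peq (p1 p2 : puiseux) : Prop := forall q, pcoef p1 q = pcoef p2 q.

Definition ord_diff (p1 p2 : puiseux) (rho : rat) : Prop :=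
  pcoef p1 rho != pcoef p2 rho /\
  forall q, q < rho -> pcoef p1 q = pcoef p2 q.

Definition is_approx (p : puiseux) (rho : rat) (c : R) (psi : puiseux) : Prop :=
  is_puiseux psi /\
  forall q, pcoef psi q =
    (if q < rho then pcoef p q else if q == rho then c%:C else 0).

(* formal power series in t (one variable) and in (x,t) (two variables) *)
Definition mulS (s u : nat -> C) : nat -> C :=
  fun n => \sum_(j < n.+1) s j * u (n - j)%N.
Definition oneS : nat -> C := fun n => if n == 0%N then 1 else 0.
Definition powS (s : nat -> C) (i : nat) : nat -> C := iter i (mulS s) oneS.

Definition mul2 (u v : nat -> nat -> C) : nat -> nat -> C :=
  fun i k => \sum_(i1 < i.+1) \sum_(k1 < k.+1) u i1 k1 * v (i - i1)%N (k - k1)%N.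
Definition one2 : nat -> nat -> C :=
  fun i k => if (i == 0%N) && (k == 0%N) then 1 else 0.
Definition pow2 (u : nat -> nat -> C) (m : nat) : nat -> nat -> C :=
  iter m (mul2 u) one2.

(* f(x, t^N) as a two-variable series, N = pden p *)
Definition lift (a : nat -> nat -> R) (N : nat) : nat -> nat -> C :=
  fun i k => if (N %| k)%N then (a i (k %/ N)%N)%:C else 0.

Definition xminus (p : puiseux) : nat -> nat -> C :=
  fun i k => if i == 1%N then (if k == 0%N then 1 else 0)
             else if i == 0%N then - pc p k else 0.

Definition subst2 (h : nat -> nat -> C) (p : puiseux) : nat -> C :=
  fun n => \sum_(i < n.+1) \sum_(k < n.+1) h i k * powS (pc p) i (n - k)%N.

(* f(p(y), y) as a series in t = y^(1/N) *)
Definition fsubst (a : nat -> nat -> R) (p : puiseux) : nat -> C :=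
  subst2 (lift a (pden p)) p.

Definition np_root (a : nat -> nat -> R) (p : puiseux) : Prop :=
  is_puiseux p /\ forall n, fsubst a p n = 0.

Definition mult_factor (a : nat -> nat -> R) (p : puiseux) (m : nat) : Prop :=
  exists h : nat -> nat -> C,
    (forall i k, lift a (pden p) i k = mul2 (pow2 (xminus p) m) h i k) /\
    exists n, subst2 h p n != 0.

Definition multiplicity_is (a : nat -> nat -> R) (p : puiseux) (m : nat) : Prop :=
  mult_factor a p m /\ forall m', mult_factor a p m' -> (m' <= m)%N.

Definition ord_is (s : nat -> C) (n : nat) : Prop :=
  s n != 0 /\ forall k, (k < n)%N -> s k = 0.

(* ell(p) = ord_y f(p(y),y) / ord_y g(p(y),y)  (the factor 1/N cancels) *)
Definition ell_is (a b : nat -> nat -> R) (p : puiseux) (L : R) : Prop :=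
  exists n1 n2 : nat, ord_is (fsubst a p) n1 /\ ord_is (fsubst b p) n2 /\
    L = n1%:R / n2%:R.

(* L is the value of ell at the (real) approximation of the pair (p1,p2)
   of distinct Newton--Puiseux roots of F, for a generic real c
   (i.e. for all c outside a finite set) *)
Definition approx_value (F a b : nat -> nat -> R) (L : R) : Prop :=
  exists p1 p2 : puiseux, exists rho : rat,
    np_root F p1 /\ np_root F p2 /\ ~ peq p1 p2 /\ ord_diff p1 p2 rho /\
    exists s : seq R, forall c : R, c \notin s ->
      exists psi, is_approx p1 rho c psi /\ real_puiseux psi /\ ell_is a b psi L.

Definition common_root_ratio (a b : nat -> nat -> R) (L : R) : Prop :=
  exists (beta : puiseux) (m n : nat),
    real_puiseux beta /\ np_root a beta /\ np_root b beta /\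
    multiplicity_is a beta m /\ multiplicity_is b beta n /\
    L = m%:R / n%:R.

Definition Lplus_set (a b : nat -> nat -> R) : set R :=
  [set L | approx_value (psmul a b) a b L \/ common_root_ratio a b L].

Definition is_max (S : set R) (L : R) : Prop :=
  S L /\ forall x, S x -> x <= L.

End Germs.

(* Main.v *)
Require Import Defs.
From HB Require Import structures.
From mathcomp Require Import all_boot all_order all_algebra.
From mathcomp Require Import all_classical all_reals.
From mathcomp Require Import topology normedtype sequences exp.
From mathcomp Require Import complex.
From mathcomp Require Import zify ring lra.

(* Over C{t}, with y = t^N, both germs factor as a unit times a product of linear
   factors x - phi(t) (Newton-Puiseux).  Hence near the origin, for y > 0, |f| and |g|
   are comparable to the products of the distances |x - phi(t)|.

   Every element of [Lplus_set] bounds each admissible exponent from below: compare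
   orders along the real curve x = psi(y), resp. along x = beta(y) + y^(K/N) with K
   tending to infinity for a common root beta.

   Conversely, let phi be the root nearest to (x, y) and |x - phi(t)| = t^s.  Then
   |x - psi(t)| is comparable to t^(min(s, ord(phi - psi))) for every root psi, so
   |f| >= C |g|^alpha reduces to H(s) <= 0, where H is the piecewise linear function
     sum_(f(psi) = 0) min(s, ord(phi - psi)) - alpha sum_(g(psi) = 0) min(s, ord(phi - psi)).
   It suffices to check H at the break points, which are the orders along the
   approximations of phi, and its final slope, which is governed by the multiplicities
   of phi.  If phi is not real, s is bounded by ord(phi - conj phi), and conj phi is
   again a root; so only real approximations matter.

   The maximum defining L^+ then needs no classification of the roots: the largest of
   the finitely many values found above is an admissible exponent on y >= 0, hence an
   upper bound of the whole set. *)

Set Implicit Arguments.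
Unset Strict Implicit.
Unset Printing Implicit Defensive.

Import Order.TTheory GRing.Theory Num.Theory numFieldNormedType.Exports.
Local Open Scope ring_scope.
Local Open Scope complex_scope.

(** * Formal power series *)

(** One [N] with [y = t^N] serves all roots of both germs, so orders in [t] are integers and every
    value of ell is a quotient of two of them. The algebra takes place in [fps (fps C)], that is
    [C[[t]][[x]]], since the germs are not polynomial in [x]; convergence is a separate predicate.
    Values enter by restricting a series to a line through the origin: an identity between series in
    two variables becomes one between sums in one variable. The parametrization reaches only
    [y > 0]. The half plane [y < 0] is the same statement for the reflected germs, and the axis
    [y = 0] needs a comparison of the orders in [x], which is H at a point to the left of all break
    points. The inclusion of the zero sets makes g vanish at 0 and every real root of f a root of g;
    for a real root of f alone, the final slope of H would be positive whatever alpha is. For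
    nonreal phi, the break points up to ord(phi - conj phi) suffice; below that order phi and conj
    phi have equal, hence real, coefficients. *)

Record fps (A : Type) := Fps { fps_coef :> nat -> A }.

HB.instance Definition _ (A : Type) := gen_eqMixin (fps A).
HB.instance Definition _ (A : Type) := gen_choiceMixin (fps A).

Lemma fpsP (A : Type) (f g : fps A) : (forall n, f n = g n) -> f = g.
Proof. by case: f g => f [g] /= fg; congr Fps; apply: funext. Qed.

Section FpsRing.
Variable A : comNzRingType.
Implicit Types f g h : fps A.

Definition fps_add f g := Fps (fun n => f n + g n).
Definition fps_opp f := Fps (fun n => - f n).

Fact fps_addA : associative fps_add.
Proof. by move=> f g h; apply: fpsP => n /=; rewrite addrA. Qed.
Fact fps_addC : commutative fps_add.
Proof. by move=> f g; apply: fpsP => n /=; rewrite addrC. Qed.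
Fact fps_add0 : left_id (Fps (fun=> 0)) fps_add.
Proof. by move=> f; apply: fpsP => n /=; rewrite add0r. Qed.
Fact fps_addN : left_inverse (Fps (fun=> 0)) fps_opp fps_add.
Proof. by move=> f; apply: fpsP => n /=; rewrite addNr. Qed.

HB.instance Definition _ :=
  GRing.isZmodule.Build (fps A) fps_addA fps_addC fps_add0 fps_addN.

Definition fps_const (a : A) := Fps (fun n => if n == 0%N then a else 0).
Definition fps_mul f g := Fps (fun n => \sum_(j < n.+1) f j * g (n - j)%N).

Lemma fps_mulE f g n : fps_mul f g n = \sum_(j < n.+1) f j * g (n - j)%N.
Proof. by []. Qed.

Definition trunc (L : nat) f : {poly A} := \poly_(i < L) f i.

Lemma coef_trunc L f i : (trunc L f)`_i = if (i < L)%N then f i else 0.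
Proof. by rewrite coef_poly. Qed.

(** Coefficients below [L] see only the truncations, so the ring axioms are inherited from
    polynomials. *)
Lemma fps_mul_trunc L f g n : (n < L)%N ->
  fps_mul f g n = (trunc L f * trunc L g)`_n.
Proof.
move=> nL; rewrite coefM; apply: eq_bigr => -[j /= jn] _.
by rewrite !coef_trunc !ifT //; lia.
Qed.

Fact fps_mulC : commutative fps_mul.
Proof.
by move=> f g; apply: fpsP => n; rewrite !(@fps_mul_trunc n.+1) // mulrC.
Qed.

Fact fps_mulA : associative fps_mul.
Proof.
move=> f g h; apply: fpsP => n.
have E u v w : fps_mul (fps_mul u v) w n
    = (trunc n.+1 u * trunc n.+1 v * trunc n.+1 w)`_n.
  rewrite coefM fps_mulE; apply: eq_bigr => -[j jn] _.
  by rewrite [nat_of_ord _]/= (@fps_mul_trunc n.+1) // [in RHS]coef_trunc ifT // ltnS leq_subr.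
by rewrite fps_mulC !E mulrC mulrA.
Qed.

Fact fps_mul1 : left_id (fps_const 1) fps_mul.
Proof.
move=> f; apply: fpsP => n /=.
rewrite big_ord_recl /= mul1r subn0 big1 ?addr0 // => i _.
by rewrite /bump /= mul0r.
Qed.

Fact fps_mulDl : left_distributive fps_mul fps_add.
Proof.
move=> f g h; apply: fpsP => n /=.
by rewrite -big_split /=; apply: eq_bigr => i _; rewrite mulrDl.
Qed.

Fact fps_one_neq0 : fps_const 1 != 0.
Proof. by apply/eqP => /(congr1 (fun f : fps A => f 0%N)) /eqP; rewrite /= oner_eq0. Qed.

HB.instance Definition _ := GRing.Zmodule_isComNzRing.Build (fps A)
  fps_mulA fps_mulC fps_mul1 fps_mulDl fps_one_neq0.

(** Inverses are chosen classically: this structure is a prerequisite of [idomainType], which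
    provides cancellation and the lemmas on vanishing products. No inverse series is computed. *)
Definition fps_unit f := `[< exists g, g * f = 1 >].
Definition fps_inv f : fps A :=
  if pselect (exists g, g * f = 1) is left e then projT1 (cid e) else f.

Fact fps_mulV : {in fps_unit, left_inverse 1 fps_inv *%R}.
Proof.
move=> f /asboolP e; rewrite /fps_inv; case: pselect => // e'.
by case: cid.
Qed.
Fact fps_unitP f g : g * f = 1 -> fps_unit f.
Proof. by move=> gf; apply/asboolP; exists g. Qed.
Fact fps_inv_out : {in [predC fps_unit], fps_inv =1 id}.
Proof.
by move=> f /asboolP e; rewrite /fps_inv; case: pselect.
Qed.

HB.instance Definition _ := GRing.ComNzRing_hasMulInverse.Build (fps A)
  fps_mulV fps_unitP fps_inv_out.

Lemma fps_coefD f g n : (f + g) n = f n + g n. Proof. by []. Qed.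
Lemma fps_coefN f n : (- f) n = - f n. Proof. by []. Qed.
Lemma fps_coefB f g n : (f - g) n = f n - g n. Proof. by []. Qed.
Lemma fps_coef0 n : (0 : fps A) n = 0. Proof. by []. Qed.
Lemma fps_coef1 n : (1 : fps A) n = (n == 0%N)%:R.
Proof. by rewrite /= ; case: eqP. Qed.
Lemma fps_coefM f g n : (f * g) n = \sum_(j < n.+1) f j * g (n - j)%N.
Proof. by []. Qed.
Lemma fps_coef_sum I (r : seq I) (P : pred I) (F : I -> fps A) n :
  (\sum_(i <- r | P i) F i) n = \sum_(i <- r | P i) F i n.
Proof. by apply: (big_morph (fun f : fps A => f n)). Qed.
Lemma fps_coefMn f k n : (f *+ k) n = f n *+ k.
Proof. by elim: k => [|k IH]; rewrite ?mulr0n // !mulrS fps_coefD IH. Qed.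
Lemma fps_coefM0 f g : (f * g) 0%N = f 0%N * g 0%N.
Proof. by rewrite fps_coefM big_ord_recl big_ord0 addr0. Qed.
Lemma mul_fps_const a f n : (fps_const a * f) n = a * f n.
Proof.
rewrite fps_coefM big_ord_recl /= subn0 big1 ?addr0 // => i _.
by rewrite mul0r.
Qed.

Definition fps_X := Fps (fun n => if n == 1%N then 1 else 0 : A).

Lemma mul_fps_X f n : (fps_X * f) n = if n is n'.+1 then f n' else 0.
Proof.
rewrite fps_coefM; case: n => [|n].
  by rewrite big_ord_recl big_ord0 /= mul0r addr0.
rewrite !big_ord_recl /= mul0r add0r mul1r subSS subn0 big1 ?addr0 // => i _.
by rewrite mul0r.
Qed.

Lemma mul_fps_Xn k f n :
  (fps_X ^+ k * f) n = if (k <= n)%N then f (n - k)%N else 0.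
Proof.
elim: k n => [|k IH] n; first by rewrite expr0 mul1r subn0.
by rewrite exprS -mulrA mul_fps_X; case: n => [|n] //; rewrite IH subSS.
Qed.

(** * Order of vanishing *)

Definition vge (k : nat) f := forall n, (n < k)%N -> f n = 0.

Lemma vgeW k l f : (k <= l)%N -> vge l f -> vge k f.
Proof. by move=> kl fl n nk; apply: fl; apply: leq_trans kl. Qed.
Lemma vgeD k f g : vge k f -> vge k g -> vge k (f + g).
Proof. by move=> fk gk n nk; rewrite fps_coefD fk ?gk ?addr0. Qed.
Lemma vge_sum k I (r : seq I) (P : pred I) (F : I -> fps A) :
  (forall i, P i -> vge k (F i)) -> vge k (\sum_(i <- r | P i) F i).
Proof. by move=> H; apply: big_ind => //; apply: vgeD. Qed.
Lemma vgeM k l f g : vge k f -> vge l g -> vge (k + l) (f * g).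
Proof.
move=> fk gl n nkl; rewrite fps_coefM big1 // => -[j /= jn] _.
have [jk|kj] := ltnP j k; first by rewrite fk ?mul0r.
by rewrite gl ?mulr0 //; lia.
Qed.
Lemma vgeX k f i : vge k f -> vge (k * i) (f ^+ i).
Proof.
move=> fk; elim: i => [|i IH]; first by rewrite muln0.
by rewrite exprS mulnS; apply: vgeM.
Qed.
Lemma vgeX1 f i : f 0%N = 0 -> vge i (f ^+ i).
Proof. by move=> f0; have := @vgeX 1 f i; rewrite mul1n; apply => -[]. Qed.
Lemma vgeMl k f g : vge k f -> vge k (f * g).
Proof. by move=> fk; rewrite -[k]addn0; apply: vgeM. Qed.
Lemma vgeMr k f g : vge k g -> vge k (f * g).
Proof. by rewrite mulrC; apply: vgeMl. Qed.
Definition ford (f : fps A) (n : nat) := f n != 0 /\ vge n f.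

Lemma ford_exists f : f != 0 -> exists n, ford f n.
Proof.
move=> f0; have ex : exists n, f n != 0.
  apply: contrapT => H; move/eqP: f0; apply; apply: fpsP => n.
  by apply/eqP; apply: contrapT => /negP fn; apply: H; exists n.
exists (ex_minn ex); case: ex_minnP => m fm mmin; split=> // k km.
by apply/eqP; apply: contraTT km => fk; rewrite -leqNgt mmin.
Qed.

Lemma ford_neq0 f n : ford f n -> f != 0.
Proof. by case=> fn _; apply: contraNneq fn => ->. Qed.

Lemma ford_uniq f n m : ford f n -> ford f m -> n = m.
Proof.
move=> [fn vn] [fm vm]; case: (ltngtP n m) => // h.
  by rewrite vm ?eqxx in fn.
by rewrite vn ?eqxx in fm.
Qed.

Lemma ford_coefM f g n m : vge n f -> vge m g -> (f * g) (n + m)%N = f n * g m.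
Proof.
move=> vf vg; rewrite fps_coefM.
have nm : (n < (n + m).+1)%N by rewrite ltnS leq_addr.
rewrite (bigD1 (Ordinal nm)) //= addKn big1 ?addr0 // => -[j /= jn].
rewrite -val_eqE /= => jne; have [jk|kj] := ltnP j n; first by rewrite vf ?mul0r.
by rewrite vg ?mulr0 //; lia.
Qed.

Lemma ford0 f : f 0%N != 0 -> ford f 0.
Proof. by []. Qed.

Lemma ford_Xn k : ford (fps_X ^+ k) k.
Proof.
split; first by rewrite -[_ ^+ k]mulr1 mul_fps_Xn leqnn subnn /= oner_eq0.
by move=> n nk; rewrite -[_ ^+ k]mulr1 mul_fps_Xn leqNgt nk.
Qed.

End FpsRing.

Arguments fps_X {A}.

Section FpsDomain.
Variable A : idomainType.

Lemma fordM (f g : fps A) n m : ford f n -> ford g m -> ford (f * g) (n + m).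
Proof.
move=> [fn vf] [gm vg]; split; first by rewrite ford_coefM // mulf_neq0.
exact: vgeM.
Qed.

Fact fps_integral (f g : fps A) : f * g = 0 -> (f == 0) || (g == 0).
Proof.
move=> fg; apply: contraT; rewrite negb_or => /andP[/ford_exists[n fn]].
move=> /ford_exists[m gm]; have := ford_neq0 (fordM fn gm).
by rewrite fg eqxx.
Qed.

HB.instance Definition _ :=
  GRing.ComUnitRing_isIntegral.Build (fps A) fps_integral.

Lemma fordX (f : fps A) n k : ford f n -> ford (f ^+ k) (k * n).
Proof.
move=> fn; elim: k => [|k IH]; first by rewrite expr0 mul0n; apply: ford0; rewrite oner_eq0.
by rewrite exprS mulSn; apply: fordM.
Qed.

End FpsDomain.

(** * Substitution [x := phi(t)] in [A[[t]][[x]]], for [phi(0) = 0] *)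

Section Evaluation.
Variable A : comNzRingType.
Implicit Types (phi psi : fps A) (f g h : fps (fps A)).

(* Locked: unfolding substitutions makes conversion tests blow up. *)
Fact ev_key : unit. Proof. exact: tt. Qed.
Definition ev phi f : fps A :=
  locked_with ev_key (Fps (fun n => (trunc n.+1 f).[phi] n)).

Lemma ev_coefE phi f n : ev phi f n = (trunc n.+1 f).[phi] n.
Proof. by rewrite /ev unlock. Qed.

(** Without constant term, [phi ^+ i] vanishes to order [i]; hence each coefficient of a
    substitution depends on finitely many terms. *)
Lemma horner_vge L (p : {poly fps A}) phi : phi 0%N = 0 ->
  (forall i, (i < L)%N -> p`_i = 0) -> vge L p.[phi].
Proof.
move=> phi0 pL; rewrite horner_coef; apply: vge_sum => i _.
have [iL|Li] := ltnP i L; first by rewrite pL // mul0r.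
by apply: vgeMr; apply: vgeW Li _; apply: vgeX1.
Qed.

Lemma evE L phi f n : phi 0%N = 0 -> (n < L)%N -> ev phi f n = (trunc L f).[phi] n.
Proof.
move=> phi0 nL; apply/eqP; rewrite eq_sym ev_coefE.
rewrite -subr_eq0 -fps_coefB -hornerN -hornerD; apply/eqP/(@horner_vge n.+1) => // i iL.
by rewrite coefB !coef_trunc iL (leq_trans iL nL) subrr.
Qed.

Lemma ev_sumE L phi f n : phi 0%N = 0 -> (n < L)%N ->
  ev phi f n = \sum_(i < L) (f i * phi ^+ i) n.
Proof. by move=> phi0 nL; rewrite (evE _ phi0 nL) horner_poly fps_coef_sum. Qed.

Lemma evD phi f g : phi 0%N = 0 -> ev phi (f + g) = ev phi f + ev phi g.
Proof.
move=> phi0; apply: fpsP => n; rewrite fps_coefD !(@ev_sumE n.+1) //.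
by rewrite -big_split; apply: eq_bigr => i _; rewrite fps_coefD mulrDl.
Qed.

Lemma evN phi f : phi 0%N = 0 -> ev phi (- f) = - ev phi f.
Proof.
move=> phi0; apply: fpsP => n; rewrite fps_coefN !(@ev_sumE n.+1) //.
by rewrite -sumrN; apply: eq_bigr => i _; rewrite fps_coefN mulNr.
Qed.

Lemma evB phi f g : phi 0%N = 0 -> ev phi (f - g) = ev phi f - ev phi g.
Proof. by move=> phi0; rewrite evD // evN. Qed.

Lemma evM phi f g : phi 0%N = 0 -> ev phi (f * g) = ev phi f * ev phi g.
Proof.
move=> phi0; apply: fpsP => n; set L := n.+1.
have -> : (ev phi f * ev phi g) n = ((trunc L f).[phi] * (trunc L g).[phi]) n.
  rewrite !fps_coefM; apply: eq_bigr => -[j jn] _; rewrite [nat_of_ord _]/=.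
  by rewrite !(@evE L) // /L ltnS leq_subr.
rewrite (@evE L) // -hornerM; apply/eqP; rewrite -subr_eq0 -fps_coefB -hornerN -hornerD.
apply/eqP/(@horner_vge L) => // i iL.
by rewrite coefB coef_trunc iL -(@fps_mul_trunc _ L) // subrr.
Qed.

Lemma ev_const phi (a : fps A) : phi 0%N = 0 -> ev phi (fps_const a) = a.
Proof.
move=> phi0; apply: fpsP => n; rewrite (@ev_sumE n.+1) // big_ord_recl expr0 mulr1.
by rewrite big1 ?addr0 // => i _; rewrite mul0r.
Qed.

Lemma ev_X phi : phi 0%N = 0 -> ev phi fps_X = phi.
Proof.
move=> phi0; apply: fpsP => n; rewrite (@evE n.+2) //.
suff -> : trunc n.+2 fps_X = 'X :> {poly fps A} by rewrite hornerX.
by apply/polyP => k; rewrite coef_trunc coefX /=; case: ltnP; case: eqP => //; lia.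
Qed.

Lemma ev_1 phi : phi 0%N = 0 -> ev phi 1 = 1.
Proof. by move=> phi0; rewrite -[RHS](ev_const 1 phi0). Qed.

Lemma evX phi f k : phi 0%N = 0 -> ev phi (f ^+ k) = ev phi f ^+ k.
Proof.
move=> phi0; elim: k => [|k IH]; first by rewrite !expr0 ev_1.
by rewrite !exprS evM ?IH.
Qed.

Lemma ev_prod phi (I : Type) (r : seq I) (F : I -> fps (fps A)) : phi 0%N = 0 ->
  ev phi (\prod_(i <- r) F i) = \prod_(i <- r) ev phi (F i).
Proof.
move=> phi0; elim: r => [|i r IH]; first by rewrite !big_nil ev_1.
by rewrite !big_cons evM ?IH.
Qed.

Lemma ev_coef0 phi f : phi 0%N = 0 -> ev phi f 0%N = f 0%N 0%N.
Proof.
by move=> phi0; rewrite (@ev_sumE 1) // big_ord_recl big_ord0 expr0 mulr1 addr0.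
Qed.

Definition xsub (phi : fps A) : fps (fps A) := fps_X - fps_const phi.

Lemma ev_xsub phi psi : phi 0%N = 0 -> ev phi (xsub psi) = phi - psi.
Proof. by move=> phi0; rewrite evB // ev_X // ev_const. Qed.

Definition xshift (k : nat) f : fps (fps A) := Fps (fun j => f (k + j)%N).

Lemma ev_xshift phi f k : phi 0%N = 0 ->
  ev phi (xshift k f) = f k + phi * ev phi (xshift k.+1 f).
Proof.
move=> phi0; transitivity (ev phi (fps_const (f k) + fps_X * xshift k.+1 f)); last first.
  by rewrite evD // evM // ev_const // ev_X.
congr (ev phi _); apply: fpsP => -[|n].
  by rewrite fps_coefD mul_fps_X /= addn0 addr0.
by rewrite fps_coefD mul_fps_X /= add0r addSnnS.
Qed.

(** Synthetic division by [x - phi]: the coefficients of the quotient are the intermediate values of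
    Horner's scheme [ev_xshift]. *)
Definition quotx phi f : fps (fps A) := Fps (fun i => ev phi (xshift i.+1 f)).

Lemma xsub_quotx phi f : phi 0%N = 0 -> ev phi f = 0 -> f = xsub phi * quotx phi f.
Proof.
move=> phi0 fphi; have f0 : ev phi (xshift 0 f) = 0.
  by rewrite -fphi; congr (ev phi _); apply: fpsP.
apply: fpsP => -[|i]; rewrite mulrBl fps_coefB mul_fps_X mul_fps_const /=.
  by apply/eqP; rewrite sub0r -addr_eq0 -ev_xshift ?f0.
by rewrite ev_xshift // addrK.
Qed.

Definition hasse (i : nat) f : fps (fps A) :=
  Fps (fun j => f (i + j)%N *+ 'C(i + j, i)).

(** This is [f(phi + x)] as a series in [x]; [hasse i] is the divided derivative, the analogue for
    series of [nderivn]. *)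
Definition taylor phi f : fps (fps A) := Fps (fun i => ev phi (hasse i f)).

(** Differentiating a truncation [i] times costs [i] orders of accuracy; in the Taylor formula the
    factor [psi ^+ i] gives them back. *)
Lemma ev_trunc_nderiv L phi f i : phi 0%N = 0 ->
  vge (L - i) ((trunc L f)^`N(i).[phi] - taylor phi f i).
Proof.
move=> phi0 n nLi; rewrite fps_coefB /taylor [X in _ - X](@evE (L - i)) //.
rewrite -fps_coefB -hornerN -hornerD.
apply: (@horner_vge n.+1) => // j jn.
rewrite coefB coef_nderivn !coef_trunc !ifT ?subrr //; lia.
Qed.

Lemma ev_taylor phi psi f : phi 0%N = 0 -> psi 0%N = 0 ->
  ev psi (taylor phi f) = ev (phi + psi) f.
Proof.
move=> phi0 psi0; apply: fpsP => n; set L := n.+1.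
have pp0 : (phi + psi) 0%N = 0 by rewrite fps_coefD phi0 psi0 addr0.
rewrite (@ev_sumE L) // (@evE L) // (@nderiv_taylor_wide _ L); first last.
- exact: size_poly.
- exact: mulrC.
rewrite fps_coef_sum; apply: eq_bigr => -[i iL] _; rewrite [nat_of_ord _]/=.
apply/eqP; rewrite eq_sym -subr_eq0 -fps_coefB -mulrBl.
apply/eqP; have /vgeM vp := @ev_trunc_nderiv L phi f i phi0.
by apply: (vp _ _ (vgeX1 psi0)); rewrite subnK // ltnW.
Qed.

(** In the Taylor expansion at [psi] the quadratic remainder has order at least [2n], and the
    derivative at [psi] differs from its constant term by a series of positive order. The order
    gained over [n] is what makes the iteration of the implicit function theorem contracting. *)
Lemma ev_congr n phi psi f : (0 < n)%N -> phi 0%N = 0 -> psi 0%N = 0 ->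
  vge n (phi - psi) ->
  vge n.+1 (ev phi f - ev psi f - fps_const (f 1%N 0%N) * (phi - psi)).
Proof.
move=> n0 phi0 psi0 vn; set eta := phi - psi.
have eta0 : eta 0%N = 0 by apply: vn.
have -> : phi = psi + eta by rewrite addrC subrK.
rewrite -ev_taylor //.
have -> : taylor psi f = xshift 0 (taylor psi f) by apply: fpsP.
rewrite ev_xshift // ev_xshift //.
have -> : taylor psi f 0%N = ev psi f.
  by congr ev; apply: fpsP => j /=; rewrite bin0 mulr1n.
set r := ev eta _; set b := taylor psi f 1%N; set c := fps_const _.
have -> : ev psi f + eta * (b + eta * r) - ev psi f - c * eta = eta * (b - c) + eta * eta * r.
  by ring.
apply: vgeD; last by apply: vgeMl; apply: (@vgeW _ _ (n + n)); [lia | apply: vgeM].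
rewrite -[n.+1]addn1; apply: vgeM => // -[] // _.
by rewrite fps_coefB [b _](@ev_coef0 psi) // /c /= bin1 mulr1n subrr.
Qed.

End Evaluation.

(** * Ramification [t := t^q] and rescaling [t := c t] *)

Section Ramification.
Variable A : comNzRingType.
Implicit Types (f g phi : fps A) (q : nat).

(* [q.-1.+1] is [q] for [0 < q]; it makes [ram q] a ring morphism for every [q]. *)
Definition ram q f : fps A :=
  Fps (fun n => if (q.-1.+1 %| n)%N then f (n %/ q.-1.+1)%N else 0).

Lemma ramE q f n : (0 < q)%N ->
  ram q f n = if (q %| n)%N then f (n %/ q)%N else 0.
Proof. by case: q. Qed.

Lemma ram_trunc q L f n : (n < L)%N -> ram q f n = (trunc L f \Po 'X^(q.-1.+1))`_n.
Proof.
move=> nL; rewrite coef_comp_poly_Xn // coef_trunc /=; case: ifP => // _.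
by rewrite ifT // (leq_ltn_trans (leq_div _ _)).
Qed.

Fact ram_zmod q : zmod_morphism (ram q).
Proof. by move=> f g; apply: fpsP => n; rewrite /= ; case: ifP => //; rewrite subr0. Qed.

Fact ram_monoid q : monoid_morphism (ram q).
Proof.
split.
  apply: fpsP => n; rewrite /ram [LHS]/= !fps_coef1; case: ifP => [/dvdnP[k ->]|].
    by rewrite mulnK // muln_eq0 orbF; case: (k == 0%N).
  by case: n => [|n]; rewrite ?dvdn0.
move=> f g; apply: fpsP => n; have -> : (ram q f * ram q g) n =
    ((trunc n.+1 f \Po 'X^(q.-1.+1)) * (trunc n.+1 g \Po 'X^(q.-1.+1)))`_n.
  rewrite fps_coefM coefM; apply: eq_bigr => -[j /= jn] _.
  by rewrite -!(@ram_trunc q n.+1) // ltnS leq_subr.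
rewrite -comp_polyM coef_comp_poly_Xn //; rewrite [LHS]/=; case: ifP => // _.
by rewrite -fps_mul_trunc // ltnS leq_div.
Qed.

HB.instance Definition _ q :=
  GRing.isZmodMorphism.Build (fps A) (fps A) (ram q) (ram_zmod q).
HB.instance Definition _ q :=
  GRing.isMonoidMorphism.Build (fps A) (fps A) (ram q) (ram_monoid q).

Lemma ramM q : {morph ram q : f g / f * g}. Proof. exact: rmorphM. Qed.

Lemma ram1 f : ram 1 f = f.
Proof. by apply: fpsP => n; rewrite ramE // dvd1n divn1. Qed.

Lemma ram_ram p q f : (0 < p)%N -> (0 < q)%N -> ram p (ram q f) = ram (p * q) f.
Proof.
move=> p0 q0; apply: fpsP => n; rewrite !ramE ?muln_gt0 ?p0 //.
case: (boolP (p %| n)%N) => [/dvdnP[k ->]|pn]; last first.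
  by rewrite ifF //; apply/negP => /(dvdn_trans (dvdn_mulr _ (dvdnn p))); apply/negP.
by rewrite mulnK // [(p * q)%N]mulnC dvdn_pmul2r // divnMr.
Qed.

Lemma ram_coef0 q f : ram q f 0%N = f 0%N.
Proof. by rewrite -[LHS]/(if (q.-1.+1 %| 0)%N then f (0 %/ q.-1.+1)%N else 0) dvdn0 div0n. Qed.

Lemma ram_Xn q k : (0 < q)%N -> ram q (fps_X ^+ k) = fps_X ^+ (q * k).
Proof.
move=> q0; rewrite exprM rmorphXn /=; congr (_ ^+ k); apply: fpsP => n.
rewrite ramE // -[fps_X ^+ q]mulr1 mul_fps_Xn fps_coef1 /=.
case: ifP => [/dvdnP[m ->]|qn].
  rewrite mulnK //; case: m => [|[|m]] /=; last by rewrite ifT; [case: eqP => //; nia|nia].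
    by rewrite mul0n leqNgt q0.
  by rewrite mul1n leqnn subnn.
case: ifP => // qlen; case: eqP => // qn'; move: qn; rewrite (_ : n = q) ?dvdnn //; lia.
Qed.

Lemma ford_ram q f n : (0 < q)%N -> ford f n -> ford (ram q f) (q * n).
Proof.
move=> q0 [fn vf]; split; first by rewrite ramE // dvdn_mulr // mulKn.
move=> k kqn; rewrite ramE //; case: ifP => // /dvdnP[m mk].
by rewrite mk mulnK // vf //; move: kqn; rewrite mk mulnC ltn_pmul2l.
Qed.

Definition map_fps (B B' : Type) (h : B -> B') (f : fps B) := Fps (fun i => h (f i)).

Lemma map_fpsM (B B' : comNzRingType) (h : {rmorphism B -> B'}) :
  {morph map_fps h : f g / f * g}.
Proof.
move=> f g; apply: fpsP => n; rewrite !fps_coefM [LHS]/= rmorph_sum.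
by apply: eq_bigr => j _; rewrite rmorphM.
Qed.

Definition ram2 q (f : fps (fps A)) : fps (fps A) := map_fps (ram q) f.

Lemma ram2M q : {morph ram2 q : f g / f * g}.
Proof. exact: map_fpsM. Qed.

Lemma ram2_xsub q phi : ram2 q (xsub phi) = xsub (ram q phi).
Proof.
apply: fpsP => k; rewrite -[LHS]/(ram q (xsub phi k)) /xsub !fps_coefB rmorphB.
by congr (_ - _); rewrite /=; case: eqP => _; rewrite ?rmorph1 ?rmorph0.
Qed.

Lemma ram2_ram2 p q (f : fps (fps A)) : (0 < p)%N -> (0 < q)%N -> ram2 p (ram2 q f) = ram2 (p * q) f.
Proof. by move=> p0 q0; apply: fpsP => i; apply: ram_ram. Qed.

Lemma ram2_1 (f : fps (fps A)) : ram2 1 f = f.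
Proof. by apply: fpsP => i; apply: ram1. Qed.

Lemma ram2_prod q (I : Type) (r : seq I) (F : I -> fps (fps A)) :
  ram2 q (\prod_(i <- r) F i) = \prod_(i <- r) ram2 q (F i).
Proof.
elim: r => [|i r IH]; last by rewrite !big_cons ram2M IH.
by rewrite !big_nil; apply: fpsP => -[|i] /=; rewrite ?rmorph1 ?rmorph0.
Qed.

Lemma ev_ram2 q phi (f : fps (fps A)) : (0 < q)%N -> phi 0%N = 0 ->
  ev (ram q phi) (ram2 q f) = ram q (ev phi f).
Proof.
move=> q0 phi0; have rphi0 : ram q phi 0%N = 0 by rewrite ram_coef0.
apply: fpsP => n; rewrite (@ev_sumE _ n.+1) //.
have -> : \sum_(i < n.+1) (ram2 q f i * ram q phi ^+ i) n
   = (ram q (\sum_(i < n.+1) f i * phi ^+ i)) n.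
  rewrite rmorph_sum fps_coef_sum; apply: eq_bigr => i _.
  by rewrite rmorphM rmorphXn.
rewrite !ramE //; case: ifP => // _.
by rewrite (@ev_sumE _ n.+1) ?fps_coef_sum // ltnS leq_div.
Qed.

Lemma taylor_ram2 q phi (f : fps (fps A)) : (0 < q)%N -> phi 0%N = 0 ->
  taylor (ram q phi) (ram2 q f) = ram2 q (taylor phi f).
Proof.
move=> q0 phi0; apply: fpsP => i; rewrite /= -ev_ram2 //; congr ev.
by apply: fpsP => j; rewrite /= rmorphMn.
Qed.

Definition rescale (c : A) f : fps A := Fps (fun n => f n * c ^+ n).

Fact rescale_zmod c : zmod_morphism (rescale c).
Proof. by move=> f g; apply: fpsP => n; rewrite /= mulrBl. Qed.

Fact rescale_monoid c : monoid_morphism (rescale c).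
Proof.
split; first by apply: fpsP => -[|n]; rewrite /= ?mul1r ?expr0 // mul0r.
move=> f g; apply: fpsP => n; rewrite [LHS]/= !fps_coefM mulr_suml.
apply: eq_bigr => -[j /= jn] _.
by rewrite mulrACA -exprD subnKC // -ltnS.
Qed.

HB.instance Definition _ c :=
  GRing.isZmodMorphism.Build (fps A) (fps A) (rescale c) (rescale_zmod c).
HB.instance Definition _ c :=
  GRing.isMonoidMorphism.Build (fps A) (fps A) (rescale c) (rescale_monoid c).

Lemma rescaleM c : {morph rescale c : f g / f * g}. Proof. exact: rmorphM. Qed.

End Ramification.

(** * Convergence *)

Section Modulus.
Variable R : rcfType.
Implicit Types z w : R[i].

Definition nc z : R := Normc.normc z.

Lemma nc_sqr z : nc z ^+ 2 = complex.Re z ^+ 2 + complex.Im z ^+ 2.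
Proof. by case: z => a b; rewrite /nc /= sqr_sqrtr // addr_ge0 ?sqr_ge0. Qed.
Lemma nc_ge0 z : 0 <= nc z. Proof. by case: z => a b; apply: sqrtr_ge0. Qed.
Lemma nc0 : nc 0 = 0. Proof. exact: Normc.normc0. Qed.
Lemma nc1 : nc 1 = 1. Proof. exact: Normc.normc1. Qed.
Lemma ncM z w : nc (z * w) = nc z * nc w. Proof. exact: Normc.normcM. Qed.
Lemma ncN z : nc (- z) = nc z. Proof. by case: z => x y; rewrite /nc /= !sqrrN. Qed.
Lemma ncD z w : nc (z + w) <= nc z + nc w. Proof. exact: le_normcD. Qed.
Lemma nc_eq0 z : (nc z == 0) = (z == 0).
Proof. by apply/eqP/eqP => [/Normc.eq0_normc|->] //; rewrite nc0. Qed.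
Lemma nc_gt0 z : (0 < nc z) = (z != 0).
Proof. by rewrite lt_def nc_ge0 nc_eq0 andbT. Qed.
Lemma ncX z k : nc (z ^+ k) = nc z ^+ k.
Proof. by elim: k => [|k IH]; rewrite ?expr0 ?nc1 // !exprS ncM IH. Qed.
Lemma nc_distC z w : nc (z - w) = nc (w - z).
Proof. by rewrite -ncN opprB. Qed.
Lemma ncB z w : nc (z - w) <= nc z + nc w.
Proof. by rewrite -(ncN w); apply: ncD. Qed.
Lemma ncB_ge z w : nc z - nc w <= nc (z - w).
Proof. by have := ncD (z - w) w; rewrite subrK lerBlDr. Qed.
Lemma nc_sum I (r : seq I) (P : pred I) (F : I -> R[i]) :
  nc (\sum_(i <- r | P i) F i) <= \sum_(i <- r | P i) nc (F i).
Proof.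
apply: (big_ind2 (fun z x => nc z <= x)) => [|z x w y zx wy|//]; first by rewrite nc0.
by apply: le_trans (ncD z w) _; apply: lerD.
Qed.
Lemma nc_prod I (r : seq I) (F : I -> R[i]) :
  nc (\prod_(i <- r) F i) = \prod_(i <- r) nc (F i).
Proof. by elim: r => [|i r IH]; rewrite ?big_nil ?nc1 // !big_cons ncM IH. Qed.
Lemma nc_real (x : R) : nc x%:C = `|x|.
Proof. by rewrite /nc /= expr0n addr0 sqrtr_sqr. Qed.
Lemma ncMn z k : nc (z *+ k) = nc z *+ k.
Proof.
by rewrite -mulr_natr ncM -[k%:R](rmorph_nat (real_complex R)) nc_real ger0_norm ?mulr_natr // ler0n.
Qed.
Lemma Re_le_nc z : `|complex.Re z| <= nc z.
Proof.
rewrite -[`|_|]ger0_norm // -[nc z]ger0_norm ?nc_ge0 // -ler_sqr ?nnegrE ?normr_ge0 //.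
by rewrite !real_normK ?num_real // nc_sqr lerDl sqr_ge0.
Qed.
Lemma Im_le_nc z : `|complex.Im z| <= nc z.
Proof.
rewrite -[`|_|]ger0_norm // -[nc z]ger0_norm ?nc_ge0 // -ler_sqr ?nnegrE ?normr_ge0 //.
by rewrite !real_normK ?num_real // nc_sqr lerDr sqr_ge0.
Qed.
Lemma nc_le_ReIm z : nc z <= `|complex.Re z| + `|complex.Im z|.
Proof.
rewrite -ler_sqr ?nnegrE ?nc_ge0 ?addr_ge0 // nc_sqr sqrrD !real_normK ?num_real //.
by rewrite addrAC -addrA lerD // lerDl mulrn_wge0 // mulr_ge0.
Qed.

End Modulus.

Arguments nc : simpl never.

Lemma bin_le_exp2 n k : ('C(n, k) <= 2 ^ n)%N.
Proof.
elim: n k => [|n IH] [|k] //; first by rewrite bin0 expn_gt0.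
by rewrite binS expnS mul2n -addnn leq_add.
Qed.

(** * Weighted l1-norms of power series *)

Section Norms.
Variable R : realType.
Local Notation C := (R[i]).
Implicit Types (s u phi psi : fps C) (f : fps (fps C)) (rho M : R).

Definition cv1 s := exists M sg : R, 0 < sg /\ forall n, nc (s n) <= M * sg ^+ n.
Definition cv2 f :=
  exists M sg : R, 0 < sg /\ forall i k, nc (f i k) <= M * sg ^+ (i + k).

(* Only partial sums are bounded, so that no limit has to be taken. *)
Definition nb rho s M := forall n, \sum_(k < n) nc (s k) * rho ^+ k <= M.

Lemma nb_ge0 rho s M : nb rho s M -> 0 <= M.
Proof. by move=> /(_ 0%N); rewrite big_ord0. Qed.

Lemma nb_le rho s M M' : M <= M' -> nb rho s M -> nb rho s M'.
Proof. by move=> MM' H n; apply: le_trans (H n) MM'. Qed.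

Lemma nbW rho rho' s M : 0 <= rho' <= rho -> nb rho s M -> nb rho' s M.
Proof.
move=> /andP[r0 rr] H n; apply: le_trans (H n); apply: ler_sum => i _.
by rewrite ler_wpM2l ?nc_ge0 // lerXn2r // nnegrE // (le_trans r0).
Qed.

Lemma nbD rho s u M M' : 0 <= rho -> nb rho s M -> nb rho u M' ->
  nb rho (s + u) (M + M').
Proof.
move=> r0 H H' n; apply: le_trans (lerD (H n) (H' n)); rewrite -big_split /=.
by apply: ler_sum => i _; rewrite -mulrDl ler_wpM2r ?exprn_ge0 // ncD.
Qed.

Lemma nbN rho s M : nb rho s M -> nb rho (- s) M.
Proof. by move=> H n; apply: le_trans (H n); apply: ler_sum => i _; rewrite ncN. Qed.

(** The partial sums are dominated by the coefficients of a product of two polynomials with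
    nonnegative coefficients; completing to all degrees below [2n] and evaluating at 1 gives the
    product of the bounds. *)
Lemma nbM rho s u M M' : 0 <= rho -> nb rho s M -> nb rho u M' ->
  nb rho (s * u) (M * M').
Proof.
move=> r0 H H' n.
pose P (v : fps C) := \poly_(k < n) (nc (v k) * rho ^+ k).
have P0 v k : 0 <= (P v)`_k.
  by rewrite coef_poly; case: ifP => // _; rewrite mulr_ge0 ?nc_ge0 ?exprn_ge0.
have PQ0 v w k : 0 <= (P v * P w)`_k.
  by rewrite coefM; apply: sumr_ge0 => j _; rewrite mulr_ge0.
have E v : (P v).[1] = \sum_(k < n) nc (v k) * rho ^+ k.
  by rewrite horner_poly; apply: eq_bigr => k _; rewrite expr1n mulr1.
have le1 : \sum_(k < n) nc ((s * u) k) * rho ^+ k <= \sum_(k < n) (P s * P u)`_k.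
  apply: ler_sum => -[k kn] _; rewrite [nat_of_ord _]/= fps_coefM coefM.
  apply: le_trans (ler_wpM2r (exprn_ge0 _ r0) (nc_sum _ _ _)) _; rewrite mulr_suml.
  apply: ler_sum => -[j jk] _; rewrite [nat_of_ord _]/= !coef_poly ncM.
  have -> : (j < n)%N by lia.
  have -> : (k - j < n)%N by lia.
  by rewrite mulrACA -exprD subnKC // -ltnS.
apply: le_trans le1 _; apply: (@le_trans _ _ ((P s).[1] * (P u).[1])); last first.
  by apply: ler_pM; rewrite ?E ?H ?H' //; apply: sumr_ge0 => k _; rewrite mulr_ge0 ?nc_ge0 ?exprn_ge0.
rewrite -hornerM (@horner_coef_wide _ (n + n) (P s * P u)); last first.
  apply: leq_trans (size_polyMleq _ _) _; apply: leq_trans (leq_pred _) _.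
  by apply: leq_add; apply: size_poly.
rewrite big_split_ord /=; under [X in _ <= X + _]eq_bigr do rewrite expr1n mulr1.
by rewrite lerDl; apply: sumr_ge0 => k _; rewrite expr1n mulr1.
Qed.

Lemma nb_const rho (c : C) : 0 <= rho -> nb rho (fps_const c) (nc c).
Proof.
move=> r0 [|n]; first by rewrite big_ord0 nc_ge0.
rewrite big_ord_recl expr0 mulr1 big1 ?addr0 // => i _.
by rewrite (_ : fps_const c _ = 0) // nc0 mul0r.
Qed.

Lemma nbX rho s M k : 0 <= rho -> nb rho s M -> nb rho (s ^+ k) (M ^+ k).
Proof.
move=> r0 H; elim: k => [|k IH]; last by rewrite !exprS; apply: nbM.
by rewrite !expr0 -(nc1 R); apply: nb_const.
Qed.

Lemma nbMn rho s M k : nb rho s M -> nb rho (s *+ k) (M *+ k).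
Proof.
move=> H n; have := lerMn2r k (\sum_(j < n) nc (s j) * rho ^+ j) M.
rewrite H orbT => /idP; apply: le_trans; rewrite -sumrMnl.
by apply: ler_sum => j _; rewrite fps_coefMn ncMn mulrnAl.
Qed.

Lemma geo_half n : \sum_(k < n) (2^-1 : R) ^+ k <= 2.
Proof.
suff : \sum_(k < n) (2^-1 : R) ^+ k = 2 - 2 * 2^-1 ^+ n.
  by move=> ->; rewrite gerBl mulr_ge0 ?exprn_ge0 ?invr_ge0.
elim: n => [|n IH]; first by rewrite big_ord0 expr0; ring.
by rewrite big_ord_recr /= IH exprS; field.
Qed.

Lemma geo_bound (x : R) n : 0 <= x <= 2^-1 -> \sum_(k < n) x ^+ k <= 2.
Proof.
move=> /andP[x0 x2]; apply: le_trans (geo_half n); apply: ler_sum => k _.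
by rewrite lerXn2r // nnegrE ?invr_ge0.
Qed.

Lemma nb_geo rho sg s M : 0 <= rho -> 0 <= sg -> rho * sg <= 2^-1 ->
  (forall n, nc (s n) <= M * sg ^+ n) -> nb rho s (M * 2).
Proof.
move=> r0 s0 rs H n; have M0 : 0 <= M.
  by apply: le_trans (nc_ge0 (s 0%N)) _; have := H 0%N; rewrite expr0 mulr1.
apply: (@le_trans _ _ (\sum_(k < n) M * (rho * sg) ^+ k)).
  apply: ler_sum => k _; rewrite exprMn mulrCA [X in X <= _]mulrC.
  by rewrite ler_wpM2l ?exprn_ge0.
by rewrite -mulr_sumr ler_wpM2l // geo_bound // rs mulr_ge0.
Qed.

Lemma nb_coef rho s M n : 0 < rho -> nb rho s M -> nc (s n) <= M * rho^-1 ^+ n.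
Proof.
move=> r0 /(_ n.+1) H; rewrite exprVn ler_pdivlMr ?exprn_gt0 //.
apply: le_trans H; rewrite big_ord_recr /= lerDr.
by apply: sumr_ge0 => k _; rewrite mulr_ge0 ?nc_ge0 ?exprn_ge0 // ltW.
Qed.

Lemma cv1P s : cv1 s <-> exists rho M : R, 0 < rho /\ nb rho s M.
Proof.
split=> [[M [sg [s0 H]]]|[rho [M [r0 H]]]].
  have r0 : 0 < sg^-1 / 2 by rewrite divr_gt0 ?invr_gt0.
  exists (sg^-1 / 2), (M * 2); split=> //.
  by apply: nb_geo H; rewrite ?(ltW r0) ?(ltW s0) // mulrAC mulVf ?gt_eqF // mul1r.
by exists M, rho^-1; rewrite invr_gt0; split=> // n; apply: nb_coef.
Qed.

(** Every remaining term carries at least one power of the radius, hence one factor [th]. Shrinking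
    the radius is how norms are made small below. *)
Lemma nb_small rho s M (th : R) : s 0%N = 0 -> 0 <= rho -> 0 <= th <= 1 ->
  nb rho s M -> nb (th * rho) s (th * M).
Proof.
move=> s0 r0 /andP[t0 t1] H n.
apply: (@le_trans _ _ (th * \sum_(k < n) nc (s k) * rho ^+ k)); last by rewrite ler_wpM2l.
rewrite mulr_sumr; apply: ler_sum => -[[|k] kn] _ /=; first by rewrite s0 nc0 !mul0r mulr0.
set a := nc _; have -> : a * (th * rho) ^+ k.+1 = th * (a * rho ^+ k.+1) * th ^+ k.
  by rewrite exprMn exprS; ring.
by rewrite ler_piMr ?exprn_ile1 // !mulr_ge0 ?exprn_ge0 ?nc_ge0.
Qed.

Lemma cv2_nb f : cv2 f -> exists rho M sg : R, [/\ 0 < rho, 0 <= M, 0 < sg &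
  forall i, nb rho (f i) (M * sg ^+ i)].
Proof.
move=> [M [sg [s0 H]]]; exists (sg^-1 / 2), (M * 2), sg.
have r0 : 0 < sg^-1 / 2 by rewrite divr_gt0 ?invr_gt0.
have M0 : 0 <= M.
  by apply: le_trans (nc_ge0 (f 0%N 0%N)) _; have := H 0%N 0%N; rewrite expr0 mulr1.
split=> //; first by rewrite mulr_ge0.
move=> i; rewrite mulrAC; apply: (@nb_geo _ sg); rewrite ?(ltW r0) ?(ltW s0) //.
  by rewrite mulrAC mulVf ?gt_eqF // mul1r.
by move=> n; rewrite -mulrA -exprD.
Qed.

Lemma nb_cv2 f rho M sg : 0 < rho -> 0 <= M -> 0 < sg ->
  (forall i, nb rho (f i) (M * sg ^+ i)) -> cv2 f.
Proof.
move=> r0 M0 s0 H; exists M, (Num.max sg rho^-1).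
have m0 : 0 < Num.max sg rho^-1 by rewrite lt_max s0.
split=> // i k; apply: le_trans (nb_coef k r0 (H i)) _.
rewrite -mulrA ler_wpM2l // exprD ler_pM ?exprn_ge0 ?invr_ge0 ?(ltW s0) ?(ltW r0) //.
  by rewrite lerXn2r ?nnegrE ?le_max ?lexx ?(ltW s0) // ltW.
by rewrite lerXn2r ?nnegrE ?le_max ?lexx ?orbT // ?invr_ge0 ?(ltW r0) ?(ltW s0).
Qed.

Lemma nb_ev rho f phi M sg r : 0 <= rho -> 0 <= M -> 0 <= sg -> phi 0%N = 0 ->
  nb rho phi r -> (forall i, nb rho (f i) (M * sg ^+ i)) -> sg * r <= 2^-1 ->
  nb rho (ev phi f) (M * 2).
Proof.
move=> r0 M0 s0 phi0 phir fM sr K; have rr0 := nb_ge0 phir.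
apply: (@le_trans _ _
  (\sum_(k < K) \sum_(i < K) nc ((f i * phi ^+ i) k) * rho ^+ k)).
  apply: ler_sum => k _; rewrite (@ev_sumE _ K) // -mulr_suml.
  by rewrite ler_wpM2r ?exprn_ge0 // nc_sum.
rewrite exchange_big /=; apply: (@le_trans _ _ (\sum_(i < K) M * (sg * r) ^+ i)).
  apply: ler_sum => i _; rewrite exprMn mulrA.
  by have /(_ K) := nbM r0 (fM i) (nbX i r0 phir).
by rewrite -mulr_sumr ler_wpM2l // geo_bound // sr mulr_ge0.
Qed.

(** The 2 in [2 * sg * r] is there for the binomial coefficients of [hasse], which are at most
    [2 ^ (i + j)]; division by [x - phi] only needs [sg * r]. *)
Lemma nb_common f phi : cv2 f -> cv1 phi -> phi 0%N = 0 ->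
  exists rho M sg r : R, [/\ 0 < rho, 0 <= M, 0 < sg &
    [/\ forall i, nb rho (f i) (M * sg ^+ i), nb rho phi r & 2 * sg * r <= 2^-1]].
Proof.
move=> /cv2_nb[rho [M [sg [r0 M0 s0 H]]]] /cv1P[rho' [K [r'0 H']]] phi0.
have K0 := nb_ge0 H'.
pose m := Num.min rho rho'; have m0 : 0 < m by rewrite lt_min r0.
pose th := (1 + 4 * sg * K)^-1.
have d0 : 0 < 1 + 4 * sg * K by rewrite ltr_pwDl // !mulr_ge0 // ltW.
have th0 : 0 < th by rewrite invr_gt0.
have th1 : th <= 1 by rewrite invf_le1 // lerDl !mulr_ge0 // ltW.
exists (th * m), M, sg, (th * K); split=> //; first by rewrite mulr_gt0.
split.
- move=> i; apply: nbW (H i); rewrite mulr_ge0 ?(ltW th0) ?(ltW m0) //=.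
  by apply: (@le_trans _ _ m); [rewrite ler_piMl // ltW | rewrite ge_min lexx].
- apply: nb_small => //; rewrite ?(ltW m0) ?(ltW th0) //.
  by apply: nbW H'; rewrite (ltW m0) ge_min lexx orbT.
rewrite mulrCA -ler_pdivlMl // /th invrK.
by rewrite mulrDl mul1r; lra.
Qed.

Lemma cv2_taylor f phi : cv2 f -> cv1 phi -> phi 0%N = 0 -> cv2 (taylor phi f).
Proof.
move=> cf cp p0; have [rho [M [sg [r [r0 M0 s0 [fH pH sr]]]]]] := nb_common cf cp p0.
apply: (@nb_cv2 _ rho (M * 2) (2 * sg)); rewrite ?mulr_ge0 ?mulr_gt0 //.
move=> i; rewrite mulrAC; apply: (nb_ev _ _ _ p0 pH); last exact: sr.
- exact: ltW.
- by rewrite mulr_ge0 ?exprn_ge0 ?mulr_ge0 // ltW.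
- by rewrite mulr_ge0 // ltW.
move=> j; have := nbMn 'C(i + j, i) (fH (i + j)%N); apply: nb_le.
have -> : M * (2 * sg) ^+ i * (2 * sg) ^+ j = 2 ^+ (i + j) * (M * sg ^+ (i + j)).
  by rewrite !exprMn !exprD; ring.
rewrite -[X in X <= _]mulr_natl ler_wpM2r //.
  by rewrite mulr_ge0 ?exprn_ge0 // ltW.
by rewrite -natrX ler_nat bin_le_exp2.
Qed.

Lemma cv2_quotx f phi : cv2 f -> cv1 phi -> phi 0%N = 0 -> cv2 (quotx phi f).
Proof.
move=> cf cp p0; have [rho [M [sg [r [r0 M0 s0 [fH pH sr]]]]]] := nb_common cf cp p0.
apply: (@nb_cv2 _ rho (M * sg * 2) sg); rewrite ?mulr_ge0 ?(ltW s0) //.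
move=> i; rewrite mulrAC; apply: (@nb_ev _ _ _ _ sg _ _ _ _ p0 pH).
- exact: ltW.
- by rewrite !mulr_ge0 ?exprn_ge0 // ltW.
- exact: ltW.
- by move=> j; have := fH (i.+1 + j)%N; apply: nb_le; rewrite exprD exprS !mulrA.
by have := nb_ge0 pH; nra.
Qed.

Lemma cv2_ram2 q f : (0 < q)%N -> cv2 f -> cv2 (ram2 q f).
Proof.
move=> q0 [M [sg [s0 H]]]; exists M, (1 + sg).
have M0 : 0 <= M.
  by apply: le_trans (nc_ge0 (f 0%N 0%N)) _; have := H 0%N 0%N; rewrite expr0 mulr1.
have s1 : 1 <= 1 + sg by rewrite lerDl ltW.
split=> [|i k]; first by rewrite ltr_pwDl // ltW.
rewrite [ram2 _ _ _ _](@ramE _ q (f i)) //; case: ifP => [_|_]; last first.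
  by rewrite nc0 mulr_ge0 // exprn_ge0 // (le_trans ler01).
apply: le_trans (H _ _) _; rewrite ler_wpM2l //.
apply: (@le_trans _ _ ((1 + sg) ^+ (i + k %/ q))).
  by rewrite lerXn2r ?nnegrE ?lerDr ?(ltW s0) // (le_trans ler01).
by rewrite ler_weXn2l // leq_add2l leq_div.
Qed.

Lemma cv1_ram q s : (0 < q)%N -> cv1 s -> cv1 (ram q s).
Proof.
move=> q0 [M [sg [s0 H]]]; exists M, (1 + sg).
have M0 : 0 <= M.
  by apply: le_trans (nc_ge0 (s 0%N)) _; have := H 0%N; rewrite expr0 mulr1.
have s1 : 1 <= 1 + sg by rewrite lerDl ltW.
split=> [|k]; first by rewrite ltr_pwDl // ltW.
rewrite ramE //; case: ifP => [_|_]; last first.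
  by rewrite nc0 mulr_ge0 // exprn_ge0 // (le_trans ler01).
apply: le_trans (H _) _; rewrite ler_wpM2l //.
apply: (@le_trans _ _ ((1 + sg) ^+ (k %/ q))).
  by rewrite lerXn2r ?nnegrE ?lerDr ?(ltW s0) // (le_trans ler01).
by rewrite ler_weXn2l // leq_div.
Qed.

Lemma cv1D s u : cv1 s -> cv1 u -> cv1 (s + u).
Proof.
move=> /cv1P[r [M [r0 H]]] /cv1P[r' [M' [r'0 H']]]; apply/cv1P.
exists (Num.min r r'), (M + M'); have m0 : 0 < Num.min r r' by rewrite lt_min r0.
by split=> //; apply: nbD; rewrite ?(ltW m0) //; [apply: nbW H|apply: nbW H'];
  rewrite (ltW m0) ge_min lexx ?orbT.
Qed.

Lemma cv1M s u : cv1 s -> cv1 u -> cv1 (s * u).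
Proof.
move=> /cv1P[r [M [r0 H]]] /cv1P[r' [M' [r'0 H']]]; apply/cv1P.
exists (Num.min r r'), (M * M'); have m0 : 0 < Num.min r r' by rewrite lt_min r0.
by split=> //; apply: nbM; rewrite ?(ltW m0) //; [apply: nbW H|apply: nbW H'];
  rewrite (ltW m0) ge_min lexx ?orbT.
Qed.

Lemma cv1N s : cv1 s -> cv1 (- s).
Proof. by move=> [M [sg [s0 H]]]; exists M, sg; split=> // n; rewrite ncN. Qed.

Lemma cv1_const (c : C) : cv1 (fps_const c).
Proof. by apply/cv1P; exists 1, (nc c); split=> //; apply: nb_const. Qed.

Lemma cv1_Xn k : cv1 (fps_X ^+ k).
Proof.
elim: k => [|k IH]; first by rewrite expr0; apply: cv1_const.
rewrite exprS; apply: cv1M IH; exists 1, 1; split=> // n.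
by rewrite expr1n mulr1 /=; case: eqP => _; rewrite ?nc0 ?nc1.
Qed.

(** * The implicit function theorem *)

Section Implicit.
Variable f : fps (fps C).
Hypotheses (cf : cv2 f) (f00 : f 0%N 0%N = 0) (f10 : f 1%N 0%N != 0).

(* [phi = step phi] iff [f (phi, t) = 0]; [step] is t-adically contracting and preserves
   a ball of the weighted l1-norm, which gives convergence of the formal fixed point. *)
Let step phi : fps C := phi - fps_const (f 1%N 0%N)^-1 * ev phi f.

Let step0 phi : phi 0%N = 0 -> step phi 0%N = 0.
Proof.
by move=> p0; rewrite fps_coefB mul_fps_const ev_coef0 // f00 mulr0 p0 subr0.
Qed.

Let step_congr n phi psi : (0 < n)%N -> phi 0%N = 0 -> psi 0%N = 0 ->
  vge n (phi - psi) -> vge n.+1 (step phi - step psi).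
Proof.
move=> n0 p0 s0 /(ev_congr f n0 p0 s0) H k kn; rewrite /step.
have := H k kn; rewrite !fps_coefB !mul_fps_const !fps_coefB => {}H.
have a0 := f10; set a := f 1%N 0%N in a0 H *; rewrite -[RHS](mulr0 (- a^-1)) -H; field.
exact: a0.
Qed.

Let step_stable : exists rho r : R,
  [/\ 0 < rho, 0 < r & forall phi, phi 0%N = 0 -> nb rho phi r -> nb rho (step phi) r].
Proof.
have [rho0 [M [sg [r00 M0 s0 fH]]]] := cv2_nb cf.
have a0 := f10; set a := f 1%N 0%N in a0 *; pose c := nc a^-1.
have c0 : 0 <= c by apply: nc_ge0.
pose K := M + (M * sg + nc a).
have sg0 := ltW s0.
have K0 : 0 <= K by rewrite !addr_ge0 ?mulr_ge0 ?nc_ge0.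
(* [r * D] bounds the effect of the quadratic part of [step] relative to [r], and [r] is chosen to
   make it at most 1/2. The other two series have no constant coefficient, so shrinking the radius
   by [th] brings their contribution below [r / 4]. *)
pose D := c * (M * sg ^+ 2 * 2).
have D0 : 0 <= D by rewrite !mulr_ge0 ?exprn_ge0.
pose r := (1 + 2 * sg + 2 * D)^-1.
have d0 : 0 < 1 + 2 * sg + 2 * D by rewrite -addrA ltr_pwDl // addr_ge0 // mulr_ge0.
have r0 : 0 < r by rewrite invr_gt0.
have r1 : r <= 1 by rewrite invf_le1 // -addrA lerDl addr_ge0 // mulr_ge0.
have rE : r * (1 + 2 * sg + 2 * D) = 1 by rewrite mulVf // gt_eqF.
pose th := r / (r + 4 * c * K).
have e0 : 0 < r + 4 * c * K by rewrite ltr_pwDl // !mulr_ge0.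
have th0 : 0 < th by rewrite divr_gt0.
have th1 : th <= 1 by rewrite ler_pdivrMr // mul1r lerDl !mulr_ge0.
have thE : th * (r + 4 * c * K) = r by rewrite mulfVK // gt_eqF.
exists (th * rho0), r; split=> [||phi p0 pH] //; first by rewrite mulr_gt0.
have rho_ge0 : 0 <= th * rho0 by rewrite mulr_ge0 // ltW.
have rho_le : 0 <= th * rho0 <= rho0 by rewrite rho_ge0 ler_piMl // ltW.
have nb0 : nb (th * rho0) (f 0%N) (th * M).
  apply: nb_small; rewrite ?(ltW th0) ?(ltW r00) //.
  by have := fH 0%N; rewrite expr0 mulr1.
have nb1 : nb (th * rho0) (f 1%N - fps_const a) (th * (M * sg + nc a)).
  apply: nb_small; rewrite ?(ltW th0) ?(ltW r00) //; first by rewrite fps_coefB subrr.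
  apply: nbD; rewrite ?(ltW r00) //.
  by apply: nbN; apply: nb_const; rewrite ltW.
have nb2 : nb (th * rho0) (ev phi (xshift 2 f)) (M * sg ^+ 2 * 2).
  refine (@nb_ev _ (xshift 2 f) _ (M * sg ^+ 2) sg r rho_ge0 _ sg0 p0 pH _ _).
  - by rewrite mulr_ge0 ?exprn_ge0.
  - by move=> i; rewrite -mulrA -exprD; apply: nbW rho_le (fH _).
  - by nra.
have -> : step phi = - (fps_const a^-1 *
   (f 0%N + phi * ((f 1%N - fps_const a) + phi * ev phi (xshift 2 f)))).
  have -> : step phi = phi - fps_const a^-1 * ev phi (xshift 0 f).
    by congr (_ - _ * ev _ _); apply: fpsP.
  rewrite ev_xshift // ev_xshift //.
  have E : fps_const a^-1 * fps_const a = 1.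
    by apply: fpsP => n; rewrite mul_fps_const /= -/a; case: eqP; rewrite ?mulVf ?mulr0.
  set u := fps_const a^-1 in E *; set v := fps_const a in E *; set w := ev _ _.
  have {1}-> : phi = u * v * phi by rewrite E mul1r.
  by ring.
apply: nbN; apply: (@nb_le _ _ (c * (th * M + r * (th * (M * sg + nc a) + r * (M * sg ^+ 2 * 2))))).
  have -> : c * (th * M + r * (th * (M * sg + nc a) + r * (M * sg ^+ 2 * 2)))
    = th * (c * (M + r * (M * sg + nc a))) + r * (r * D) by rewrite /D; ring.
  have B0 : 0 <= M * sg + nc a by rewrite addr_ge0 ?mulr_ge0 ?nc_ge0.
  have le1 : c * (M + r * (M * sg + nc a)) <= c * K.
    by rewrite ler_wpM2l // lerD2l ler_piMl.
  have le2 : r * D <= 2^-1 by have := mulr_ge0 (ltW r0) sg0; nra.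
  have le3 : th * (c * K) <= r / 4 by have := mulr_ge0 (ltW th0) (ltW r0); nra.
  have := ler_wpM2l (ltW th0) le1; have := ler_wpM2l (ltW r0) le2; lra.
apply: nbM; rewrite ?rho_ge0 //; first exact: nb_const.
apply: nbD => //; apply: nbM => //; apply: nbD => //.
exact: nbM.
Qed.

Lemma implicit_root : exists phi : fps C, [/\ phi 0%N = 0, cv1 phi & ev phi f = 0].
Proof.
have [rho [r [rho0 r0 stab]]] := step_stable.
pose it k := iter k step (0 : fps C).
have it0 k : it k 0%N = 0 by elim: k => // k IH; apply: step0.
have itS k : vge k.+1 (it k.+1 - it k).
  elim: k => [|k IH]; first by case=> // _; rewrite fps_coefB !it0 subrr.
  exact: (@step_congr k.+1 (it k.+1) (it k) isT (it0 _) (it0 _) IH).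
have itE k l : vge k.+1 (it (k + l)%N - it k).
  elim: l => [|l IH]; first by rewrite addn0 subrr.
  rewrite -(subrK (it (k + l)%N) (it _)) -addrA; apply: vgeD => //.
  by rewrite addnS; apply: vgeW (itS _); lia.
(* The [n]-th coefficient is stationary from the [n]-th iterate on, so the diagonal is the limit. A
   partial sum involves a single iterate, hence the norm bound survives. *)
pose phi := Fps (fun n => it n n).
have phiE k : vge k.+1 (phi - it k).
  move=> n nk; rewrite fps_coefB /=.
  have := @itE n (k - n)%N n (ltnSn _); rewrite subnKC // fps_coefB => /eqP.
  by rewrite subr_eq0 => /eqP ->; rewrite subrr.
have phi0 : phi 0%N = 0 by apply: it0.
exists phi; split=> //.
  apply/cv1P; exists rho, r; split=> // n.
  have it_nb k : nb rho (it k) r.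
    elim: k => [|k IH]; last by apply: stab.
    by move=> m; rewrite big1 ?(ltW r0) // => j _; rewrite nc0 mul0r.
  apply: le_trans (it_nb n n); apply: ler_sum => -[k kn] _; rewrite [nat_of_ord _]/=.
  have /eqP := @phiE n k (leqW kn); rewrite fps_coefB subr_eq0 => /eqP ->.
  exact: lexx.
apply: fpsP => n; have := @ev_congr _ n.+1 phi (it n) f (ltn0Sn _) phi0 (it0 n) (phiE n).
move=> /(_ n (leqW (ltnSn n))).
rewrite !fps_coefB mul_fps_const [(phi - _) n](phiE n n (ltnSn n)) mulr0 subr0.
move=> /eqP; rewrite subr_eq0 => /eqP ->.
have /eqP := itS n n (ltnSn n); rewrite (_ : it n.+1 = step (it n)) // /step fps_coefB fps_coefB mul_fps_const.
rewrite addrC addKr oppr_eq0 mulf_eq0 invr_eq0 (negPf f10) /= => /eqP ->.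
by [].
Qed.
End Implicit.
End Norms.

(** * The Newton-Puiseux theorem *)

Section NewtonPuiseux.
Variable R : realType.
Local Notation C := (R[i]).
Implicit Types (s u phi psi : fps C) (f g : fps (fps C)).

Definition xreg (m : nat) f := (forall i, (i < m)%N -> f i 0%N = 0) /\ f m 0%N != 0.

Lemma cv2_hasse m f : cv2 f -> cv2 (hasse m f).
Proof.
move=> [M [sg [s0 H]]]; exists (M * (2 * sg) ^+ m), (2 * sg).
have M0 : 0 <= M.
  by apply: le_trans (nc_ge0 (f 0%N 0%N)) _; have := H 0%N 0%N; rewrite expr0 mulr1.
split=> [|i k]; first by rewrite mulr_gt0.
rewrite [hasse _ _ _ _]fps_coefMn ncMn -mulrA -exprD addnA exprMn.
rewrite [X in _ <= X]mulrCA -[X in X <= _]mulr_natl; apply: ler_pM => //.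
- exact: nc_ge0.
- rewrite -natrX ler_nat; apply: leq_trans (bin_le_exp2 _ _) _.
  by rewrite leq_exp2l // leq_addr.
Qed.

Lemma taylor_coef0 phi f i : phi 0%N = 0 -> taylor phi f i 0%N = f i 0%N.
Proof.
by move=> p0; rewrite [LHS](@ev_coef0 _ phi) // fps_coefMn addn0 binn mulr1n.
Qed.

Lemma xreg_taylor phi f m : phi 0%N = 0 -> xreg m f -> xreg m (taylor phi f).
Proof.
by move=> p0 [fi fm]; split=> [i im|]; rewrite taylor_coef0 // fi.
Qed.

Lemma ev_taylor0 phi f : taylor phi f 0%N = ev phi f.
Proof. by congr ev; apply: fpsP => j /=; rewrite bin0 mulr1n. Qed.

Lemma complex_natr_neq0 n : (n.+1)%:R != 0 :> C.
Proof. by rewrite pnatr_eq0. Qed.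

(** The [m]-th divided derivative has linear coefficient [(m + 1) f_(m+1)(0)], nonzero in
    characteristic 0, so the implicit function theorem gives a root of it. Translating by this root
    removes the coefficient of [x^m] exactly, although [f] is not a polynomial in [x]. *)
Lemma tschirnhaus f m : cv2 f -> xreg m.+1 f ->
  exists phi, [/\ phi 0%N = 0, cv1 phi & taylor phi f m = 0].
Proof.
move=> cf [fi fm]; apply: implicit_root; first exact: cv2_hasse.
- by rewrite [hasse _ _ _ _]fps_coefMn addn0 fi // mul0rn.
rewrite [hasse _ _ _ _]fps_coefMn addn1 binSn -mulr_natr mulf_neq0 //.
exact: complex_natr_neq0.
Qed.

(* [p / (m - i0)] is the slope of the edge of the Newton polygon through [(m, 0)]. *)
Lemma newton_slope f m : (exists2 i, (i < m)%N & f i != 0) ->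
  exists i0 p, [/\ (i0 < m)%N, f i0 p != 0 &
    forall i n, (i < m)%N -> (n * (m - i0) < p * (m - i))%N -> f i n = 0].
Proof.
(* [v i n] is the slope [n / (m - i)] multiplied by [m!]: an integer, so a least slope exists by
   minimality in [nat]. *)
move=> [i im fi]; pose v i n := (n * (m`! %/ (m - i)))%N.
have vE j n : (j < m)%N -> (v j n * (m - j) = n * m`!)%N.
  by move=> jm; rewrite /v -mulnA divnK // dvdn_fact // subn_gt0 jm leq_subr.
pose P k := `[< exists j n, [/\ (j < m)%N, f j n != 0 & k = v j n] >].
have exP : exists k, P k.
  by have [n [fn _]] := ford_exists fi; exists (v i n); apply/asboolP; exists i, n.
case: (ex_minnP exP) => k /asboolP[i0 [p [i0m fp ->]]] kmin.
exists i0, p; split=> // j n jm lt; apply/eqP; apply: contraT => fjn.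
have /kmin : P (v j n) by apply/asboolP; exists j, n.
have f0 : (0 < m`!)%N := fact_gt0 m.
have := vE _ p i0m; have := vE _ n jm; move: lt; rewrite -subn_gt0 in jm; rewrite -subn_gt0 in i0m.
move: (v j n) (v i0 p) (m - j)%N (m - i0)%N jm i0m => a b c d c0 d0 lt1 e1 e2 ab.
have h1 : (b * d * c <= a * c * d)%N by rewrite -mulnA [(d * c)%N]mulnC mulnA !leq_mul2r ab !orbT.
move: h1; rewrite e1 e2.
have : (n * d * m`! < p * c * m`!)%N by rewrite ltn_pmul2r.
by lia.
Qed.

Lemma ev_scale (c d : fps C) f g psi : psi 0%N = 0 -> d 0%N = 0 ->
  (forall i, c * f i = d ^+ i * g i) -> c * ev psi f = ev (d * psi) g.
Proof.
move=> p0 d0 H; rewrite -{1}(ev_const c p0) -evM //; apply: fpsP => n.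
have dp0 : (d * psi) 0%N = 0 by rewrite fps_coefM0 d0 mul0r.
rewrite (ev_sumE _ p0 (ltnSn n)) (ev_sumE _ dp0 (ltnSn n)); apply: eq_bigr => i _.
by rewrite mul_fps_const H exprMn [g i * _]mulrCA mulrA.
Qed.

Lemma fps_constX (c : C) k : fps_const c ^+ k = fps_const (c ^+ k).
Proof.
elim: k => [|k IH]; first by rewrite !expr0.
by rewrite !exprS IH; apply: fpsP => n; rewrite mul_fps_const /=; case: eqP; rewrite ?mulr0.
Qed.

Lemma fps_X0 k : (fps_X ^+ k.+1 : fps C) 0%N = 0.
Proof. by rewrite -[_ ^+ _]mulr1 mul_fps_Xn. Qed.

(** * Blowing up along an edge of the Newton polygon *)

Section Polygon.
Variables (f : fps (fps C)) (m p : nat) (c : C).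
Hypotheses (p0 : (0 < p)%N) (fv : forall i, (i <= m)%N -> vge (p * (m - i)) (f i)).

(** Under [x = c t^p] the terms of [f] on the edge all reach the lowest order [p m], and their sum
    is [edge_poly.[c] t^(p m)]. *)
Definition edge_poly : {poly C} := \poly_(l < m.+1) f l (p * (m - l))%N.

Let phi : fps C := fps_const c * fps_X ^+ p.
Let phi0 : phi 0%N = 0.
Proof. by rewrite mul_fps_const -(prednK p0) fps_X0 mulr0. Qed.
Let g := taylor phi f.

Let gE i n L : (n < L)%N -> g i n =
  \sum_(j < L) (if (p * j <= n)%N
    then c ^+ j * (f (i + j)%N (n - p * j)%N *+ 'C(i + j, i)) else 0).
Proof.
move=> nL; rewrite [LHS](ev_sumE _ phi0 nL); apply: eq_bigr => j _.
have -> : hasse i f j * phi ^+ j = fps_const (c ^+ j) * (fps_X ^+ (p * j) * hasse i f j).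
  by rewrite /phi exprMn fps_constX -exprM mulrCA [hasse i f j * _]mulrC.
rewrite mul_fps_const mul_fps_Xn; case: ifP => _; last by rewrite mulr0.
by rewrite [hasse _ _ _ _]fps_coefMn.
Qed.

Lemma vge_taylor_edge i : (i <= m)%N -> vge (p * (m - i)) (g i).
Proof.
move=> im n nlt; rewrite (@gE _ _ n.+1) // big1 // => j _; case: ifP => // pj.
rewrite fv ?mul0rn ?mulr0 //.
  by rewrite -leq_subRL //; move: (leq_ltn_trans pj nlt); rewrite ltn_pmul2l //; lia.
by move: pj nlt; rewrite subnDA [(p * (m - i - j))%N]mulnBr; lia.
Qed.

Lemma taylor_edge i : (i <= m)%N -> g i (p * (m - i))%N = edge_poly^`N(i).[c].
Proof.
move=> im; set n := (p * (m - i))%N; pose L := (n + m).+2.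
rewrite (@gE _ _ L) //; last by rewrite /L; lia.
rewrite (@horner_coef_wide _ L); last first.
  apply/leq_sizeP => j Lj; rewrite coef_nderivn coef_poly ifF ?mul0rn //.
  by apply/negbTE; rewrite -leqNgt; move: Lj; rewrite /L; lia.
apply: eq_bigr => j _; rewrite coef_nderivn coef_poly /n.
rewrite leq_pmul2l // ltnS -leq_subRL //; case: ifP => jm; last by rewrite mul0rn mul0r.
by rewrite mulrC subnDA [in RHS]mulnBr.
Qed.

(** This is [f(t^p (c + x)) / t^(p m)]. The division is exact by [vge_taylor_edge]; the test rules
    out truncated subtraction, where the coefficient has to be 0. *)
Definition blowup : fps (fps C) := Fps (fun i => Fps (fun n =>
  if (p * i <= n + p * m)%N then g i (n + p * m - p * i)%N else 0)).

Lemma blowupE i : fps_X ^+ (p * m) * blowup i = fps_X ^+ p ^+ i * g i.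
Proof.
apply: fpsP => n; rewrite -exprM !mul_fps_Xn /=.
case: (leqP (p * m) n) => [pmn|npm]; first by rewrite subnK.
case: ifP => // pin; symmetry; apply: (@vge_taylor_edge i).
  by rewrite leqNgt; apply/negP => mi; move: (leq_trans npm (leq_mul (leqnn p) (ltnW mi))); lia.
by rewrite mulnBr; lia.
Qed.

(** At [t = 0] the blow-up is the Taylor expansion of the edge polynomial at [c], so its order in
    [x] is the multiplicity of [c] as a root. *)
Lemma blowup_coef0 i : (i <= m)%N -> blowup i 0%N = edge_poly^`N(i).[c].
Proof.
by move=> im; rewrite /= add0n leq_pmul2l // im -mulnBr taylor_edge.
Qed.

Lemma blowup_top : blowup m 0%N = f m 0%N.
Proof. by rewrite /= add0n leqnn subnn taylor_coef0. Qed.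

Lemma cv2_blowup : cv2 f -> cv2 blowup.
Proof.
move=> cf; have cphi : cv1 phi by apply: cv1M; [apply: cv1_const | apply: cv1_Xn].
have [M [sg [s0 H]]] := cv2_taylor cf cphi phi0.
have M0 : 0 <= M.
  by apply: le_trans (nc_ge0 (g 0%N 0%N)) _; have := H 0%N 0%N; rewrite expr0 mulr1.
have s1 : 1 <= 1 + sg by rewrite lerDl ltW.
have s10 : 0 <= 1 + sg by apply: le_trans s1.
exists (M * (1 + sg) ^+ (p * m)), (1 + sg); split=> [|i n]; first by rewrite ltr_pwDl // ltW.
rewrite /=; case: ifP => [le|_]; last by rewrite nc0 !mulr_ge0 ?exprn_ge0.
apply: le_trans (H _ _) _; rewrite -mulrA -exprD ler_wpM2l //.
apply: (@le_trans _ _ ((1 + sg) ^+ (i + (n + p * m - p * i)))).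
  by rewrite lerXn2r ?nnegrE ?lerDr // ltW.
by rewrite ler_weXn2l //; lia.
Qed.

Lemma ev_blowup N psi : (0 < N)%N -> psi 0%N = 0 ->
  ev psi (ram2 N blowup) = 0 ->
  ev (ram N phi + fps_X ^+ (N * p) * psi) (ram2 N f) = 0.
Proof.
move=> N0 psi0 H.
have d0 : (fps_X ^+ (N * p) : fps C) 0%N = 0.
  by rewrite -(prednK (_ : 0 < N * p)%N) ?fps_X0 // muln_gt0 N0.
have rphi0 : ram N phi 0%N = 0 by rewrite ram_coef0.
have dpsi0 : (fps_X ^+ (N * p) * psi) 0%N = 0 by rewrite fps_coefM0 d0 mul0r.
rewrite -ev_taylor // taylor_ram2 //.
rewrite -(@ev_scale (fps_X ^+ (N * (p * m))) _ (ram2 N blowup)) ?H ?mulr0 //.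
move=> i; have := congr1 (ram N) (blowupE i).
rewrite -exprM !ramM !ram_Xn // => E; transitivity (fps_X ^+ (N * (p * i)) * ram N (g i)).
  exact: E.
by rewrite mulnA exprM.
Qed.

End Polygon.

(* Induction on the order [m + 1] in [x].  After the Tschirnhaus translation the
   coefficient of [x^m] vanishes, so the edge polynomial is not an [(m + 1)]-th power
   and blowing up at one of its roots lowers the order. *)
Lemma newton_puiseux m f : cv2 f -> xreg m.+1 f ->
  exists N phi, [/\ (0 < N)%N, phi 0%N = 0, cv1 phi & ev phi (ram2 N f) = 0].
Proof.
elim/ltn_ind: m f => m IH f cf fr.
have [phi0 [p00 cp0 tphi]] := tschirnhaus cf fr.
set f1 := taylor phi0 f in tphi.
have cf1 : cv2 f1 by apply: cv2_taylor.
have f1r : xreg m.+1 f1 by apply: xreg_taylor.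
have [nz|z] := pselect (exists2 i, (i < m.+1)%N & f1 i != 0); last first.
  exists 1%N, phi0; split=> //; rewrite ram2_1 -ev_taylor0.
  by apply/eqP; apply: contraT => H; case: z; exists 0%N.
have [i0 [p [i0m f1p slope]]] := newton_slope nz.
have p0 : (0 < p)%N.
  by rewrite lt0n; apply: contraNneq f1p => ->; case: f1r => fi _; rewrite fi.
set q := (m.+1 - i0)%N in slope.
have q0 : (0 < q)%N by rewrite subn_gt0.
(* The slope [p / q] becomes the integer [p], as the blow-up requires. *)
pose f2 := ram2 q f1.
have cf2 : cv2 f2 by apply: cv2_ram2.
have fv i : (i <= m.+1)%N -> vge (p * (m.+1 - i)) (f2 i).
  rewrite leq_eqVlt => /orP[/eqP ->|im]; first by rewrite subnn muln0.
  move=> n nlt; rewrite [f2 i n](@ramE _ q (f1 i)) //; case: ifP => // /dvdnP[k kq].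
  by rewrite kq mulnK // slope // -kq.
pose P := edge_poly f2 m.+1 p.
have Pl l : (l <= m.+1)%N -> P`_l = f2 l (p * (m.+1 - l))%N.
  by move=> lm; rewrite coef_poly ltnS lm.
have Pm : P`_m = 0 by rewrite Pl // [f2 m _]ramE // tphi; case: ifP.
have PmS : P`_m.+1 != 0.
  by rewrite Pl // subnn muln0 [f2 _ _]ram_coef0; case: f1r.
have Pi0 : P`_i0 != 0.
  by rewrite Pl ?(ltnW i0m) // [f2 _ _]ramE // -/q dvdn_mull // mulnK.
have sP : size P = m.+2.
  apply/eqP; rewrite eqn_leq size_poly /=; apply: contraNltn PmS => sP.
  by rewrite nth_default.
have /closed_rootP[c rc] : size P != 1%N by rewrite sP.
pose F := blowup f2 m.+1 p c.
have F0 i : (i <= m.+1)%N -> F i 0%N = P^`N(i).[c] by move=> im; apply: blowup_coef0.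
have Ftop : F m.+1 0%N != 0.
  by rewrite /F blowup_top // [f2 _ _]ram_coef0; case: f1r.
have exF : exists k, F k 0%N != 0 by exists m.+1.
case: (ex_minnP exF) => m' Fm' m'min.
have F00 : F 0%N 0%N = 0 by rewrite F0 // nderivn0; apply/rootP.
have m'0 : (0 < m')%N by rewrite lt0n; apply: contraNneq Fm' => ->; rewrite F00.
have m'lt : (m' < m.+1)%N.
  have := m'min _ Ftop; rewrite leq_eqVlt => /orP[/eqP m'm|//].
  (* If the order did not drop, [c] would be an [(m + 1)]-fold root of the edge polynomial. Its
     vanishing coefficient of degree [m] then forces [c = 0], which contradicts [Pi0]. *)
  have Fz i : (i < m.+1)%N -> P^`N(i).[c] = 0.
    move=> im; rewrite -F0 ?(ltnW im) //; apply/eqP; apply: contraT => /m'min.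
    by rewrite m'm leqNgt im.
  have : P^`N(m).[c] = P`_m.+1 * m.+1%:R * c.
    rewrite (@horner_coef_wide _ 2); last first.
      by apply/leq_sizeP => j j2; rewrite coef_nderivn nth_default ?mul0rn // sP; lia.
    rewrite !big_ord_recl big_ord0 /= !coef_nderivn addn0 Pm mul0rn mul0r add0r addr0.
    by rewrite /bump /= addn1 binSn expr1 mulr_natr.
  rewrite Fz // => /esym/eqP; rewrite !mulf_eq0 (negPf PmS) (negPf (complex_natr_neq0 m)) /=.
  move=> /eqP c0; move: (Fz _ i0m); rewrite c0 horner_coef0 coef_nderivn addn0 binn mulr1n.
  by move/eqP; rewrite (negPf Pi0).
have Fr : xreg m'.-1.+1 F.
  rewrite prednK //; split=> // i im; apply/eqP; apply: contraT => /m'min.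
  by rewrite leqNgt im.
have [||N [psi [N0 psi0 cpsi Hpsi]]] := IH m'.-1 _ F _ Fr.
- by rewrite -ltnS prednK.
- exact: cv2_blowup.
have H := ev_blowup p0 fv N0 psi0 Hpsi; set eta := _ + _ in H.
have d0 : (fps_X ^+ (N * p) : fps C) 0%N = 0.
  by rewrite -(prednK (_ : 0 < N * p)%N) ?fps_X0 // muln_gt0 N0.
have e0 : eta 0%N = 0.
  rewrite fps_coefD fps_coefM0 d0 mul0r addr0 ram_coef0 mul_fps_const.
  by rewrite -(prednK p0) fps_X0 mulr0.
have Nq0 : (0 < N * q)%N by rewrite muln_gt0 N0.
exists (N * q)%N, (ram (N * q) phi0 + eta); split=> //.
- by rewrite fps_coefD e0 ram_coef0 p00 addr0.
- apply: cv1D; first exact: cv1_ram.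
  apply: cv1D; last by apply: cv1M => //; apply: cv1_Xn.
  by apply: cv1_ram => //; apply: cv1M; [apply: cv1_const | apply: cv1_Xn].
by rewrite -ev_taylor ?ram_coef0 // taylor_ram2 // -ram2_ram2.
Qed.

(** Dividing by [x - phi] lowers the order in [x] by one. The quotient may need a further
    ramification, which is then applied to the root already found. *)
Lemma puiseux_factorization m f : cv2 f -> xreg m f ->
  exists N (rs : seq (fps C)) (u : fps (fps C)), [/\ (0 < N)%N, size rs = m,
    forall phi, phi \in rs -> phi 0%N = 0 /\ cv1 phi,
    cv2 u /\ u 0%N 0%N != 0 &
    ram2 N f = \prod_(phi <- rs) xsub phi * u].
Proof.
elim: m f => [|m IH] f cf fr.
  exists 1%N, [::], f; split=> //; first by split=> //; case: fr.
  by rewrite big_nil mul1r ram2_1.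
have [N [phi [N0 p0 cp H]]] := newton_puiseux cf fr.
have E := xsub_quotx p0 H; set h := quotx _ _ in E.
have ch : cv2 h by apply: cv2_quotx => //; apply: cv2_ram2.
have hE i : h i 0%N = f i.+1 0%N.
  rewrite [h i 0%N](@ev_coef0 _ phi) // -[xshift _ _ 0%N]/(ram N (f (i.+1 + 0)%N)).
  by rewrite addn0 ram_coef0.
have hr : xreg m h.
  by case: fr => fi fm; split=> [i im|]; rewrite hE // fi.
have [N' [rs [u [N'0 srs rsP uP E']]]] := IH h ch hr.
exists (N' * N)%N, (ram N' phi :: rs), u; split.
- by rewrite muln_gt0 N'0.
- by rewrite /= srs.
- move=> psi; rewrite inE => /orP[/eqP ->|/rsP //].
  by split; [rewrite ram_coef0 | apply: cv1_ram].
- exact: uP.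
by rewrite -(ram2_ram2 f N'0 N0) E ram2M ram2_xsub E' big_cons mulrA.
Qed.

End NewtonPuiseux.

(** * Values of convergent series *)

Section Values.
Variable R : realType.
Local Notation C := (R[i]).
Implicit Types (s u phi psi : fps C) (f g : fps (fps C)).

Definition sumto (s : nat -> C) (v : C) := forall e : R, 0 < e ->
  exists n0, forall n, (n0 <= n)%N -> nc (\sum_(k < n) s k - v) <= e.

Lemma sumto_uniq s v w : sumto s v -> sumto s w -> v = w.
Proof.
move=> sv sw; apply/eqP; rewrite -subr_eq0 -nc_eq0 eq_le nc_ge0 andbT.
apply/ler_addgt0Pr => e e0; rewrite add0r.
have e20 : 0 < e / 2 by rewrite divr_gt0.
have [n Hn] := sv _ e20; have [m Hm] := sw _ e20.
have := Hn (maxn n m) (leq_maxl _ _); have := Hm (maxn n m) (leq_maxr _ _).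
set S := \sum_(k < _) _ => h1 h2; have -> : v - w = (S - w) - (S - v) by ring.
by apply: le_trans (ncB _ _) _; lra.
Qed.

Lemma real_sum_exists (r : nat -> R) (M : R) :
  (forall n, \sum_(k < n) `|r k| <= M) ->
  exists l : R, forall e : R, 0 < e ->
    exists n0, forall n, (n0 <= n)%N -> `|\sum_(k < n) r k - l| <= e.
Proof.
move=> H; have cv : cvgn (series r).
  apply: normed_cvg; apply: nondecreasing_is_cvgn.
    by apply: nondecreasing_series => k _ _; apply: normr_ge0.
  by exists M => _ [n _ <-]; have := H n; rewrite -(big_mkord xpredT (fun k => `|r k|)).
exists (limn (series r)) => e e0.
move/cvgrPdist_le: cv => /(_ e e0) [n0 _ Hn]; exists n0 => n nn.
by have := Hn n nn; rewrite seriesEord distrC.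
Qed.

Lemma complex_eqP (z w : C) : complex.Re z = complex.Re w ->
  complex.Im z = complex.Im w -> z = w.
Proof. by case: z w => [a b] [c d] /= -> ->. Qed.

Lemma Re_sum n (s : nat -> C) : complex.Re (\sum_(k < n) s k) = \sum_(k < n) complex.Re (s k).
Proof. by apply: (big_morph (@complex.Re R)) => [[? ?] [? ?]|]. Qed.
Lemma Im_sum n (s : nat -> C) : complex.Im (\sum_(k < n) s k) = \sum_(k < n) complex.Im (s k).
Proof. by apply: (big_morph (@complex.Im R)) => [[? ?] [? ?]|]. Qed.

Lemma nb_abs_le rho s M n : 1 <= rho -> nb rho s M -> \sum_(k < n) nc (s k) <= M.
Proof.
move=> r1 H; apply: le_trans (H n); apply: ler_sum => k _.
by rewrite ler_peMr ?nc_ge0 // exprn_ege1.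
Qed.

Lemma sumto_exists rho s M : 1 <= rho -> nb rho s M -> exists v, sumto s v.
Proof.
move=> r1 H.
have [a Ha] : exists l : R, forall e : R, 0 < e -> exists n0, forall n, (n0 <= n)%N ->
    `|\sum_(k < n) complex.Re (s k) - l| <= e.
  apply: (@real_sum_exists (fun k => complex.Re (s k)) M) => n; apply: le_trans (nb_abs_le n r1 H).
  by apply: ler_sum => k _; apply: Re_le_nc.
have [b Hb] : exists l : R, forall e : R, 0 < e -> exists n0, forall n, (n0 <= n)%N ->
    `|\sum_(k < n) complex.Im (s k) - l| <= e.
  apply: (@real_sum_exists (fun k => complex.Im (s k)) M) => n; apply: le_trans (nb_abs_le n r1 H).
  by apply: ler_sum => k _; apply: Im_le_nc.
exists (a +i* b) => e e0; have e20 : 0 < e / 2 by rewrite divr_gt0.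
have [n Hn] := Ha _ e20; have [m Hm] := Hb _ e20.
exists (maxn n m) => k; rewrite geq_max => /andP[nk mk].
have := Hn k nk; have := Hm k mk; rewrite -Re_sum -Im_sum.
case: (\sum_(j < k) s j) => x y /= h1 h2.
by apply: le_trans (nc_le_ReIm _) _; rewrite /=; lra.
Qed.

Lemma exp_half_small (M e : R) : 0 <= M -> 0 < e ->
  exists n0, forall n, (n0 <= n)%N -> M * 2^-1 ^+ n <= e.
Proof.
move=> M0 e0; have [k hk] : exists k : nat, M / e <= k%:R.
  by exists (Num.truncn (M / e)).+1; rewrite ltW // truncnS_gt.
exists k => n kn; rewrite exprVn ler_pdivrMr ?exprn_gt0 // -ler_pdivrMl // mulrC.
apply: le_trans hk _; rewrite -natrX ler_nat; apply: leq_trans kn _.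
exact/ltnW/ltn_expl.
Qed.

Lemma sumto_close (s u : nat -> C) (v : C) (M : R) : 0 <= M -> sumto s v ->
  (forall n, nc (\sum_(k < n) u k - \sum_(k < n) s k) <= M * 2^-1 ^+ n) -> sumto u v.
Proof.
move=> M0 sv H e e0; have e20 : 0 < e / 2 by rewrite divr_gt0.
have [n Hn] := sv _ e20; have [m Hm] := exp_half_small M0 e20.
exists (maxn n m) => k; rewrite geq_max => /andP[nk mk].
rewrite -(subrKA (\sum_(j < k) s j)).
by apply: le_trans (ncD _ _) _; have := Hn k nk; have := Hm k mk; have := H k; lra.
Qed.

Lemma sumtoD s u v w : sumto s v -> sumto u w -> sumto (s + u) (v + w).
Proof.
move=> sv sw e e0; have e20 : 0 < e / 2 by rewrite divr_gt0.
have [n Hn] := sv _ e20; have [m Hm] := sw _ e20.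
exists (maxn n m) => k; rewrite geq_max => /andP[nk mk].
rewrite big_split /= opprD addrACA.
by apply: le_trans (ncD _ _) _; have := Hn k nk; have := Hm k mk; lra.
Qed.

Lemma sumtoN s v : sumto s v -> sumto (- s) (- v).
Proof.
move=> sv e e0; have [n Hn] := sv _ e0; exists n => k nk.
by rewrite sumrN -opprD ncN; apply: Hn.
Qed.

Lemma nc_sumto_le s v z (B : R) :
  (forall n, nc (\sum_(k < n.+1) s k - z) <= B) -> sumto s v -> nc (v - z) <= B.
Proof.
move=> H sv; apply/ler_addgt0Pr => e e0; have [n Hn] := sv e e0.
have := Hn n.+1 (leqW (leqnn n)); have := H n; set S := \sum_(k < _) _ => h1 h2.
have -> : v - z = (S - z) - (S - v) by ring.
by apply: le_trans (ncB _ _) _; lra.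
Qed.

Lemma sumto_monomial (c : C) n : sumto (fps_const c * fps_X ^+ n) c.
Proof.
have E j : (fps_const c * fps_X ^+ n) j = if j == n then c else 0.
  rewrite mul_fps_const -[fps_X ^+ n]mulr1 mul_fps_Xn fps_coef1.
  case: (ltngtP n j) => [nj|jn|->]; last by rewrite subnn mulr1.
    by rewrite subn_eq0 leqNgt nj mulr0.
  by rewrite mulr0.
move=> e e0; exists n.+1 => k nk; under eq_bigr do rewrite E.
rewrite -big_mkcond (big_pred1 (Ordinal nk)) ?subrr ?nc0 ?ltW //.
Qed.

(** The partial sum of the Cauchy product and the product of the partial sums differ only in degrees
    at least [n]. Bounds at radius 2 make the difference [O(2^-n)]; this is why [nb 2] accompanies
    the sums from here on. *)
Lemma sumtoM s u v w M M' : nb 2 s M -> nb 2 u M' -> sumto s v -> sumto u w ->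
  sumto (s * u) (v * w).
Proof.
move=> sM uM sv uw; have M0 := nb_ge0 sM; have M'0 := nb_ge0 uM.
have diff n : nc (\sum_(k < n) (s * u) k - (\sum_(k < n) s k) * (\sum_(k < n) u k))
    <= M * M' * 2^-1 ^+ n.
  pose P (r : fps C) := trunc n r.
  pose Q (r : fps C) := \poly_(k < n) nc (r k).
  have Q0 r k : 0 <= (Q r)`_k by rewrite coef_poly; case: ifP => // _; apply: nc_ge0.
  have QQ0 r r' k : 0 <= (Q r * Q r')`_k by rewrite coefM sumr_ge0 // => j _; rewrite mulr_ge0.
  have PQ k : nc (P s * P u)`_k <= (Q s * Q u)`_k.
    rewrite !coefM; apply: le_trans (nc_sum _ _ _) _; apply: ler_sum => j _.
    rewrite ncM !coef_poly; case: ifP => _; rewrite ?nc0 ?mul0r //.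
    by case: ifP => _; rewrite ?nc0.
  have E (r : fps C) : \sum_(k < n) r k = (P r).[1].
    by rewrite horner_poly; apply: eq_bigr => k _; rewrite expr1n mulr1.
  have szQ : (size (Q s * Q u)%R <= n + n)%N.
    apply: leq_trans (size_polyMleq _ _) _; apply: leq_trans (leq_pred _) _.
    by apply: leq_add; apply: size_poly.
  have szP : (size (P s * P u)%R <= n + n)%N.
    apply: leq_trans (size_polyMleq _ _) _; apply: leq_trans (leq_pred _) _.
    by apply: leq_add; apply: size_poly.
  have -> : \sum_(k < n) (s * u) k = \sum_(k < n) (P s * P u)`_k * 1 ^+ k.
    by apply: eq_bigr => k _; rewrite expr1n mulr1; apply: fps_mul_trunc.
  rewrite !E -hornerM (horner_coef_wide _ szP) big_split_ord /=.
  rewrite opprD addrA subrr add0r ncN.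
  have : (Q s * Q u).[2] <= M * M'.
    rewrite hornerM; apply: ler_pM; rewrite ?horner_poly ?sM ?uM //;
      by apply: sumr_ge0 => k _; rewrite mulr_ge0 ?nc_ge0 ?exprn_ge0.
  rewrite (horner_coef_wide _ szQ) big_split_ord /= => hQ.
  rewrite exprVn ler_pdivlMr ?exprn_gt0 //; apply: le_trans hQ.
  apply: (@le_trans _ _ (\sum_(k < n) (Q s * Q u)`_(n + k) * 2 ^+ (n + k))); last first.
    by rewrite lerDr sumr_ge0 // => k _; rewrite mulr_ge0 ?exprn_ge0.
  apply: le_trans (ler_wpM2r _ (nc_sum _ _ _)) _; first by rewrite exprn_ge0.
  rewrite mulr_suml; apply: ler_sum => k _; rewrite expr1n mulr1.
  apply: ler_pM; rewrite ?nc_ge0 ?exprn_ge0 ?PQ //.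
  by rewrite ler_weXn2l ?ler1n // leq_addr.
move=> e e0.
have W0 : 0 < 1 + nc w + nc v + M * M'.
  by rewrite -!addrA ltr_pwDl // !addr_ge0 ?nc_ge0 ?mulr_ge0.
pose d := Num.min 1 (e / (3 * (1 + nc w + nc v + M * M'))).
have d0 : 0 < d by rewrite lt_min ltr01 divr_gt0 // mulr_gt0.
have d1 : d <= 1 by rewrite ge_min lexx.
have dE : d * (3 * (1 + nc w + nc v + M * M')) <= e.
  by rewrite -ler_pdivlMr ?mulr_gt0 // ge_min lexx orbT.
have [n1 H1] := sv _ d0; have [n2 H2] := uw _ d0.
have [n3 H3] := exp_half_small (mulr_ge0 M0 M'0) (divr_gt0 e0 (ltr0Sn R 2)).
exists (maxn n1 (maxn n2 n3)) => n; rewrite !geq_max => /and3P[/H1 h1 /H2 h2 /H3 h3].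
have := diff n; move: h1 h2; set A := \sum_(k < n) s k; set B := \sum_(k < n) u k.
set D := \sum_(k < n) _ => h1 h2 h4.
have -> : D - v * w = (D - A * B) + ((A - v) * (B - w) + (A - v) * w + v * (B - w)) by ring.
apply: le_trans (ncD _ _) _.
have t1 : nc ((A - v) * (B - w)) <= d.
  by rewrite ncM -[d]mulr1 ler_pM ?nc_ge0 // (le_trans h2).
have t2 : nc ((A - v) * w) <= d * nc w by rewrite ncM ler_wpM2r ?nc_ge0.
have t3 : nc (v * (B - w)) <= d * nc v by rewrite ncM mulrC ler_wpM2r ?nc_ge0.
have t4 := ncD ((A - v) * (B - w) + (A - v) * w) (v * (B - w)).
have t5 := ncD ((A - v) * (B - w)) ((A - v) * w).
have dM : 0 <= d * (M * M') by rewrite !mulr_ge0 // ltW.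
have : 3 * (d + d * nc w + d * nc v) <= e.
  by apply: le_trans dE; move: dM; lra.
by lra.
Qed.

(** ** Restriction of a series in two variables to a line through the origin *)

Definition line (x t : C) f : fps C := ev (fps_const x * fps_X) (map_fps (rescale t) f).

(** [line x t f] is [f(x T, t T)] in an auxiliary variable [T], so its sum is the value of [f] at
    [(x, t)]. Multiplicativity turns a factorization of series into one of values. *)
Lemma lineM x t f g : line x t (f * g) = line x t f * line x t g.
Proof.
have z0 : (fps_const x * fps_X : fps C) 0%N = 0 by rewrite mul_fps_const mulr0.
by rewrite /line map_fpsM evM.
Qed.

Lemma line_prod x t (I : Type) (r : seq I) (F : I -> fps (fps C)) :
  line x t (\prod_(i <- r) F i) = \prod_(i <- r) line x t (F i).
Proof.
have z0 : (fps_const x * fps_X : fps C) 0%N = 0 by rewrite mul_fps_const mulr0.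
elim: r => [|i r IH]; last by rewrite !big_cons lineM IH.
rewrite !big_nil /line (_ : map_fps _ _ = 1) ?ev_1 //.
by apply: fpsP => -[|i]; rewrite [LHS]/= ?rmorph1 ?rmorph0.
Qed.

Lemma line_xsub x t phi : line x t (xsub phi) = fps_const x * fps_X - rescale t phi.
Proof.
have z0 : (fps_const x * fps_X : fps C) 0%N = 0 by rewrite mul_fps_const mulr0.
rewrite /line -(ev_xsub (rescale t phi) z0); congr (ev _ _); apply: fpsP => k.
rewrite -[LHS]/(rescale t (xsub phi k)) /xsub !fps_coefB rmorphB.
by congr (_ - _); rewrite /=; case: eqP => _; rewrite ?rmorph1 ?rmorph0.
Qed.

Lemma line_coef x t f n :
  line x t f n = \sum_(i < n.+1) f i (n - i)%N * t ^+ (n - i) * x ^+ i.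
Proof.
have z0 : (fps_const x * fps_X : fps C) 0%N = 0 by rewrite mul_fps_const mulr0.
rewrite [LHS](ev_sumE _ z0 (ltnSn n)); apply: eq_bigr => -[k kn] _; rewrite [nat_of_ord _]/=.
set h := map_fps _ f k; rewrite exprMn fps_constX mulrCA [h * _]mulrC mul_fps_const mul_fps_Xn.
by rewrite -ltnS kn mulrC.
Qed.

Lemma nb_rescale (t : C) s rho M : nb (nc t * rho) s M -> nb rho (rescale t s) M.
Proof.
move=> H n; apply: le_trans (H n); apply: ler_sum => k _.
by rewrite /= ncM ncX exprMn mulrA.
Qed.

Lemma nb_fps_X rho : 0 <= rho -> nb rho (fps_X : fps C) rho.
Proof.
move=> r0 [|[|n]]; first by rewrite big_ord0.
  by rewrite big_ord_recl big_ord0 /= nc0 mul0r addr0.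
rewrite !big_ord_recl big1 => [|k _]; last by rewrite (_ : fps_X _ = 0) // nc0 mul0r.
by rewrite (_ : fps_X 0%N = 0) // (_ : fps_X _ = 1) // nc0 nc1 mul0r mul1r expr1 add0r addr0.
Qed.

(** [M] does not depend on the radius [K]: a larger [K] is paid for by a smaller neighbourhood.
    Taking [K] large against [M] then lets the constant term dominate. *)
Lemma nb_line f : cv2 f -> exists M : R, forall K, 0 < K -> exists r, 0 < r /\
  forall x t : C, nc x <= r -> nc t <= r -> nb K (line x t f) M.
Proof.
move=> /cv2_nb[rho [M [sg [r0 M0 s0 H]]]]; exists (M * 2) => K K0.
have d0 : 0 < Num.min (rho / K) (2^-1 / (sg * K)).
  by rewrite lt_min !divr_gt0 ?mulr_gt0 // invr_gt0.
exists (Num.min (rho / K) (2^-1 / (sg * K))); split=> // x t.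
rewrite !le_min => /andP[x1 x2] /andP[t1 t2].
have z0 : (fps_const x * fps_X : fps C) 0%N = 0 by rewrite mul_fps_const mulr0.
refine (@nb_ev _ K _ _ M sg (nc x * K) (ltW K0) M0 (ltW s0) z0 _ _ _).
- apply: nbM; [exact: ltW | by apply: nb_const; rewrite ltW | by apply: nb_fps_X; rewrite ltW].
- move=> i; apply: nb_rescale; apply: nbW (H i).
  by rewrite mulr_ge0 ?nc_ge0 ?(ltW K0) //= -ler_pdivlMr.
- by rewrite mulrCA -ler_pdivlMr ?mulr_gt0.
Qed.

Lemma nb_val s : cv1 s -> exists M : R, forall K, 0 < K -> exists r, 0 < r /\
  forall t : C, nc t <= r -> nb K (rescale t s) M.
Proof.
move=> /cv1P[rho [M [r0 H]]]; exists M => K K0; exists (rho / K).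
split=> [|t tr]; first by rewrite divr_gt0.
apply: nb_rescale; apply: nbW H.
by rewrite mulr_ge0 ?nc_ge0 ?(ltW K0) //= -ler_pdivlMr.
Qed.

(* The junk value [0] is taken when the series diverges. *)
Fact sval_key : unit. Proof. exact: tt. Qed.
Definition sval s (t : C) : C :=
  locked_with sval_key (xget 0 [set v | sumto (rescale t s) v]).

Lemma svalP s : cv1 s -> exists r : R, 0 < r /\ forall t : C, nc t <= r ->
  sumto (rescale t s) (sval s t).
Proof.
move=> /nb_val[M /(_ 2 (ltr0Sn _ _))[r [r0 H]]]; exists r; split=> // t /H nbt.
rewrite /sval unlock.
by apply: (@xgetPex _ 0 [set v | sumto (rescale t s) v]); apply: sumto_exists nbt; rewrite ler1n.
Qed.

End Values.

(** * Two-sided bounds near the origin *)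

Section FactorBounds.
Variable R : realType.
Local Notation C := (R[i]).
Implicit Types (s u phi psi : fps C) (f g : fps (fps C)).

(** In the norm at radius [K] every term of positive degree is counted with a factor at least
    [K]. *)
Lemma sumto_near (s : fps C) v (M K : R) : 1 <= K -> nb K s M -> sumto s v ->
  nc (v - s 0%N) <= M / K.
Proof.
move=> K1 H; have K0 : 0 < K by apply: lt_le_trans K1.
apply: nc_sumto_le => n; rewrite big_ord_recl addrC addKr.
apply: le_trans (nc_sum _ _ _) _; rewrite ler_pdivlMr // mulr_suml.
apply: le_trans (H n.+1); rewrite big_ord_recl.
apply: ler_wpDl; first by rewrite mulr_ge0 ?nc_ge0 ?exprn_ge0 // ltW.
apply: ler_sum => k _; rewrite ler_wpM2l ?nc_ge0 // exprS ler_peMr ?(ltW K0) //.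
by rewrite exprn_ege1.
Qed.

Lemma dominant_scale (M d : R) : 0 < d -> exists K : R, 2 <= K /\ M / K <= d / 2.
Proof.
move=> d0; exists (2 + 2 * `|M| / d); have h : 0 <= 2 * `|M| / d.
  by rewrite divr_ge0 ?mulr_ge0 // ltW.
split; first by rewrite lerDl.
rewrite ler_pdivrMr; last by rewrite ltr_pwDl.
rewrite (_ : d / 2 * _ = d + `|M|); last by field; rewrite gt_eqF.
by apply: le_trans (ler_norm M) _; rewrite lerDr ltW.
Qed.

Lemma unit_bounds f : cv2 f -> f 0%N 0%N != 0 -> exists r : R, 0 < r /\
  forall x t : C, nc x <= r -> nc t <= r -> (exists M, nb 2 (line x t f) M) /\
    exists w, sumto (line x t f) w /\
      nc (f 0%N 0%N) / 2 <= nc w <= 2 * nc (f 0%N 0%N).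
Proof.
move=> cf f0; have [M HM] := nb_line cf.
have d0 : 0 < nc (f 0%N 0%N) by rewrite nc_gt0.
have [K [K2 MK]] := dominant_scale M d0.
have K0 : 0 < K by apply: lt_le_trans K2.
have [r [r0 Hr]] := HM K K0; exists r; split=> // x t xr tr.
have nbK := Hr x t xr tr; have nb2 : nb 2 (line x t f) M by apply: nbW nbK; rewrite ler0n.
split; first by exists M.
have K1 : 1 <= K by apply: le_trans K2; rewrite ler1n.
have [w Hw] := sumto_exists K1 nbK; exists w; split=> //.
have := sumto_near K1 nbK Hw.
have -> : line x t f 0%N = f 0%N 0%N.
  by rewrite line_coef big_ord_recl big_ord0 subnn !expr0 !mulr1 addr0.
move=> h; have h1 := ncB_ge (f 0%N 0%N) w; have h2 := ncB_ge w (f 0%N 0%N).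
by rewrite nc_distC in h1; lra.
Qed.

Lemma ford_bounds s n : cv1 s -> ford s n -> exists c B r : R, [/\ 0 < c, 0 < B, 0 < r &
  forall t : C, nc t <= r -> c * nc t ^+ n <= nc (sval s t) <= B * nc t ^+ n].
Proof.
move=> cs [sn vs]; pose s' : fps C := Fps (fun k => s (n + k)%N).
have E : s = fps_X ^+ n * s'.
  by apply: fpsP => k; rewrite mul_fps_Xn; case: leqP => [nk|/vs //]; rewrite /= subnKC.
have s'0 : s' 0%N != 0 by rewrite /= addn0.
have cs' : cv1 s'.
  have [M [sg [s0 H]]] := cs; exists (M * sg ^+ n), sg; split=> // k.
  by rewrite -mulrA -exprD; apply: H.
have d0 : 0 < nc (s' 0%N) by rewrite nc_gt0.
have [M HM] := nb_val cs'; have [K [K2 MK]] := dominant_scale M d0.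
have K0 : 0 < K by apply: lt_le_trans K2.
have [r1 [r10 H1]] := HM K K0; have [r2 [r20 H2]] := svalP cs.
exists (nc (s' 0%N) / 2), (2 * nc (s' 0%N)), (Num.min r1 r2).
split; rewrite ?divr_gt0 ?mulr_gt0 ?lt_min ?r10 // => t.
rewrite le_min => /andP[/H1 nbK /H2 sv].
have K1 : 1 <= K by apply: le_trans K2; rewrite ler1n.
have [w Hw] := sumto_exists K1 nbK.
have nb2 : nb 2 (rescale t s') M by apply: nbW nbK; rewrite ler0n.
have -> : sval s t = t ^+ n * w.
  apply: (sumto_uniq sv); rewrite {1}E rescaleM.
  have -> : rescale t (fps_X ^+ n) = fps_const (t ^+ n) * fps_X ^+ n.
    apply: fpsP => k; rewrite mul_fps_const -[fps_X ^+ n]mulr1 /rescale.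
    rewrite -[LHS]/((fps_X ^+ n * 1 : fps C) k * t ^+ k) mul_fps_Xn fps_coef1.
    case: (ltngtP n k) => [nk|kn|->]; last by rewrite subnn mul1r mulr1.
      by rewrite subn_eq0 leqNgt nk mul0r mulr0.
    by rewrite mul0r mulr0.
  have nbm : nb 2 (fps_const (t ^+ n) * fps_X ^+ n) (nc (t ^+ n) * 2 ^+ n).
    by apply: nbM; [by [] | exact: nb_const | apply: nbX => //; exact: nb_fps_X].
  by apply: sumtoM nbm nb2 _ Hw; apply: sumto_monomial.
rewrite ncM ncX; have := sumto_near K1 nbK Hw.
have -> : rescale t s' 0%N = s' 0%N by rewrite /= expr0 mulr1.
move=> h; have h1 := ncB_ge (s' 0%N) w; have h2 := ncB_ge w (s' 0%N).
rewrite nc_distC in h1; have tn : 0 <= nc t ^+ n by rewrite exprn_ge0 ?nc_ge0.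
by rewrite [_ / 2 * _]mulrC [2 * _ * _]mulrC !ler_wpM2l //; lra.
Qed.

Lemma linear_factors (rs : seq (fps C)) : (forall phi, phi \in rs -> cv1 phi) ->
  exists r : R, 0 < r /\ forall x t : C, nc x <= r -> nc t <= r ->
    (exists M, nb 2 (line x t (\prod_(phi <- rs) xsub phi)) M) /\
    sumto (line x t (\prod_(phi <- rs) xsub phi)) (\prod_(phi <- rs) (x - sval phi t)).
Proof.
elim: rs => [|phi rs IH] crs.
  exists 1; split=> // x t _ _; have L1 : line x t 1 = 1.
    by have := line_prod x t [::] (@xsub C); rewrite !big_nil.
  rewrite !big_nil L1.
  split; first by exists (nc (1 : C)); apply: nb_const.
  by have := @sumto_monomial R 1 0; rewrite expr0 mulr1.
have [r1 [r10 H1]] := IH (fun psi h => crs psi (mem_behead (s := phi :: rs) h)).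
have cphi : cv1 phi by apply: crs; rewrite mem_head.
have [r2 [r20 H2]] := svalP cphi.
have [M2 HM2] := nb_val cphi; have [r3 [r30 H3]] := HM2 2 (ltr0Sn _ _).
exists (Num.min r1 (Num.min r2 r3)); rewrite !lt_min r10 r20; split=> // x t.
rewrite !le_min => /and3P[x1 _ _] /and3P[t1 /H2 sphi /H3 nphi].
have [[M nM] sM] := H1 x t x1 t1.
have nx : nb 2 (fps_const x * fps_X) (nc x * 2).
  by apply: nbM; [by [] | exact: nb_const | exact: nb_fps_X].
have nl : nb 2 (line x t (xsub phi)) (nc x * 2 + M2).
  by rewrite line_xsub; apply: nbD nx _ => //; apply: nbN.
have sl : sumto (line x t (xsub phi)) (x - sval phi t).
  rewrite line_xsub; apply: sumtoD; last exact: sumtoN.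
  by have := @sumto_monomial R x 1; rewrite expr1.
rewrite !big_cons lineM; split; first by exists ((nc x * 2 + M2) * M); apply: nbM.
exact: sumtoM nl nM sl sM.
Qed.

Definition germ (a : nat -> nat -> R) : fps (fps C) :=
  Fps (fun i => Fps (fun k => (a i k)%:C)).

Lemma cv2_germ a : cps a -> cv2 (germ a).
Proof.
by move=> [M [sg [s0 H]]]; exists M, sg; split=> // i k; rewrite nc_real.
Qed.

Lemma ord_sum_eq (V : nmodType) K n (G : nat -> V) : (n < K)%N ->
  \sum_(i < K) (if i == n :> nat then G i else 0) = G n.
Proof.
move=> nK; rewrite -big_mkcond (big_pred1 (Ordinal nK)) //.
Qed.

Lemma triangle_sum (V : nmodType) (F : nat -> nat -> V) K :
  \sum_(n < K) \sum_(i < n.+1) F i (n - i)%N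
  = \sum_(i < K) \sum_(k < K) (if (i + k < K)%N then F i k else 0).
Proof.
elim: K => [|K IH]; first by rewrite !big_ord0.
rewrite big_ord_recr /= IH.
transitivity (\sum_(i < K.+1) (\sum_(k < K.+1) (if (i + k < K)%N then F i k else 0)
   + F i (K - i)%N)).
  rewrite big_split /=; congr (_ + _); rewrite [RHS]big_ord_recr /=.
  rewrite [X in _ + X]big1 ?addr0 => [|k _]; last by rewrite ifF // ltnNge leq_addr.
  by apply: eq_bigr => i _; rewrite big_ord_recr /= ifF ?addr0 // ltnNge leq_addl.
apply: eq_bigr => -[i iK] _ /=.
rewrite -(@ord_sum_eq _ K.+1 (K - i) (F i)) ?ltnS ?leq_subr // -big_split /=.
apply: eq_bigr => -[k kK] _ /=; case: (ltngtP (i + k) K) => h.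
- by rewrite ltnW ?h // ifF ?addr0 //; apply/eqP; lia.
- by rewrite ltnNge h /= ifF ?addr0 //; apply/eqP; lia.
- by rewrite ifT ?ifT ?add0r //; [apply/eqP; lia | lia].
Qed.

Lemma multiples_sum (V : nmodType) (G : nat -> V) N K : (0 < N)%N ->
  \sum_(k < K) (if (N %| k)%N then G k else 0)
  = \sum_(j < K) (if (N * j < K)%N then G (N * j)%N else 0).
Proof.
move=> N0.
transitivity (\sum_(j < K) \sum_(k < K) (if (k : nat) == (N * j)%N then G k else 0)).
  rewrite exchange_big /=; apply: eq_bigr => -[k kK] _ /=.
  case: ifP => [/dvdnP[j kj]|nd]; last first.
    by rewrite big1 // => j _; case: eqP => // kj; rewrite kj dvdn_mulr in nd.
  have jK : (j < K)%N by apply: leq_ltn_trans kK; rewrite kj leq_pmulr.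
  rewrite (eq_bigr (fun i : 'I_K => if (i : nat) == j then G k else 0)); last first.
    move=> i _; congr (if _ then _ else _); rewrite kj mulnC eqn_pmul2l //.
  by rewrite (@ord_sum_eq _ _ j (fun=> G k)).
apply: eq_bigr => -[j jK] _ /=; case: ifP => h; first by rewrite ord_sum_eq.
by rewrite big1 // => -[k kK] _ /=; case: eqP => // kj; rewrite -kj kK in h.
Qed.

(* [pseval] sums over [i + j < K], the series in [(x, t)] over [i + N j < K]; the
   difference of these partial sums is exponentially small. *)
Lemma line_ram2_close f N : (0 < N)%N -> cv2 f -> exists B r : R,
  [/\ 0 <= B, 0 < r & forall x t : C, nc x <= r -> nc t <= r -> forall K,
  nc (\sum_(n < K) line x (t ^+ N) f n - \sum_(n < K) line x t (ram2 N f) n)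
    <= B * 2^-1 ^+ K].
Proof.
move=> N0 [M [sg [s0 H]]].
have M0 : 0 <= M.
  by apply: le_trans (nc_ge0 (f 0%N 0%N)) _; have := H 0%N 0%N; rewrite expr0 mulr1.
pose S := 1 + sg; have S1 : 1 <= S by rewrite lerDl ltW.
have S0 : 0 < S by apply: lt_le_trans S1.
(* This radius bounds the term of index [(i, j)] by [M * 4^-(i + N j)]. Half of the decay yields
   [2^-K] where the two sums differ, the other half makes the double sum at most 4. *)
exists (M * 4), (4 * S)^-1; split=> [||x t xr tr K]; first by rewrite mulr_ge0.
  by rewrite invr_gt0 mulr_gt0.
have xS : nc x * S <= 4^-1 by rewrite -ler_pdivlMr // -invfM.
have tS : nc t * S <= 4^-1 by rewrite -ler_pdivlMr // -invfM.
pose w i j := f i j * (t ^+ N) ^+ j * x ^+ i.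
have wb i j : nc (w i j) <= M * 4^-1 ^+ (i + N * j).
  rewrite !ncM !ncX exprD -exprM.
  apply: (@le_trans _ _ (M * ((nc x * S) ^+ i * (nc t * S) ^+ (N * j)))); last first.
    rewrite ler_wpM2l // ler_pM ?exprn_ge0 ?mulr_ge0 ?nc_ge0 ?(ltW S0) //.
      by rewrite lerXn2r ?nnegrE ?mulr_ge0 ?nc_ge0 ?(ltW S0) ?invr_ge0.
    by rewrite lerXn2r ?nnegrE ?mulr_ge0 ?nc_ge0 ?(ltW S0) ?invr_ge0.
  rewrite [X in _ <= X](_ : _ = M * S ^+ (i + N * j) * nc t ^+ (N * j) * nc x ^+ i); last first.
    by rewrite !exprMn exprD; ring.
  rewrite !ler_wpM2r ?exprn_ge0 ?nc_ge0 //; apply: le_trans (H i j) _.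
  rewrite ler_wpM2l //; apply: (@le_trans _ _ (S ^+ (i + j))).
    by rewrite lerXn2r ?nnegrE ?(ltW s0) ?(ltW S0) // lerDr.
  by rewrite ler_weXn2l // leq_add2l leq_pmull.
have -> : \sum_(n < K) line x (t ^+ N) f n
    = \sum_(i < K) \sum_(j < K) (if (i + j < K)%N then w i j else 0).
  rewrite -triangle_sum; apply: eq_bigr => n _; rewrite line_coef.
  by apply: eq_bigr.
have -> : \sum_(n < K) line x t (ram2 N f) n
    = \sum_(i < K) \sum_(j < K) (if (i + N * j < K)%N then w i j else 0).
  pose F i k := ram2 N f i k * t ^+ k * x ^+ i.
  transitivity (\sum_(n < K) \sum_(i < n.+1) F i (n - i)%N).
    by apply: eq_bigr => n _; rewrite line_coef.
  rewrite triangle_sum; apply: eq_bigr => -[i iK] _ /=.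
  transitivity (\sum_(k < K) (if (N %| k)%N then (if (i + k < K)%N then w i (k %/ N)%N else 0) else 0)).
    apply: eq_bigr => -[k kK] _ /=; rewrite /F [ram2 N f i k](@ramE _ N (f i)) //.
    case: ifP => ik; case: ifP => // /dvdnP; last by rewrite !mul0r.
    by case=> j ->; rewrite mulnK // /w -exprM mulnC.
  rewrite (multiples_sum (fun k => if (i + k < K)%N then w i (k %/ N)%N else 0) K N0).
  apply: eq_bigr => -[j jK] _ /=; rewrite mulKn //.
  by case: ifP => // h; rewrite ifF //; lia.
rewrite -sumrB; apply: le_trans (nc_sum _ _ _) _.
apply: (@le_trans _ _ (\sum_(i < K) \sum_(j < K) M * 2^-1 ^+ K * (2^-1 ^+ i * 2^-1 ^+ j))).
  apply: ler_sum => i _; rewrite -sumrB; apply: le_trans (nc_sum _ _ _) _.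
  apply: ler_sum => j _.
  have nn : 0 <= M * 2^-1 ^+ K * (2^-1 ^+ i * 2^-1 ^+ j) by rewrite !mulr_ge0 ?exprn_ge0 ?invr_ge0.
  have le1 : (j <= N * j)%N by rewrite leq_pmull.
  case: ifP => h1; case: ifP => h2; rewrite ?subrr ?nc0 //; last first.
    by case/negP: h1; rewrite (leq_ltn_trans _ h2) // leq_add2l.
  rewrite subr0; apply: le_trans (wb _ _) _; rewrite -mulrA ler_wpM2l //.
  have -> : (4^-1 : R) = 2^-1 * 2^-1 by field.
  rewrite exprMn -[2^-1 ^+ i * _]exprD ler_pM ?exprn_ge0 ?invr_ge0 //.
    by rewrite ler_wiXn2l ?invr_ge0 // ?invf_le1 ?ler1n // leqNgt h2.
  by rewrite ler_wiXn2l ?invr_ge0 // ?invf_le1 ?ler1n // leq_add2l.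
under eq_bigr => i _ do rewrite -mulr_sumr -mulr_sumr.
rewrite -mulr_sumr -mulr_suml.
have g0 : 0 <= \sum_(i < K) (2^-1 : R) ^+ i by rewrite sumr_ge0 // => k _; rewrite exprn_ge0 ?invr_ge0.
have := geo_half R K; move: g0; set G := \sum_(i < K) _ => g0 g2.
have -> : M * 4 * 2^-1 ^+ K = M * 2^-1 ^+ K * (2 * 2) by ring.
by rewrite ler_wpM2l ?mulr_ge0 ?exprn_ge0 ?invr_ge0 // ler_pM.
Qed.

Lemma pseval_line a N : (0 < N)%N -> cps a -> exists r : R, 0 < r /\
  forall x t : R, `|x| <= r -> `|t| <= r ->
    sumto (line x%:C t%:C (ram2 N (germ a))) (pseval a x (t ^+ N))%:C.
Proof.
move=> N0 /cv2_germ ca; have [B [r1 [B0 r10 H1]]] := line_ram2_close N0 ca.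
have [M HM] := nb_line (cv2_ram2 N0 ca); have [r2 [r20 H2]] := HM 2 (ltr0Sn _ _).
exists (Num.min r1 r2); rewrite lt_min r10; split=> // x t.
rewrite !le_min => /andP[x1 x2] /andP[t1 t2].
have := H2 x%:C t%:C; rewrite !nc_real => /(_ x2 t2)/sumto_exists[]; first by rewrite ler1n.
move=> v sv; have := H1 x%:C t%:C; rewrite !nc_real => /(_ x1 t1) close.
have sv' := sumto_close B0 sv close.
pose S K := series (fun n : nat => \sum_(i < n.+1) a i (n - i)%N * x ^+ i * (t ^+ N) ^+ (n - i)%N) K.
have SE K : \sum_(n < K) line x%:C (t%:C ^+ N) (germ a) n = (S K)%:C.
  rewrite /S seriesEord rmorph_sum; apply: eq_bigr => n _; rewrite line_coef rmorph_sum.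
  by apply: eq_bigr => i _; rewrite !rmorphM !rmorphXn /= mulrAC.
have Ev : v = (complex.Re v)%:C.
  apply: complex_eqP => //=; apply/eqP; rewrite -normr_eq0 eq_le normr_ge0 andbT.
  apply/ler_addgt0Pr => e e0; have [n Hn] := sv' e e0; have := Hn n (leqnn n).
  rewrite SE add0r => h; apply: le_trans h; apply: le_trans (Im_le_nc _).
  by case: (v) => p q /=; rewrite sub0r normrN.
suff -> : pseval a x (t ^+ N) = complex.Re v by rewrite -Ev.
apply: (@cvg_lim R); first exact: Rhausdorff.
apply/cvgrPdist_le => e e0; have [n Hn] := sv' e e0; exists n => // k /= nk.
have := Hn k nk; rewrite SE => h; apply: le_trans h; rewrite distrC.
apply: le_trans (Re_le_nc _); rewrite -/(S k).
by case: (v) => p q /=.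
Qed.

Lemma factor_bounds a N (rs : seq (fps C)) (u : fps (fps C)) : (0 < N)%N -> cps a ->
  (forall phi, phi \in rs -> cv1 phi) -> cv2 u -> u 0%N 0%N != 0 ->
  ram2 N (germ a) = \prod_(phi <- rs) xsub phi * u ->
  exists c B r : R, [/\ 0 < c, 0 < B, 0 < r & forall x t : R, `|x| <= r -> `|t| <= r ->
    c * \prod_(phi <- rs) nc (x%:C - sval phi t%:C) <= `|pseval a x (t ^+ N)|
      <= B * \prod_(phi <- rs) nc (x%:C - sval phi t%:C)].
Proof.
move=> N0 ca crs cu u0 E.
have [r1 [r10 H1]] := linear_factors crs; have [r2 [r20 H2]] := unit_bounds cu u0.
have [r3 [r30 H3]] := pseval_line N0 ca.
have d0 : 0 < nc (u 0%N 0%N) by rewrite nc_gt0.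
exists (nc (u 0%N 0%N) / 2), (2 * nc (u 0%N 0%N)), (Num.min r1 (Num.min r2 r3)).
rewrite divr_gt0 ?mulr_gt0 ?lt_min ?r10 ?r20 //; split=> // x t.
rewrite !le_min => /and3P[x1 x2 x3] /and3P[t1 t2 t3].
have := H3 x t x3 t3; rewrite E lineM => s3.
have nE (y e : R) : `|y| <= e -> nc y%:C <= e by rewrite nc_real.
have [[M nM] sM] := H1 x%:C t%:C (nE _ _ x1) (nE _ _ t1).
have [[M' nM'] [w [sw wb]]] := H2 x%:C t%:C (nE _ _ x2) (nE _ _ t2).
have := sumto_uniq s3 (sumtoM nM nM' sM sw) => Ev.
have -> : `|pseval a x (t ^+ N)| = nc (pseval a x (t ^+ N))%:C by rewrite nc_real.
rewrite Ev ncM nc_prod; case/andP: wb => w1 w2.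
have p0 : 0 <= \prod_(phi <- rs) nc (x%:C - sval phi t%:C).
  by apply: prodr_ge0 => phi _; apply: nc_ge0.
by rewrite [_ * nc w]mulrC !ler_wpM2r.
Qed.

End FactorBounds.

(** * Lower bound for the exponent: test curves *)

Section Curves.
Variable R : realType.
Local Notation C := (R[i]).
Implicit Types (s u phi psi : fps C) (f g : fps (fps C)) (a b : nat -> nat -> R).
Implicit Type p : puiseux R.

(** * Translation of the definitions on coefficient functions into the rings of series *)

Definition pser p : fps C := Fps (pc p).
Definition fps2_of (h : nat -> nat -> C) : fps (fps C) := Fps (fun i => Fps (h i)).
Definition pgerm a p : fps (fps C) := ram2 (pden p) (germ a).

Lemma powSE (s : nat -> C) i n : powS s i n = (Fps s ^+ i : fps C) n.
Proof.
elim: i n => [|i IH] n; first by rewrite expr0.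
rewrite exprS fps_coefM; apply: eq_bigr => j _.
by rewrite -IH.
Qed.

Lemma subst2E h p n : pc p 0%N = 0 -> subst2 h p n = ev (pser p) (fps2_of h) n.
Proof.
move=> p0; rewrite (ev_sumE _ (p0 : pser p 0%N = 0) (ltnSn n)); apply: eq_bigr => j _.
by rewrite fps_coefM; apply: eq_bigr => k _; rewrite powSE.
Qed.

Lemma lift_pgerm a p i k : Defs.lift a (pden p) i k = pgerm a p i k.
Proof. by []. Qed.

Lemma fsubstE a p n : pc p 0%N = 0 -> fsubst a p n = ev (pser p) (pgerm a p) n.
Proof.
move=> p0; rewrite /fsubst subst2E //.
Qed.

Lemma mul2E (u v : nat -> nat -> C) i k : mul2 u v i k = (fps2_of u * fps2_of v) i k.
Proof.
by rewrite fps_coefM fps_coef_sum; apply: eq_bigr => j _.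
Qed.

Lemma fps2_of_mul2 (u v : nat -> nat -> C) : fps2_of (mul2 u v) = fps2_of u * fps2_of v.
Proof. by apply: fpsP => i; apply: fpsP => k; rewrite -mul2E. Qed.

Lemma fps2_of_pow2 (u : nat -> nat -> C) m : fps2_of (pow2 u m) = fps2_of u ^+ m.
Proof.
elim: m => [|m IH]; last by rewrite exprS -IH -fps2_of_mul2.
by rewrite expr0; apply: fpsP => -[|i]; apply: fpsP => -[|k].
Qed.

Lemma xminusE p : fps2_of (xminus p) = xsub (pser p).
Proof.
apply: fpsP => i; apply: fpsP => k; rewrite !fps_coefB.
case: i => [|[|i]]; first exact: esym (sub0r (pc p k)).
  by case: k => [|k]; [exact: esym (subr0 1) | exact: esym (subr0 0)].
exact: esym (subr0 0).
Qed.

Lemma mult_factorP a p m : pc p 0%N = 0 -> mult_factor a p m <->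
  exists h, pgerm a p = xsub (pser p) ^+ m * h /\ ev (pser p) h != 0.
Proof.
move=> p0; split=> [[h [E [n hn]]]|[h [E hn]]].
  exists (fps2_of h); split.
    rewrite -xminusE -fps2_of_pow2 -fps2_of_mul2; apply: fpsP => i; apply: fpsP => k.
    by rewrite -lift_pgerm E.
  by apply: contraNneq hn => e; rewrite subst2E // e.
have hE : fps2_of (fun i k => h i k) = h by apply: fpsP => i; apply: fpsP.
exists (fun i k => h i k); split=> [i k|].
  by rewrite mul2E fps2_of_pow2 xminusE hE -E.
have [n [hn' _]] := ford_exists hn; exists n.
by rewrite subst2E // hE.
Qed.

Lemma is_puiseuxP p : is_puiseux p <-> pser p 0%N = 0 /\ cv1 (pser p).
Proof. by []. Qed.

Lemma ord_isP a p n : pc p 0%N = 0 ->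
  ord_is (fsubst a p) n <-> ford (ev (pser p) (pgerm a p)) n.
Proof.
by move=> p0; split=> -[h1 h2]; split=> [|k kn]; rewrite -?fsubstE ?fsubstE // ?h2 // -fsubstE // h2.
Qed.

Lemma np_rootP a p : np_root a p <->
  [/\ pser p 0%N = 0, cv1 (pser p) & ev (pser p) (pgerm a p) = 0].
Proof.
split=> [[[p0 cp] H]|[p0 cp H]].
  by split=> //; apply: fpsP => n; rewrite -fsubstE // H.
by split=> [|n]; [split | rewrite fsubstE // H].
Qed.

Definition real_fps s := forall k, exists r : R, s k = r%:C.

Lemma real_fps_Im s k : real_fps s -> complex.Im (s k) = 0.
Proof. by move=> /(_ k)[r ->]. Qed.

Lemma sval_real s : cv1 s -> real_fps s -> exists r : R, 0 < r /\ forall t : R,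
  `|t| <= r -> sval s t%:C = (complex.Re (sval s t%:C))%:C.
Proof.
move=> cs rs; have [r [r0 H]] := svalP cs; exists r; split=> // t tr.
have := H t%:C; rewrite nc_real => /(_ tr) sv; set v := sval _ _ in sv *.
apply: complex_eqP => //=; apply/eqP; rewrite -normr_eq0 eq_le normr_ge0 andbT.
apply/ler_addgt0Pr => e e0; have [n Hn] := sv e e0; rewrite add0r.
apply: le_trans (Hn n (leqnn n)); apply: le_trans (Im_le_nc _).
have -> : \sum_(k < n) rescale t%:C s k = (\sum_(k < n) complex.Re (s k) * t ^+ k)%:C.
  rewrite rmorph_sum; apply: eq_bigr => k _; rewrite rmorphM rmorphXn /=.
  by have [z ->] := rs k.
by case: (v) => x y /=; rewrite sub0r normrN.
Qed.

Lemma svalB s u : cv1 s -> cv1 u -> exists r : R, 0 < r /\ forall t : C,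
  nc t <= r -> sval (s - u) t = sval s t - sval u t.
Proof.
move=> cs cu; have [r1 [r10 H1]] := svalP cs; have [r2 [r20 H2]] := svalP cu.
have [r3 [r30 H3]] := svalP (cv1D cs (cv1N cu)).
exists (Num.min r1 (Num.min r2 r3)); rewrite !lt_min r10 r20; split=> // t.
rewrite !le_min => /and3P[/H1 h1 /H2 h2 /H3 h3]; apply: (sumto_uniq h3).
have -> : rescale t (s - u) = rescale t s - rescale t u by exact: rmorphB.
exact: (sumtoD h1 (sumtoN h2)).
Qed.

Lemma sval_small s (e : R) : cv1 s -> s 0%N = 0 -> 0 < e ->
  exists r : R, 0 < r /\ forall t : C, nc t <= r -> nc (sval s t) <= e.
Proof.
move=> cs s0 e0; have [M HM] := nb_val cs; have [K [K2 MK]] := dominant_scale M e0.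
have K0 : 0 < K by apply: lt_le_trans K2.
have [r1 [r10 H1]] := HM K K0; have [r2 [r20 H2]] := svalP cs.
exists (Num.min r1 r2); rewrite lt_min r10; split=> // t; rewrite le_min => /andP[/H1 h1 /H2 h2].
have K1 : 1 <= K by apply: le_trans K2; rewrite ler1n.
have := sumto_near K1 h1 h2; rewrite [rescale _ _ _]/= s0 mul0r subr0 => h3.
by apply: le_trans h3 _; apply: le_trans MK _; rewrite ler_pdivrMr // ler_peMr ?ler1n // ltW.
Qed.

Lemma sval0 s : s 0%N = 0 -> cv1 s -> sval s 0 = 0.
Proof.
move=> s0 cs; have [r [r0 H]] := svalP cs; apply: (sumto_uniq (H 0 _)); first by rewrite nc0 ltW.
move=> e e0; exists 0%N => n _; rewrite big1 ?subr0 ?nc0 ?ltW // => -[[|k] kn] _ /=.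
  by rewrite s0 mul0r.
by rewrite expr0n mulr0.
Qed.

(* [rs] lists the roots of [a] with multiplicity, as series in [t = y^(1/N)]. *)
Definition factored a (N : nat) (rs : seq (fps C)) :=
  [/\ (0 < N)%N, cps a, forall phi, phi \in rs -> phi 0%N = 0 /\ cv1 phi &
   exists u : fps (fps C), [/\ cv2 u, u 0%N 0%N != 0 &
     ram2 N (germ a) = \prod_(phi <- rs) xsub phi * u]].

Lemma factored_ram a N M rs : (0 < M)%N -> factored a N rs ->
  factored a (M * N) [seq ram M phi | phi <- rs].
Proof.
move=> M0 [N0 ca rsP [u [cu u0 E]]]; split; [by rewrite muln_gt0 M0 | by [] | | ].
  move=> _ /mapP[phi /rsP[p0 cp] ->]; split; [by rewrite ram_coef0 | exact: cv1_ram].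
exists (ram2 M u); split.
- exact: cv2_ram2.
- by rewrite [ram2 _ _ _ _]ram_coef0.
rewrite -(ram2_ram2 _ M0 N0) E ram2M ram2_prod big_map; congr (_ * _).
by apply: eq_bigr => phi _; rewrite ram2_xsub.
Qed.

Lemma factored_exists a m : cps a -> xreg m (germ a) ->
  exists N rs, factored a N rs /\ size rs = m.
Proof.
move=> ca ar; have [N [rs [u [N0 sz rsP [cu u0] E]]]] := puiseux_factorization (cv2_germ ca) ar.
by exists N, rs; split=> //; split=> //; exists u; split.
Qed.

Lemma regular_xreg a : regular_x a -> exists m, xreg m (germ a).
Proof.
move=> [m [low am]]; exists m; split=> [i im|].
  by rewrite /= low ?addn0.
by apply: contraNneq am => /= -[->].
Qed.

Lemma common_factored a b : cps a -> cps b -> regular_x a -> regular_x b ->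
  a 0%N 0%N = 0 -> b 0%N 0%N = 0 ->
  exists N ra rb, [/\ factored a N ra, factored b N rb, (0 < size ra)%N & (0 < size rb)%N].
Proof.
move=> ca cb /regular_xreg[m ar] /regular_xreg[n br] a0 b0.
have [N [ra [Fa sa]]] := factored_exists ca ar.
have [M [rb [Fb sb]]] := factored_exists cb br.
have N0 : (0 < N)%N by case: Fa.
have M0 : (0 < M)%N by case: Fb.
exists (M * N)%N, [seq ram M phi | phi <- ra], [seq ram N phi | phi <- rb].
split; first exact: factored_ram.
- by rewrite mulnC; apply: factored_ram.
- by rewrite size_map sa lt0n; apply/eqP => m0; case: ar => _; rewrite m0 /= a0 eqxx.
- by rewrite size_map sb lt0n; apply/eqP => n0; case: br => _; rewrite n0 /= b0 eqxx.
Qed.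

Lemma ev_factored a N rs psi : factored a N rs -> psi 0%N = 0 ->
  exists v : fps C, v 0%N != 0 /\
    ev psi (ram2 N (germ a)) = \prod_(phi <- rs) (psi - phi) * v.
Proof.
move=> [N0 ca rsP [u [cu u0 E]]] p0; exists (ev psi u); rewrite ev_coef0 // E evM // ev_prod //.
by split=> //; congr (_ * _); apply: eq_bigr => phi _; rewrite ev_xsub.
Qed.

Lemma factored_root a N rs psi : factored a N rs -> psi 0%N = 0 ->
  ev psi (ram2 N (germ a)) = 0 <-> psi \in rs.
Proof.
move=> Fa p0; have [v [v0 ->]] := ev_factored Fa p0; split=> [/eqP|psirs].
  rewrite mulf_eq0 => /orP[|/eqP v00]; last by rewrite v00 eqxx in v0.
  rewrite prodf_seq_eq0 => /hasP[phi phirs /= ].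
  by rewrite subr_eq0 => /eqP ->.
by rewrite (big_rem psi) //= subrr !mul0r.
Qed.

Lemma prod_sval_bounds rs psi (o : fps C -> nat) : cv1 psi ->
  (forall phi, phi \in rs -> cv1 phi /\ ford (psi - phi) (o phi)) ->
  exists c B r : R, [/\ 0 < c, 0 < B, 0 < r & forall t : C, nc t <= r ->
    c * nc t ^+ (\sum_(phi <- rs) o phi) <= \prod_(phi <- rs) nc (sval psi t - sval phi t)
     <= B * nc t ^+ (\sum_(phi <- rs) o phi)].
Proof.
move=> cpsi; elim: rs => [|phi rs IH] H.
  by exists 1, 1, 1; split=> // t _; rewrite !big_nil expr0 mulr1 lexx.
have [c [B [r [c0 B0 r0 Hr]]]] := IH (fun chi h => H chi (mem_behead (s := phi :: rs) h)).
have [cphi fo] := H phi (mem_head _ _).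
have [c' [B' [r' [c'0 B'0 r'0 Hr']]]] := ford_bounds (cv1D cpsi (cv1N cphi)) fo.
have [r3 [r30 H3]] := svalB cpsi cphi.
exists (c' * c), (B' * B), (Num.min r (Num.min r' r3)).
rewrite !mulr_gt0 // !lt_min r0 r'0 r30; split=> // t.
rewrite !le_min => /and3P[/Hr /andP[h1 h2] /Hr' h3 /H3 h4].
move: h3; rewrite h4 => /andP[h3 h5]; rewrite !big_cons exprD.
have t0 := nc_ge0 t.
apply/andP; split; rewrite [_ * _ * (_ * _)]mulrACA; apply: ler_pM => //.
- by rewrite mulr_ge0 ?exprn_ge0 // ltW.
- by rewrite mulr_ge0 ?exprn_ge0 // ltW.
- exact: nc_ge0.
- by apply: prodr_ge0 => chi _; apply: nc_ge0.
Qed.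

Lemma curve_bounds a N rs psi n : factored a N rs -> psi 0%N = 0 -> cv1 psi ->
  real_fps psi -> ford (ev psi (ram2 N (germ a))) n ->
  exists c B r : R, [/\ 0 < c, 0 < B, 0 < r & forall t : R, 0 <= t <= r ->
    c * t ^+ n <= `|pseval a (complex.Re (sval psi t%:C)) (t ^+ N)| <= B * t ^+ n].
Proof.
move=> Fa p0 cp rp fo; have [v [v0 E]] := ev_factored Fa p0.
have [N0 ca rsP [u [cu u0 EF]]] := Fa.
have nz : ev psi (ram2 N (germ a)) != 0 by apply: ford_neq0 fo.
have dif phi : phi \in rs -> psi - phi != 0.
  move=> prs; apply: contraNneq nz => pe; rewrite E (big_rem phi) //= pe.
  by rewrite !mul0r.
pose o phi := xget 0%N [set k | ford (psi - phi) k].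
have oP phi : phi \in rs -> ford (psi - phi) (o phi).
  by move=> /dif/ford_exists[k fk]; apply: (@xgetPex _ 0%N [set k | ford (psi - phi) k]); exists k.
have no : n = \sum_(phi <- rs) o phi.
  apply: (ford_uniq fo); rewrite E -[X in ford _ X]addn0; apply: fordM; last exact: ford0.
  rewrite big_seq [X in ford _ X]big_seq; clear -oP.
  elim: rs oP => [|phi rs IH] oP; first by rewrite !big_nil; apply: ford0; rewrite oner_eq0.
  rewrite -!big_seq !big_cons; apply: fordM; first by apply: oP; rewrite mem_head.
  by rewrite big_seq [X in ford _ X]big_seq; apply: IH => chi h; apply: oP; rewrite inE h orbT.
have H phi : phi \in rs -> cv1 phi /\ ford (psi - phi) (o phi).
  by move=> prs; split; [case: (rsP _ prs) | apply: oP].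
have [c [B [r [c0 B0 r0 Hr]]]] := prod_sval_bounds cp H.
have crs phi : phi \in rs -> cv1 phi by move=> /rsP[].
have [c' [B' [r' [c'0 B'0 r'0 Hr']]]] := factor_bounds N0 ca crs cu u0 EF.
have [r3 [r30 H3]] := sval_real cp rp; have [r4 [r40 H4]] := sval_small cp p0 r'0.
exists (c' * c), (B' * B), (Num.min (Num.min r r') (Num.min r3 r4)).
rewrite !mulr_gt0 // !lt_min r0 r'0 r30 r40; split=> // t /andP[t0].
rewrite !le_min => /andP[/andP[t1 t2] /andP[t3 t4]].
have nt : `|t| = t by rewrite ger0_norm.
have nct : nc t%:C = t by rewrite nc_real.
have := Hr t%:C; rewrite nct -no => /(_ t1)/andP[h1 h2].
have := H3 t; rewrite nt => /(_ t3) => xE; set x := complex.Re _ in xE *.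
have := H4 t%:C; rewrite nct xE nc_real => /(_ t4) xr.
have := Hr' x t xr; rewrite nt => /(_ t2); rewrite -xE => /andP[h3 h4].
apply/andP; split.
  by apply: le_trans h3; rewrite -mulrA ler_wpM2l // ltW.
by apply: le_trans h4 _; rewrite -mulrA ler_wpM2l // ltW.
Qed.

(** Only [y >= 0] is reached by [y = t^N] with [t >= 0]; the other half is the same condition for
    the germs reflected by [flipy]. A square is used because the bounds on [x] and [t] come
    separately. *)
Definition half_admissible a b (al : R) := exists K r : R, [/\ 0 < K, 0 < r &
  forall x y : R, `|x| <= r -> 0 <= y <= r ->
    K * (`|pseval b x y| `^ al) <= `|pseval a x y|].

Lemma power_compare (al K c B r : R) (n1 n2 : nat) :
  0 <= al -> 0 < K -> 0 < c -> 0 < B -> 0 < r ->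
  (forall t : R, 0 < t <= r -> K * ((c * t ^+ n2) `^ al) <= B * t ^+ n1) ->
  n1%:R <= al * n2%:R.
Proof.
move=> al0 K0 c0 B0 r0 H; rewrite leNgt; apply/negP => lt.
(* Otherwise, after cancelling [t^(n2 al)], the hypothesis reads [k <= t^e] with [e > 0], and the
   chosen [t] has [t^e <= k / 2]. *)
pose e := n1%:R - al * n2%:R; have e0 : 0 < e by rewrite subr_gt0.
pose k := K * (c `^ al) / B; have k0 : 0 < k by rewrite divr_gt0 // mulr_gt0 // powR_gt0.
pose t := Num.min r ((k / 2) `^ e^-1).
have k20 : 0 < k / 2 by rewrite divr_gt0.
have t0 : 0 < t by rewrite lt_min r0 powR_gt0.
have tr : t <= r by rewrite ge_min lexx.
have := H t; rewrite t0 tr => /(_ isT).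
have -> : (c * t ^+ n2) `^ al = c `^ al * t `^ (n2%:R * al).
  by rewrite powRM ?exprn_ge0 ?(ltW c0) ?(ltW t0) // -[t ^+ n2]powR_mulrn ?(ltW t0) // -powRrM.
have -> : t ^+ n1 = t `^ n1%:R by rewrite powR_mulrn // ltW.
have -> : n1%:R = e + n2%:R * al by rewrite /e; ring.
rewrite powRD; last by rewrite (gt_eqF t0) implybT.
rewrite !mulrA ler_pM2r ?powR_gt0 // -ler_pdivrMl // mulrC -/k => h.
have : t `^ e <= k / 2.
  have -> : k / 2 = ((k / 2) `^ e^-1) `^ e by rewrite -powRrM mulVf ?gt_eqF // powRr1 // ltW.
  by apply: ge0_ler_powR; rewrite ?nnegrE ?powR_ge0 ?(ltW e0) ?(ltW t0) // ge_min lexx orbT.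
by lra.
Qed.

Lemma curve_ratio a b N ra rb psi n1 n2 (al : R) : factored a N ra -> factored b N rb ->
  0 <= al -> half_admissible a b al ->
  psi 0%N = 0 -> cv1 psi -> real_fps psi ->
  ford (ev psi (ram2 N (germ a))) n1 -> ford (ev psi (ram2 N (germ b))) n2 ->
  n1%:R <= al * n2%:R.
Proof.
move=> Fa Fb al0 [K [r [K0 r0 H]]] p0 cp rp fo1 fo2.
have [c1 [B1 [r1 [c10 B10 r10 H1]]]] := curve_bounds Fa p0 cp rp fo1.
have [c2 [B2 [r2 [c20 B20 r20 H2]]]] := curve_bounds Fb p0 cp rp fo2.
have [r3 [r30 H3]] := sval_small cp p0 r0.
have [N0 _ _ _] := Fa.
pose r' := Num.min (Num.min r1 r2) (Num.min r3 (Num.min 1 r)).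
have r'0 : 0 < r' by rewrite !lt_min r10 r20 r30 r0 ltr01.
apply: (@power_compare al K c2 B1 r') => // t /andP[t0].
rewrite !le_min => /andP[/andP[t1 t2] /and3P[t3 t4 t5]].
have tt1 : 0 <= t <= r1 by rewrite (ltW t0).
have tt2 : 0 <= t <= r2 by rewrite (ltW t0).
have /andP[_ h1] := H1 t tt1; have /andP[h2 _] := H2 t tt2.
apply: le_trans h1; set x := complex.Re _ in h2 *.
have xr : `|x| <= r.
  by apply: le_trans (Re_le_nc _) _; apply: H3; rewrite nc_real ger0_norm // ltW.
have yr : 0 <= t ^+ N <= r.
  rewrite exprn_ge0 ?(ltW t0) //=; apply: le_trans t5.
  by rewrite -{2}(expr1 t) ler_wiXn2l // ltW.
apply: le_trans (H x _ xr yr); rewrite ler_wpM2l ?(ltW K0) //.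
by apply: ge0_ler_powR; rewrite ?nnegrE ?mulr_ge0 ?exprn_ge0 ?(ltW t0) ?(ltW c20).
Qed.

(** The curve and the two factorizations may have different denominators. Both are pulled back to
    the denominator [pden p * N], which multiplies the two orders by the same [N]. *)
Lemma puiseux_ratio a b N ra rb p n1 n2 (al : R) : factored a N ra -> factored b N rb ->
  0 <= al -> half_admissible a b al ->
  pser p 0%N = 0 -> cv1 (pser p) -> real_fps (pser p) ->
  ford (ev (pser p) (pgerm a p)) n1 -> ford (ev (pser p) (pgerm b p)) n2 ->
  n1%:R <= al * n2%:R.
Proof.
move=> Fa Fb al0 Hal p0 cp rp fo1 fo2; have [N0 _ _ _] := Fa.
have M0 : (0 < pden p)%N by [].
have rr : real_fps (ram N (pser p)).
  by move=> k; rewrite ramE //; case: ifP => _; [apply: rp | exists 0].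
have E c : ram2 (pden p * N) (germ c) = ram2 N (pgerm c p).
  by rewrite /pgerm ram2_ram2 // mulnC.
have h := @curve_ratio a b (pden p * N) _ _ (ram N (pser p)) (N * n1) (N * n2) al
  (factored_ram M0 Fa) (factored_ram M0 Fb) al0 Hal.
have {}h : (N * n1)%:R <= al * (N * n2)%:R.
  apply: h; rewrite ?ram_coef0 //; first exact: cv1_ram.
    by rewrite E ev_ram2 //; apply: ford_ram.
  by rewrite E ev_ram2 //; apply: ford_ram.
by move: h; rewrite !natrM mulrCA ler_pM2l // ltr0n.
Qed.

Lemma approx_value_le F a b N ra rb (al L : R) : factored a N ra -> factored b N rb ->
  0 <= al -> half_admissible a b al -> approx_value F a b L -> L <= al.
Proof.
move=> Fa Fb al0 Hal [p1 [p2 [rho [_ [_ [_ [_ [s Hs]]]]]]]].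
have [c cs] : exists c : R, c \notin s.
  have bnd (x : R) : x \in s -> `|x| <= \sum_(y <- s) `|y|.
    by move=> xs; rewrite (big_rem x) //= lerDl sumr_ge0.
  exists (1 + \sum_(y <- s) `|y|); apply/negP => /bnd h.
  by have := ler_norm (1 + \sum_(y <- s) `|y|); lra.
have [psi [[[p0 cp] _] [rp [n1 [n2 [o1 [o2 ->]]]]]]] := Hs c cs.
have := puiseux_ratio Fa Fb al0 Hal p0 cp rp (iffLR (ord_isP _ _ p0) o1) (iffLR (ord_isP _ _ p0) o2).
(* For [n2 = 0] the quotient has the default value 0, which is at most [al]. *)
case: n2 {o2} => [|n2] h; first by rewrite invr0 mulr0.
by rewrite ler_pdivrMr.
Qed.

Lemma vge_evB n phi psi f : phi 0%N = 0 -> psi 0%N = 0 ->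
  vge n (phi - psi) -> vge n (ev phi f - ev psi f).
Proof.
case: n => [|n] // p0 s0 h; have := ev_congr f (ltn0Sn n) p0 s0 h.
move=> /(vgeW (leqnSn _)) /vgeD /(_ (vgeMr (fps_const (f 1%N 0%N)) h)).
by rewrite subrK.
Qed.

Lemma common_root_ratio_le a b N ra rb (al L : R) : factored a N ra -> factored b N rb ->
  0 <= al -> half_admissible a b al -> common_root_ratio a b L -> L <= al.
Proof.
move=> Fa Fb al0 Hal [be [m [n [rbe [ar [br [[ma _] [[mb _] ->]]]]]]]].
have [p0 cp _] := iffLR (np_rootP _ _) ar.
have [h [Eh hn]] := iffLR (mult_factorP _ _ p0) ma.
have [h' [Eh' hn']] := iffLR (mult_factorP _ _ p0) mb.
have [e he] := ford_exists hn; have [e' he'] := ford_exists hn'.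
set phi := pser be in Eh Eh' he he'.
(* Along [beta + t^K] the factor [(x - beta)^m] has order [K m]. The cofactor changes only in
   degrees at least [K], so it keeps its order [e < K]. *)
have key K : (e + e' < K)%N -> (K * m + e)%:R <= al * (K * n + e')%:R.
  move=> eK; have K0 : (0 < K)%N by lia.
  pose q := Puiseux (pN be) (phi + fps_X ^+ K : fps C).
  have XK0 : (fps_X ^+ K : fps C) 0%N = 0 by rewrite -(prednK K0) fps_X0.
  have qE : pser q = phi + fps_X ^+ K by apply: fpsP.
  have q0 : pser q 0%N = 0 by rewrite qE fps_coefD p0 XK0 addr0.
  have dif : pser q - phi = fps_X ^+ K by rewrite qE addrC addKr.
  have fo k g d c : ford (ev phi g) d -> (d < K)%N ->
      pgerm c be = xsub phi ^+ k * g -> ford (ev (pser q) (pgerm c q)) (K * k + d).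
    move=> fd dK E; rewrite /pgerm -[pden q]/(pden be) -/(pgerm c be) E evM // evX // ev_xsub // dif.
    apply: fordM; first by rewrite mulnC; apply: fordX; apply: ford_Xn.
    have vd : vge K (ev (pser q) g - ev phi g).
      by apply: vge_evB => //; rewrite dif; case: (ford_Xn C K).
    have Ek j : (j < K)%N -> ev (pser q) g j = ev phi g j.
      by move=> jK; apply/eqP; rewrite -subr_eq0 -fps_coefB vd.
    case: fd => d1 d2; split; first by rewrite Ek.
    by move=> j jd; rewrite Ek ?d2 // (ltn_trans jd).
  apply: (@puiseux_ratio a b N ra rb q) => //.
  - by rewrite qE; apply: cv1D => //; apply: cv1_Xn.
  - move=> k; rewrite qE fps_coefD; have [z zE] : exists z : R, phi k = z%:C := rbe k.
    rewrite zE -[fps_X ^+ K]mulr1 mul_fps_Xn fps_coef1.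
    case: ifP => _; last by exists z; rewrite addr0.
    by case: eqP => _; [exists (z + 1); rewrite rmorphD | exists z; rewrite addr0].
  - by apply: fo he _ Eh; lia.
  - by apply: fo he' _ Eh'; lia.
have mn : m%:R <= al * n%:R.
  rewrite leNgt; apply/negP => lt; pose d : R := m%:R - al * n%:R.
  have d0 : 0 < d by rewrite subr_gt0.
  have [K [/key Kk h2]] : exists K, (e + e' < K)%N /\ al * e'%:R / d < K%:R.
    exists (Num.truncn (al * e'%:R / d) + e + e').+1; split.
      by rewrite ltnS -addnA leq_addl.
    by apply: lt_le_trans (truncnS_gt _) _; rewrite ler_nat ltnS -addnA leq_addr.
  move: Kk h2; rewrite !natrD !natrM => hK.
  rewrite ltr_pdivrMr // => h2.
  have : K%:R * d <= al * e'%:R - e%:R.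
    have -> : K%:R * d = K%:R * m%:R + e%:R - al * (K%:R * n%:R + e'%:R) + (al * e'%:R - e%:R).
      by rewrite /d; ring.
    by rewrite gerDr subr_le0.
  by have := ler0n R e; lra.
have [->|n0] := posnP n; first by rewrite invr0 mulr0.
by rewrite ler_pdivrMr // ltr0n.
Qed.

End Curves.

(** * A piecewise linear comparison *)

Section PiecewiseLinear.
Variable R : realType.
Implicit Types (E : seq R) (s lo hi : R).

Lemma seq_floor E s : 0 <= s -> exists lo, [/\ lo = 0 \/ lo \in E, 0 <= lo <= s &
  forall e, e \in E -> e <= s -> e <= lo].
Proof.
move=> s0; elim: E => [|e E [lo [lo1 /andP[lo0 los] lo2]]].
  by exists 0; split; rewrite ?lexx //; left.
case: (leP e s) => es; last first.
  exists lo; split; rewrite ?lo0 //; first by case: lo1 => [->|h]; [left | right; rewrite inE h orbT].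
  by move=> x; rewrite inE => /orP[/eqP -> /(lt_le_trans es)|/lo2 //]; rewrite ltxx.
case: (leP e lo) => elo.
  exists lo; split; rewrite ?lo0 //; first by case: lo1 => [->|h]; [left | right; rewrite inE h orbT].
  by move=> x; rewrite inE => /orP[/eqP ->|/lo2].
exists e; split; first by right; rewrite mem_head.
  by rewrite es (le_trans lo0) // ltW.
move=> x; rewrite inE => /orP[/eqP -> //|/lo2 h xs].
by apply: le_trans (h xs) _; rewrite ltW.
Qed.

Lemma seq_ceil E s : (exists2 e, e \in E & s <= e) -> exists hi, [/\ hi \in E, s <= hi &
  forall e, e \in E -> s <= e -> hi <= e].
Proof.
elim: E => [[]//|e E IH] [x]; rewrite inE => xE sx.
case: (pselect (exists2 y, y \in E & s <= y)) => [/IH[hi [h1 h2 h3]]|nE].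
  case: (leP s e) => se; last first.
    exists hi; rewrite inE h1 orbT; split=> // y; rewrite inE => /orP[/eqP ->|/h3 //].
    by move=> /(lt_le_trans se); rewrite ltxx.
  case: (leP hi e) => hie.
    by exists hi; rewrite inE h1 orbT; split=> // y; rewrite inE => /orP[/eqP ->|/h3].
  exists e; rewrite mem_head; split=> // y; rewrite inE => /orP[/eqP -> //|/h3 h /h].
  by apply: le_trans; rewrite ltW.
have xe : x = e by case/orP: xE => [/eqP //|xE]; case: nE; exists x.
exists e; rewrite mem_head -xe; split=> // y; rewrite inE xe => /orP[/eqP -> //|yE sy].
by case: nE; exists y.
Qed.

(* [None] stands for an infinite order. *)
Definition kap (d : option nat) (s : R) : R := if d is Some n then Num.min s n%:R else s.

Lemma kap_affine d lo hi s : lo <= s <= hi ->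
  (forall n, d = Some n -> n%:R <= lo \/ hi <= n%:R) ->
  (hi - lo) * kap d s = (hi - s) * kap d lo + (s - lo) * kap d hi.
Proof.
move=> /andP[los shi]; case: d => [n|] /= H; last by ring.
have [h|h] := H n erefl.
  have ns := le_trans h los; have nhi := le_trans ns shi.
  by rewrite (min_r ns) (min_r h) (min_r nhi); ring.
have ns := le_trans shi h; have nlo := le_trans los ns.
by rewrite (min_l ns) (min_l h) (min_l nlo); ring.
Qed.

Section Sums.
Variables (I : eqType) (ra rb : seq I) (d : I -> option nat) (al : R).

Definition excess s := \sum_(i <- ra) kap (d i) s - al * \sum_(i <- rb) kap (d i) s.

Definition breaks : seq R := [seq n%:R | n <- pmap d (ra ++ rb)].

Lemma mem_breaks i n : i \in ra ++ rb -> d i = Some n -> n%:R \in breaks.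
Proof. by move=> iE di; apply: map_f; rewrite mem_pmap -di map_f. Qed.

Lemma breaksP e : e \in breaks -> exists i n, [/\ i \in ra ++ rb, d i = Some n & e = n%:R].
Proof. by move=> /mapP[n]; rewrite mem_pmap => /mapP[i iE di] ->; exists i, n. Qed.

Lemma excess_affine lo hi s : lo <= s <= hi ->
  (forall e, e \in breaks -> e <= lo \/ hi <= e) ->
  (hi - lo) * excess s = (hi - s) * excess lo + (s - lo) * excess hi.
Proof.
move=> lsh H.
have E (r : seq I) : {subset r <= ra ++ rb} ->
   (hi - lo) * (\sum_(i <- r) kap (d i) s) = (hi - s) * (\sum_(i <- r) kap (d i) lo)
     + (s - lo) * (\sum_(i <- r) kap (d i) hi).
  move=> rE; rewrite !mulr_sumr -big_split /= !big_seq; apply: eq_bigr => i ir.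
  by apply: kap_affine => // n dn; apply/H/(@mem_breaks i) => //; apply: rE.
rewrite /excess mulrBr mulrCA E; last by move=> i h; rewrite mem_cat h.
by rewrite E; [ring | move=> i h; rewrite mem_cat h orbT].
Qed.

Lemma excess0 : excess 0 = 0.
Proof.
rewrite /excess !big1 ?mulr0 ?subrr // => i _; rewrite /kap; case: (d i) => // n;
  by rewrite min_l.
Qed.

Lemma excess_bounded (D s : R) : D \in breaks ->
  (forall e, e \in breaks -> e <= D -> excess e <= 0) -> 0 <= s <= D -> excess s <= 0.
Proof.
move=> DE H /andP[s0 sD]; have [lo [lo1 /andP[lo0 los] lo2]] := seq_floor breaks s0.
have [hi [hi1 shi hi2]] : exists hi, [/\ hi \in breaks, s <= hi &
    forall e, e \in breaks -> s <= e -> hi <= e] by apply: seq_ceil; exists D.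
have Hlo : excess lo <= 0.
  by case: lo1 => [->|h]; [rewrite excess0 | apply: H => //; apply: le_trans sD].
have Hhi : excess hi <= 0 by apply: H => //; apply: hi2.
have lsh : lo <= s <= hi by rewrite los.
have out e : e \in breaks -> e <= lo \/ hi <= e.
  by move=> eE; case: (leP e s) => h; [left; apply: lo2 | right; apply: hi2 => //; apply: ltW].
have := excess_affine lsh out.
case: (ltgtP lo hi) => [lohi|hilo|lohi] E; last 1 first.
- by have -> : s = lo by apply: le_anti; rewrite los lohi shi.
- rewrite -(pmulr_rle0 _ (_ : 0 < hi - lo)) ?subr_gt0 // E.
  by rewrite -[0]addr0 lerD // mulr_ge0_le0 ?subr_ge0.
- by move: (lt_le_trans hilo los); rewrite ltNge shi.
Qed.

Lemma excess_unbounded s : (forall e, e \in breaks -> excess e <= 0) ->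
  (count (fun i => d i == None) ra)%:R <= al * (count (fun i => d i == None) rb)%:R ->
  0 <= s -> excess s <= 0.
Proof.
move=> H tail s0; case: (pselect (exists2 e, e \in breaks & s <= e)) => [[e eE se]|nE].
  by apply: (@excess_bounded e) => //; [move=> x xE _; apply: H | rewrite s0].
have [lo [lo1 /andP[lo0 los] lo2]] := seq_floor breaks s0.
have Hlo : excess lo <= 0 by case: lo1 => [->|/H //]; rewrite excess0.
(* Beyond the last break point only the terms of infinite order still grow, with slope 1 each. *)
have E (r : seq I) : {subset r <= ra ++ rb} -> \sum_(i <- r) kap (d i) s =
    \sum_(i <- r) kap (d i) lo + (count (fun i => d i == None) r)%:R * (s - lo).
  elim: r => [|i r IH] rE; first by rewrite !big_nil mul0r addr0.
  rewrite !big_cons IH => [|j jr]; last by apply: rE; rewrite inE jr orbT.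
  rewrite /= natrD mulrDl addrACA; congr (_ + _).
  case di : (d i) => [n|] /=; last by rewrite mul1r addrC subrK.
  rewrite mul0r addr0; have nE' : n%:R \in breaks.
    by apply: mem_breaks di; apply: rE; rewrite mem_head.
  have ns : n%:R <= s by case: (leP n%:R s) => // h; case: nE; exists n%:R => //; apply: ltW.
  by rewrite !min_r // lo2.
rewrite /excess E; last by move=> i h; rewrite mem_cat h.
rewrite E; last by move=> i h; rewrite mem_cat h orbT.
rewrite [al * (_ + _)]mulrDr opprD addrACA -/(excess lo) -[0]addr0 lerD // mulrA -mulrBl.
by rewrite mulr_le0_ge0 ?subr_ge0 // subr_le0.
Qed.

End Sums.
End PiecewiseLinear.

(** * The elements of [Lplus_set] attached to the roots *)

Section Members.
Variable R : realType.
Local Notation C := (R[i]).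
Implicit Types (s u phi psi : fps C) (f g : fps (fps C)) (a b : nat -> nat -> R).

Lemma pcoef_nat (p : puiseux R) q k : q * (pden p)%:R = k%:R -> pcoef p q = pc p k.
Proof.
move=> E; rewrite /pcoef E.
have -> : 0 <= q by rewrite -(pmulr_lge0 _ (_ : 0 < (pden p)%:R)) ?E ?ler0n // ltr0n.
have nE : numq k%:R = k by have := numq_int k; rewrite -pmulrn.
by have := denq_int k; rewrite -pmulrn nE => -> /=.
Qed.

Lemma pcoef_out (p : puiseux R) q : (forall k, q * (pden p)%:R != k%:R) -> pcoef p q = 0.
Proof.
move=> H; rewrite /pcoef; case: ifP => // /andP[q0 dq].
set z := q * _ in dq *; have /ratArchimedean.natrP[k zk] : (0 <= z) && (denq z == 1).
  by rewrite dq andbT mulr_ge0 ?ler0n.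
by have := H k; rewrite -/z zk eqxx.
Qed.

Definition root_dist phi psi : option nat :=
  if phi == psi then None else Some (xget 0%N [set n | ford (phi - psi) n]).

Lemma root_dist_Some phi psi n : root_dist phi psi = Some n -> ford (phi - psi) n.
Proof.
rewrite /root_dist; case: eqP => // /eqP ne [<-].
have := ford_exists (_ : phi - psi != 0); rewrite subr_eq0 => /(_ ne)[k fk].
by apply: (@xgetPex _ 0%N [set n | ford (phi - psi) n]); exists k.
Qed.

Lemma root_dist_None phi psi : (root_dist phi psi == None) = (psi == phi).
Proof. by rewrite /root_dist [psi == phi]eq_sym; case: (phi =P psi). Qed.

Definition mind (o : option nat) (d : nat) := if o is Some n then minn d n else d.

Lemma kap_mind o d : kap o d%:R = (mind o d)%:R :> R.
Proof.
case: o => //= n; rewrite /minn; case: ltnP => h.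
  by rewrite min_l // ler_nat ltnW.
by rewrite min_r // ler_nat.
Qed.

Lemma ford_prod_seq (r : seq (fps C)) (F : fps C -> fps C) (o : fps C -> nat) :
  (forall i, i \in r -> ford (F i) (o i)) ->
  ford (\prod_(i <- r) F i) (\sum_(i <- r) o i).
Proof.
elim: r => [|i r IH] H; first by rewrite !big_nil; apply: ford0; rewrite oner_eq0.
rewrite !big_cons; apply: fordM; first by apply: H; rewrite mem_head.
by apply: IH => j jr; apply: H; rewrite inE jr orbT.
Qed.

Definition approx_fps phi (d : nat) (c : R) : fps C :=
  Fps (fun k => if (k < d)%N then phi k else if k == d then c%:C else 0).

(** If [phi] and [psi] part before order [d], their difference decides; otherwise the coefficient at
    [d] is [c - psi_d]. As [c] is real, avoiding the real part of [psi_d] keeps it nonzero. *)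
Lemma ford_approx phi psi d c : complex.Re (psi d) != c ->
  ford (approx_fps phi d c - psi) (mind (root_dist phi psi) d).
Proof.
move=> cd; have cd' : c%:C - psi d != 0.
  by rewrite subr_eq0; apply: contraNneq cd => <-.
case E : (root_dist phi psi) => [n|] /=; last first.
  have pp : psi = phi by apply/eqP; rewrite -root_dist_None E.
  split; first by rewrite fps_coefB /= ltnn eqxx.
  by move=> k kd; rewrite fps_coefB /= kd pp subrr.
have [dn vn] := root_dist_Some E.
have vE k : (k < minn d n)%N -> (approx_fps phi d c - psi) k = 0.
  rewrite leq_min => /andP[kd kn]; rewrite fps_coefB /= kd.
  by have := vn k kn; rewrite fps_coefB.
split=> //; rewrite fps_coefB /=; case: (ltnP n d) => nd.
  by have := dn; rewrite fps_coefB nd.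
by rewrite ltnn eqxx.
Qed.

Lemma ev_approx_order a N rs phi d c : factored a N rs -> (0 < d)%N -> phi 0%N = 0 ->
  (forall psi, psi \in rs -> complex.Re (psi d) != c) ->
  ford (ev (approx_fps phi d c) (ram2 N (germ a)))
    (\sum_(psi <- rs) mind (root_dist phi psi) d).
Proof.
move=> Fa d0 p0 cP.
have q0 : approx_fps phi d c 0%N = 0 by rewrite /= d0.
have [v [v0 ->]] := ev_factored Fa q0.
rewrite -[X in ford _ X]addn0; apply: fordM; last exact: ford0.
by apply: ford_prod_seq => psi prs; apply: ford_approx; apply: cP.
Qed.

Lemma germ_psmul a b : germ (psmul a b) = germ a * germ b.
Proof.
apply: fpsP => i; apply: fpsP => k; rewrite fps_coefM fps_coef_sum.
rewrite -[LHS]/((psmul a b i k)%:C) /psmul rmorph_sum; apply: eq_bigr => j _; rewrite rmorph_sum fps_coefM.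
by apply: eq_bigr => l _; rewrite rmorphM.
Qed.

Definition approx_ratio (ra rb : seq (fps C)) phi d : R :=
  (\sum_(psi <- ra) mind (root_dist phi psi) d)%:R
  / (\sum_(psi <- rb) mind (root_dist phi psi) d)%:R.

Definition real_below phi d := forall k, (k < d)%N -> complex.Im (phi k) = 0.

Lemma approx_ratio_value a b N ra rb phi chi d : factored a N ra -> factored b N rb ->
  phi \in ra ++ rb -> chi \in ra ++ rb -> root_dist phi chi = Some d -> real_below phi d ->
  approx_value (psmul a b) a b (approx_ratio ra rb phi d).
Proof.
move=> Fa Fb prs crs dist rp.
have [N0 ca raP _] := Fa; have [_ cb rbP _] := Fb.
have rsP psi : psi \in ra ++ rb -> psi 0%N = 0 /\ cv1 psi.
  by rewrite mem_cat => /orP[/raP|/rbP].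
have root psi : psi \in ra ++ rb -> np_root (psmul a b) (Puiseux N.-1 psi).
  move=> h; have [p0 cp] := rsP _ h; apply/np_rootP.
  have pE : pser (Puiseux N.-1 psi) = psi by apply: fpsP.
  rewrite pE; split=> //; rewrite /pgerm /pden /= (prednK N0) germ_psmul ram2M evM //.
  move: h; rewrite mem_cat => /orP[] h.
    by rewrite (iffRL (factored_root Fa p0) h) mul0r.
  by rewrite (iffRL (factored_root Fb p0) h) mulr0.
have NE (psi : nat -> C) : pden (Puiseux N.-1 psi) = N by rewrite /pden /= prednK.
have N0' : 0 < N%:R :> rat by rewrite ltr0n.
have N00 : N%:R != 0 :> rat by rewrite gt_eqF.
pose rho : rat := d%:R / N%:R.
have coefE (psi : nat -> C) q k : q * N%:R = k%:R -> pcoef (Puiseux N.-1 psi) q = psi k.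
  by move=> E; rewrite (@pcoef_nat _ q k) // NE.
have coef0 (psi : nat -> C) q : (forall k, q * N%:R != k%:R) -> pcoef (Puiseux N.-1 psi) q = 0.
  by move=> E; rewrite pcoef_out // => k; rewrite NE.
have [dd vd] := root_dist_Some dist.
have d0 : (0 < d)%N.
  rewrite lt0n; apply: contraNneq dd => ->; rewrite fps_coefB.
  by rewrite (rsP _ prs).1 (rsP _ crs).1 subrr.
have rhoE : rho * N%:R = d%:R by rewrite /rho mulfVK.
exists (Puiseux N.-1 phi), (Puiseux N.-1 chi), rho.
have ord : ord_diff (Puiseux N.-1 phi) (Puiseux N.-1 chi) rho.
  split; first by rewrite !(coefE _ _ _ rhoE) -subr_eq0 -fps_coefB.
  move=> q qr; case: (pselect (exists k : nat, q * N%:R = k%:R)) => [[k qk]|nk]; last first.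
    by rewrite !coef0 // => k; apply/eqP => e; apply: nk; exists k.
  rewrite !(coefE _ _ _ qk); have kd : (k < d)%N.
    by rewrite -(ltr_nat rat) -qk -rhoE ltr_pM2r.
  by have /eqP := vd k kd; rewrite fps_coefB subr_eq0 => /eqP.
split; [exact: root | split; [exact: root | split; [by move=> /(_ rho); apply/eqP; case: ord | split=> //]]].
(* Generic means: [c] avoids the real parts of the coefficients at [d] of all roots, which excludes
   every cancellation at once. *)
exists [seq complex.Re (psi d) | psi : fps C <- ra ++ rb] => c cs.
have cP psi : psi \in ra ++ rb -> complex.Re (psi d) != c.
  by move=> h; apply: contraNneq cs => <-; apply: map_f.
have p0 := (rsP _ prs).1; pose psi := approx_fps phi d c.
have psi0 : psi 0%N = 0 by rewrite /psi /= d0.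
have psiE : pser (Puiseux N.-1 psi) = psi by apply: fpsP.
have pcp : pc (Puiseux N.-1 psi) 0%N = 0 by [].
exists (Puiseux N.-1 psi); split; last split.
- split.
    apply/is_puiseuxP; rewrite psiE; split=> //.
    apply/cv1P; exists 1, (\sum_(k < d.+1) nc (psi k)); split=> // n.
    under eq_bigr do rewrite expr1n mulr1.
    have [nd|dn] := leqP n d.+1.
      rewrite -!(big_mkord xpredT (fun k => nc (psi k))) (big_cat_nat (leq0n _) nd) //=.
      by rewrite lerDl sumr_ge0 // => k _; apply: nc_ge0.
    rewrite -!(big_mkord xpredT (fun k => nc (psi k))) (big_cat_nat (leq0n _) (ltnW dn)) //=.
    rewrite [X in _ + X]big_nat [X in _ + X]big1 ?addr0 // => k /andP[dk _].
    by rewrite /psi /= ltnNge (ltnW dk) /= gtn_eqF // nc0.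
  move=> q; case: (pselect (exists k : nat, q * N%:R = k%:R)) => [[k qk]|nk]; last first.
    have nk' k : q * N%:R != k%:R by apply/eqP => e; apply: nk; exists k.
    rewrite !coef0 //; case: ifP => // _; case: eqP => // qr.
    by have := nk' d; rewrite qr rhoE eqxx.
  rewrite !(coefE _ _ _ qk); have -> : (q < rho) = (k < d)%N.
    by rewrite -(ltr_nat rat) -qk -rhoE ltr_pM2r.
  have -> : (q == rho) = (k == d).
    by rewrite -(eqr_nat rat) -qk -rhoE (inj_eq (mulIf N00)).
  by [].
- move=> k; rewrite /psi /=; case: ifP => kd.
    by exists (complex.Re (phi k)); apply: complex_eqP => //=; apply: rp.
  by case: eqP => _; [exists c | exists 0].
exists (\sum_(psi <- ra) mind (root_dist phi psi) d)%N, (\sum_(psi <- rb) mind (root_dist phi psi) d)%N.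
split; last split => //.
  apply/ord_isP => //; rewrite psiE /pgerm NE; apply: ev_approx_order => // chi' h.
  by apply: cP; rewrite mem_cat h.
apply/ord_isP => //; rewrite psiE /pgerm NE; apply: ev_approx_order => // chi' h.
by apply: cP; rewrite mem_cat h orbT.
Qed.

(** Series form a domain, so a higher power of [x - phi] would leave a factor [x - phi] in the
    cofactor [h], which does not vanish on [phi]. *)
Lemma multiplicity_count a N rs phi : factored a N rs -> phi 0%N = 0 ->
  multiplicity_is a (Puiseux N.-1 phi) (count_mem phi rs).
Proof.
move=> Fa p0; have [N0 ca rsP [u [cu u0 E]]] := Fa.
have pE : pser (Puiseux N.-1 phi) = phi by apply: fpsP.
have gE : pgerm a (Puiseux N.-1 phi) = ram2 N (germ a) by rewrite /pgerm /pden /= prednK.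
pose h := \prod_(psi <- rs | psi != phi) xsub psi * u.
have Eh : ram2 N (germ a) = xsub phi ^+ count_mem phi rs * h.
  rewrite E (bigID (pred1 phi)) /= -mulrA; congr (_ * _).
  rewrite -big_filter (eq_big_seq (fun=> xsub phi)) => [|psi]; last first.
    by rewrite mem_filter => /andP[/eqP ->].
  by rewrite big_filter big_const_seq iter_mulr_1.
have hphi : ev phi h != 0.
  rewrite evM // mulf_neq0 //; last first.
    by apply: contraNneq u0 => e; rewrite -(ev_coef0 u p0) e.
  rewrite -big_filter ev_prod // prodf_seq_neq0; apply/allP => psi.
  by rewrite mem_filter eq_sym => /andP[ne _]; rewrite /= ev_xsub // subr_eq0.
split; first by apply/mult_factorP => //; rewrite pE gE; exists h.
move=> m' /mult_factorP -/(_ p0); rewrite pE gE => -[h' [Eh' h'0]].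
rewrite leqNgt; apply/negP => lt.
have x0 : xsub phi != 0.
  apply/eqP => /(congr1 (fun f : fps (fps C) => f 1%N 0%N)) /eqP.
  by rewrite !fps_coefB /= subr0 oner_eq0.
have : h = xsub phi ^+ (m' - count_mem phi rs) * h'.
  have := expf_neq0 (count_mem phi rs) x0; move=> /mulfI; apply.
  by rewrite -Eh Eh' mulrA -exprD subnKC // ltnW.
move=> hE; move: hphi; rewrite hE evM // evX // ev_xsub // subrr expr0n subn_eq0 leqNgt lt /=.
by rewrite mul0r eqxx.
Qed.

Lemma common_ratio_value a b N ra rb phi : factored a N ra -> factored b N rb ->
  phi \in ra -> phi \in rb -> real_fps phi ->
  common_root_ratio a b ((count_mem phi ra)%:R / (count_mem phi rb)%:R).
Proof.
move=> Fa Fb pra prb rp; have [N0 ca raP _] := Fa; have [p0 cp] := raP _ pra.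
have pE : pser (Puiseux N.-1 phi) = phi by apply: fpsP.
have NE : pden (Puiseux N.-1 phi) = N by rewrite /pden /= prednK.
exists (Puiseux N.-1 phi), (count_mem phi ra), (count_mem phi rb).
split=> //; split.
  by apply/np_rootP; rewrite pE /pgerm NE; split=> //; apply/(factored_root Fa).
split.
  by apply/np_rootP; rewrite pE /pgerm NE; split=> //; apply/(factored_root Fb).
split; first exact: multiplicity_count.
by split=> //; apply: multiplicity_count.
Qed.

(** ** Conjugate roots *)

Definition conj_fps phi : fps C := map_fps (@conjc R) phi.

Lemma conj_fpsX phi k : conj_fps (phi ^+ k) = conj_fps phi ^+ k.
Proof.
elim: k => [|k IH]; last by rewrite !exprS -IH; apply: map_fpsM.
by rewrite !expr0; apply: fpsP => n; rewrite -[LHS]/(((1 : fps C) n)^*) !fps_coef1 rmorph_nat.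
Qed.

(** The germ has real coefficients, so substitution commutes with conjugation. *)
Lemma conj_root a N rs phi : factored a N rs -> phi \in rs -> conj_fps phi \in rs.
Proof.
move=> Fa prs; have [N0 ca rsP _] := Fa; have [p0 cp] := rsP _ prs.
have q0 : conj_fps phi 0%N = 0 by rewrite /= p0 rmorph0.
apply/(factored_root Fa q0); apply: fpsP => n.
have := iffRL (factored_root Fa p0) prs => /(congr1 (fun f : fps C => (f n)^*)).
rewrite (ev_sumE _ p0 (ltnSn n)) (ev_sumE _ q0 (ltnSn n)) rmorph0 => H.
rewrite [RHS]fps_coef0 -[RHS]H rmorph_sum; apply: eq_bigr => k _; rewrite -conj_fpsX !fps_coefM rmorph_sum.
apply: eq_bigr => j _; rewrite rmorphM; congr (_ * _).
rewrite [ram2 _ _ _ _]ramE //; case: ifP => _; last by rewrite rmorph0.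
by rewrite /= oppr0.
Qed.

End Members.

(** * Upper bound for the exponent: the nearest root *)

Section Nearest.
Variable R : realType.
Local Notation C := (R[i]).
Implicit Types (s u phi psi : fps C) (f g : fps (fps C)) (a b : nat -> nat -> R).

Lemma powR_surj (t v : R) : 0 < t < 1 -> 0 < v <= 1 -> exists2 s, 0 <= s & v = t `^ s.
Proof.
move=> /andP[t0 t1] /andP[v0 v1]; have lt0 : ln t < 0 by rewrite ln_lt0 // t0.
exists (ln v / ln t).
  by rewrite -mulrNN -invrN divr_ge0 // oppr_ge0 ?ln_le0 // ltW.
by rewrite /powR gt_eqF // divfK ?lt_eqF // lnK // posrE.
Qed.

(* A distance [delta <= t^s <= K delta] to the nearest root [phi] determines the
   distances to all roots up to constants, by the ultrametric-like estimate
   [|x - psi| ~ max (|x - phi|, |phi - psi|)]. *)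
Lemma nearest_distance phi psi (K : R) : cv1 phi -> cv1 psi -> 1 <= K ->
  exists c B r : R, [/\ 0 < c, 0 < B, 0 < r & forall x t s : R, 0 < t <= r -> t <= 1 -> 0 <= s ->
    nc (x%:C - sval phi t%:C) <= nc (x%:C - sval psi t%:C) ->
    nc (x%:C - sval phi t%:C) <= t `^ s <= K * nc (x%:C - sval phi t%:C) ->
    c * (t `^ kap (root_dist phi psi) s) <= nc (x%:C - sval psi t%:C)
      <= B * (t `^ kap (root_dist phi psi) s)].
Proof.
move=> cphi cpsi K1; have K0 : 0 < K by apply: lt_le_trans K1.
case E : (root_dist phi psi) => [n|] /=; last first.
  have pp : psi = phi by apply/eqP; rewrite -root_dist_None E.
  exists K^-1, 1, 1; rewrite invr_gt0; split=> // x t s _ _ _ _ /andP[h1 h2].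
  by rewrite pp mul1r h1 andbT mulrC ler_pdivrMr // mulrC.
have [c [B [r [c0 B0 r0 H]]]] := ford_bounds (cv1D cphi (cv1N cpsi)) (root_dist_Some E).
have [r' [r'0 H']] := svalB cphi cpsi.
exists (Num.min K^-1 (c / 2)), (1 + B), (Num.min r r').
rewrite !lt_min invr_gt0 K0 divr_gt0 // r0 r'0 addr_gt0 //; split=> // x t s.
rewrite le_min => /andP[t0 /andP[tr tr']] t1 s0 min1 /andP[d1 d2].
have tE : nc t%:C = t by rewrite nc_real ger0_norm // ltW.
have := H t%:C; have := H' t%:C; rewrite tE => /(_ tr') -> /(_ tr) /andP[h1 h2].
set X := x%:C in min1 d1 d2 *; set P := sval phi _ in min1 d1 d2 h1 h2 *.
set Q := sval psi _ in min1 h1 h2 *.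
have tri1 := ncD (X - P) (P - Q); rewrite subrKA in tri1.
have tri2 := ncD (P - X) (X - Q); rewrite subrKA (nc_distC P X) in tri2.
clearbody X P Q; move: (nc_ge0 (X - Q)) tri1 tri2 min1 d1 d2 h1 h2.
move: (nc (X - P)) (nc (X - Q)) (nc (P - Q)) => u v w v0 tri1 tri2 min1 d1 d2 h1 h2.
(* Since [phi] is the nearer root, [w <= u + v <= 2 v]. *)
have c2 : c / 2 * t ^+ n <= v by lra.
have k2 : K^-1 * t `^ s <= v.
  by apply: le_trans min1; rewrite mulrC ler_pdivrMr // mulrC.
have tn0 : 0 <= t ^+ n by rewrite exprn_ge0 // ltW.
have ts0 : 0 <= t `^ s by apply: powR_ge0.
have [sn|ns] := leP s n%:R.
  have le1 : t ^+ n <= t `^ s.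
    by rewrite -powR_mulrn ?(ltW t0) // ger_powR // t0.
  apply/andP; split.
    by apply: le_trans k2; rewrite ler_wpM2r // ge_min lexx.
  apply: le_trans tri1 _; rewrite mulrDl mul1r lerD // (le_trans h2) //.
  by rewrite ler_wpM2l // ltW.
have le1 : t `^ s <= t ^+ n.
  by rewrite -powR_mulrn ?(ltW t0) // ger_powR ?t0 // ltW.
rewrite powR_mulrn ?(ltW t0) //; apply/andP; split.
  by apply: le_trans c2; rewrite ler_wpM2r // ge_min lexx orbT.
by apply: le_trans tri1 _; rewrite mulrDl mul1r lerD // (le_trans d1).
Qed.

Lemma nearest_product phi (rs : seq (fps C)) (K : R) : cv1 phi ->
  (forall psi, psi \in rs -> cv1 psi) -> 1 <= K ->
  exists c B r : R, [/\ 0 < c, 0 < B, 0 < r & forall x t s : R, 0 < t <= r -> t <= 1 -> 0 <= s ->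
    (forall psi, psi \in rs -> nc (x%:C - sval phi t%:C) <= nc (x%:C - sval psi t%:C)) ->
    nc (x%:C - sval phi t%:C) <= t `^ s <= K * nc (x%:C - sval phi t%:C) ->
    c * (t `^ \sum_(psi <- rs) kap (root_dist phi psi) s)
      <= \prod_(psi <- rs) nc (x%:C - sval psi t%:C)
      <= B * (t `^ \sum_(psi <- rs) kap (root_dist phi psi) s)].
Proof.
move=> cphi + K1; elim: rs => [|psi rs IH] crs.
  by exists 1, 1, 1; split=> // x t s _ _ _ _ _; rewrite !big_nil powRr0 mulr1 lexx.
have [c [B [r [c0 B0 r0 H]]]] := IH (fun chi h => crs chi (mem_behead (s := psi :: rs) h)).
have [c' [B' [r' [c'0 B'0 r'0 H']]]] := nearest_distance cphi (crs _ (mem_head _ _)) K1.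
exists (c' * c), (B' * B), (Num.min r r'); rewrite !mulr_gt0 // lt_min r0.
split=> // x t s; rewrite le_min => /andP[t0 /andP[tr tr']] t1 s0 near d12.
have tr1 : 0 < t <= r by rewrite t0.
have tr2 : 0 < t <= r' by rewrite t0.
have /andP[h1 h2] := H x t s tr1 t1 s0 (fun chi h => near chi (mem_behead (s := psi :: rs) h)) d12.
have /andP[h3 h4] := H' x t s tr2 t1 s0 (near _ (mem_head _ _)) d12.
rewrite !big_cons powRD; last by rewrite (gt_eqF t0) implybT.
apply/andP; split; rewrite [_ * _ * (_ * _)]mulrACA; apply: ler_pM => //.
- by rewrite mulr_ge0 ?powR_ge0 // ltW.
- by rewrite mulr_ge0 ?powR_ge0 // ltW.
- exact: nc_ge0.
- by apply: prodr_ge0 => chi _; apply: nc_ge0.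
Qed.

Variables (a b : nat -> nat -> R) (N : nat) (ra rb : seq (fps C)).
Hypotheses (Fa : factored a N ra) (Fb : factored b N rb).
Let rs := ra ++ rb.

Let N0 : (0 < N)%N. Proof. by case: Fa. Qed.
Let rsP psi : psi \in rs -> psi 0%N = 0 /\ cv1 psi.
Proof.
by rewrite mem_cat; have [_ _ raP _] := Fa; have [_ _ rbP _] := Fb => /orP[/raP|/rbP].
Qed.
Let in_a psi : psi \in ra -> psi \in rs. Proof. by rewrite mem_cat => ->. Qed.
Let in_b psi : psi \in rb -> psi \in rs. Proof. by rewrite mem_cat orbC => ->. Qed.

Lemma pseval_bounds_a : exists c B r : R, [/\ 0 < c, 0 < B, 0 < r &
  forall x t : R, `|x| <= r -> `|t| <= r ->
    c * \prod_(phi <- ra) nc (x%:C - sval phi t%:C) <= `|pseval a x (t ^+ N)|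
      <= B * \prod_(phi <- ra) nc (x%:C - sval phi t%:C)].
Proof.
have [_ ca raP [u [cu u0 E]]] := Fa; apply: (factor_bounds N0 ca _ cu u0 E).
by move=> phi /raP[].
Qed.

Lemma pseval_bounds_b : exists c B r : R, [/\ 0 < c, 0 < B, 0 < r &
  forall x t : R, `|x| <= r -> `|t| <= r ->
    c * \prod_(phi <- rb) nc (x%:C - sval phi t%:C) <= `|pseval b x (t ^+ N)|
      <= B * \prod_(phi <- rb) nc (x%:C - sval phi t%:C)].
Proof.
have [_ cb rbP [u [cu u0 E]]] := Fb; apply: (factor_bounds N0 cb _ cu u0 E).
by move=> phi /rbP[].
Qed.

(** Real and nonreal roots share this argument. They differ in the range [S] of exponents that occur
    and in the precision [K] with which [t^s] measures the distance; the first alternative is a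
    point on a root of g, where the left-hand side is 0. *)
Lemma nearest_inequality phi (al K r0 : R) (S : set R) : 0 < al -> phi \in rs -> 1 <= K -> 0 < r0 ->
  (forall s : R, 0 <= s -> S s -> excess ra rb (root_dist phi) al s <= 0) ->
  (forall x t : R, `|x| <= r0 -> 0 < t <= r0 ->
     (forall psi, psi \in rs -> nc (x%:C - sval phi t%:C) <= nc (x%:C - sval psi t%:C)) ->
     (nc (x%:C - sval phi t%:C) = 0 /\ phi \in rb) \/
     exists s : R, [/\ 0 <= s, S s &
       nc (x%:C - sval phi t%:C) <= t `^ s <= K * nc (x%:C - sval phi t%:C)]) ->
  exists c r : R, [/\ 0 < c, 0 < r & forall x t : R, `|x| <= r -> 0 < t <= r ->
     (forall psi, psi \in rs -> nc (x%:C - sval phi t%:C) <= nc (x%:C - sval psi t%:C)) ->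
     c * (`|pseval b x (t ^+ N)| `^ al) <= `|pseval a x (t ^+ N)|].
Proof.
move=> al0 prs K1 r00 HS Hd; have [_ cphi] := rsP prs.
have [ca [Ba [r1 [ca0 Ba0 r10 H1]]]] := pseval_bounds_a.
have [cb [Bb [r2 [cb0 Bb0 r20 H2]]]] := pseval_bounds_b.
have [c3 [B3 [r3 [c30 B30 r30 H3]]]] := nearest_product cphi (fun psi h => (rsP (in_a h)).2) K1.
have [c4 [B4 [r4 [c40 B40 r40 H4]]]] := nearest_product cphi (fun psi h => (rsP (in_b h)).2) K1.
have D0 : 0 < (Bb * B4) `^ al by rewrite powR_gt0 // mulr_gt0.
exists (ca * c3 / (Bb * B4) `^ al),
  (Num.min (Num.min r0 1) (Num.min (Num.min r1 r2) (Num.min r3 r4))).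
rewrite !lt_min r00 ltr01 r10 r20 r30 r40 divr_gt0 ?mulr_gt0 //; split=> // x t.
rewrite !le_min => /andP[/andP[x0 _] /andP[/andP[x1 x2] _]].
move=> /andP[t0 /andP[/andP[tr0 t1] /andP[/andP[tr1 tr2] /andP[tr3 tr4]]]] near.
have nt : `|t| = t by rewrite ger0_norm // ltW.
have := H1 x t x1; rewrite nt => /(_ tr1)/andP[ha _].
have := H2 x t x2; rewrite nt => /(_ tr2)/andP[_ hb].
have tt0 : 0 < t <= r0 by rewrite t0.
have [[d0 prb]|[s [s0 Ss ds]]] := Hd x t x0 tt0 near.
  have -> : pseval b x (t ^+ N) = 0.
    apply/eqP; rewrite -normr_eq0 eq_le normr_ge0 andbT; apply: le_trans hb _.
    by rewrite (big_rem phi) //= d0 mul0r mulr0.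
  by rewrite normr0 powR0 ?gt_eqF // mulr0.
have tt3 : 0 < t <= r3 by rewrite t0.
have tt4 : 0 < t <= r4 by rewrite t0.
have /andP[h3 _] := H3 x t s tt3 t1 s0 (fun psi h => near psi (in_a h)) ds.
have /andP[_ h4] := H4 x t s tt4 t1 s0 (fun psi h => near psi (in_b h)) ds.
set A := \sum_(psi <- ra) _ in h3; set B := \sum_(psi <- rb) _ in h4.
have AB : A <= al * B by have := HS s s0 Ss; rewrite subr_le0.
have ga : ca * c3 * t `^ (al * B) <= `|pseval a x (t ^+ N)|.
  apply: le_trans ha; rewrite -mulrA ler_wpM2l ?(ltW ca0) //; apply: le_trans h3.
  by rewrite ler_wpM2l ?(ltW c30) // ger_powR // t0.
apply: le_trans ga; rewrite mulrAC -mulrA ler_wpM2l ?mulr_ge0 ?(ltW ca0) ?(ltW c30) //.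
rewrite ler_pdivrMr // mulrC [al * B]mulrC powRrM -powRM ?powR_ge0 ?mulr_ge0 ?(ltW Bb0) ?(ltW B40) //.
apply: ge0_ler_powR; rewrite ?nnegrE ?mulr_ge0 ?powR_ge0 ?(ltW al0) ?(ltW Bb0) ?(ltW B40) //.
by apply: le_trans hb _; rewrite -mulrA ler_wpM2l // ltW.
Qed.

Lemma nearest_real phi (al : R) : 0 < al -> phi \in rs -> real_fps phi ->
  (phi \in ra -> phi \in rb) ->
  (forall s : R, 0 <= s -> excess ra rb (root_dist phi) al s <= 0) ->
  exists c r : R, [/\ 0 < c, 0 < r & forall x t : R, `|x| <= r -> 0 < t <= r ->
     (forall psi, psi \in rs -> nc (x%:C - sval phi t%:C) <= nc (x%:C - sval psi t%:C)) ->
     c * (`|pseval b x (t ^+ N)| `^ al) <= `|pseval a x (t ^+ N)|].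
Proof.
move=> al0 prs rp ab H; have [p0 cp] := rsP prs.
have h2 : 0 < (2^-1 : R) by rewrite invr_gt0.
have [r [r0 Hr]] := sval_small cp p0 h2.
apply: (@nearest_inequality phi al 1 (Num.min r 2^-1) setT) => //.
- by rewrite lt_min r0 invr_gt0 /=.
- by move=> s s0 _; apply: H.
move=> x t; rewrite !le_min => /andP[_ x2] /andP[t0 /andP[tr t2]] _.
set delta := nc _.
have [d0|d0] := eqVneq delta 0.
  left; split=> //; move: prs; rewrite mem_cat => /orP[/ab|] //.
right; have dp : 0 < delta by rewrite lt_def d0 nc_ge0.
have d1 : delta <= 1.
  apply: le_trans (ncB _ _) _; have := Hr t%:C; rewrite !nc_real.
  by rewrite (ger0_norm (ltW t0)) => /(_ tr); lra.
have [|s s0 sE] := @powR_surj t delta _ (introT andP (conj dp d1)); first by rewrite t0; lra.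
by exists s; split=> //; rewrite mul1r -sE lexx.
Qed.

Lemma Im_sval phi : cv1 phi -> exists r : R, 0 < r /\ forall t : R, `|t| <= r ->
  sval (conj_fps phi) t%:C = (sval phi t%:C)^*.
Proof.
move=> cp; have ccp : cv1 (conj_fps phi).
  have [M [sg [s0 H]]] := cp; exists M, sg; split=> // n.
  by apply: le_trans (H n); rewrite /= -[X in nc X]/((phi n)^*) /nc /=; case: (phi n) => p q /=; rewrite sqrrN.
have [r [r0 Hr]] := svalP cp; have [r' [r'0 Hr']] := svalP ccp.
exists (Num.min r r'); rewrite lt_min r0; split=> // t; rewrite le_min => /andP[tr tr'].
have := Hr t%:C; have := Hr' t%:C; rewrite !nc_real => /(_ tr') s1 /(_ tr) s2.
apply: (sumto_uniq s1) => e e0; have [n Hn] := s2 e e0; exists n => k nk.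
have -> : \sum_(j < k) rescale t%:C (conj_fps phi) j = (\sum_(j < k) rescale t%:C phi j)^*.
  rewrite rmorph_sum; apply: eq_bigr => j _ /=; rewrite rmorphM rmorphXn; congr (_ * _ ^+ _).
  by rewrite /= oppr0.
rewrite -rmorphB; apply: le_trans (Hn k nk).
by rewrite /nc; case: (_ - _) => p q /=; rewrite sqrrN.
Qed.

(** As [x] is real, [x - phi] and [x - conj phi] have the same modulus, so
    [|phi - conj phi| <= 2 |x - phi|] and the distance is at least [(c / 2) t^e]. It may therefore
    be replaced by its maximum with [t^e], at the price of the factor [K], and this maximum is some
    [t^s] with [s <= e]. *)
Lemma nearest_nonreal phi (al : R) e : 0 < al -> phi \in rs ->
  root_dist phi (conj_fps phi) = Some e ->
  (forall s : R, 0 <= s <= e%:R -> excess ra rb (root_dist phi) al s <= 0) ->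
  exists c r : R, [/\ 0 < c, 0 < r & forall x t : R, `|x| <= r -> 0 < t <= r ->
     (forall psi, psi \in rs -> nc (x%:C - sval phi t%:C) <= nc (x%:C - sval psi t%:C)) ->
     c * (`|pseval b x (t ^+ N)| `^ al) <= `|pseval a x (t ^+ N)|].
Proof.
move=> al0 prs De H; have [p0 cp] := rsP prs.
have ccp : conj_fps phi \in rs.
  by move: prs; rewrite !mem_cat => /orP[/(conj_root Fa) ->|/(conj_root Fb) ->] //; rewrite orbT.
have [_ cc] := rsP ccp.
have [c [B [r1 [c0 B0 r10 H1]]]] := ford_bounds (cv1D cp (cv1N cc)) (root_dist_Some De).
have [r2 [r20 H2]] := svalB cp cc; have [r3 [r30 H3]] := Im_sval cp.
have h2 : 0 < (2^-1 : R) by rewrite invr_gt0.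
have [r4 [r40 H4]] := sval_small cp p0 h2.
pose K := 1 + 2 / c; have K1 : 1 <= K by rewrite lerDl divr_ge0 // ltW.
apply: (@nearest_inequality phi al K (Num.min (Num.min r1 r2) (Num.min (Num.min r3 r4) 2^-1))
  [set s | s <= e%:R]) => //.
- by rewrite !lt_min r10 r20 r30 r40.
- by move=> s s0 /= se; apply: H; rewrite s0.
move=> x t; rewrite !le_min => /andP[_ /andP[_ x2]].
move=> /andP[t0 /andP[/andP[t1 t2] /andP[/andP[t3 t4] th]]] _; right.
set delta := nc _.
have nt : nc t%:C = t by rewrite nc_real ger0_norm // ltW.
have na : `|t| = t by rewrite ger0_norm // ltW.
have d1 : delta <= 1.
  apply: le_trans (ncB _ _) _; have := H4 t%:C; rewrite nt nc_real => /(_ t4); lra.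
have te0 : 0 < t ^+ e by rewrite exprn_gt0.
have low : c * t ^+ e <= 2 * delta.
  have := H1 t%:C; have := H2 t%:C; have := H3 t; rewrite nt na => /(_ t3) -> /(_ t2) -> /(_ t1).
  move=> /andP[h _]; apply: le_trans h _; rewrite /delta; set z := sval phi _.
  have -> : z - z^* = (x%:C - z)^* - (x%:C - z).
    by case: (z) => p q; apply: complex_eqP => /=; ring.
  apply: le_trans (ncB _ _) _; rewrite (_ : nc _^* = nc (x%:C - z)); first by lra.
  by rewrite /nc; case: (_ - _) => p q /=; rewrite sqrrN.
pose v := Num.max delta (t ^+ e).
have v0 : 0 < v by rewrite lt_max te0 orbT.
have v1 : v <= 1 by rewrite ge_max d1 exprn_ile1 // ?ltW //; lra.
have [|s s0 sE] := @powR_surj t v _ (introT andP (conj v0 v1)); first by rewrite t0; lra.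
exists s; split=> //=; last first.
  rewrite -sE le_max lexx ge_max /=; apply/andP; split.
    by rewrite ler_peMl ?nc_ge0.
  have E : t ^+ e <= 2 / c * delta by rewrite mulrAC ler_pdivlMr // mulrC.
  by apply: le_trans E _; rewrite ler_wpM2r ?nc_ge0 // lerDr.
rewrite leNgt; apply/negP => es.
have : t `^ s < t `^ e%:R.
  rewrite /powR gt_eqF // ltr_expR ltr_nM2r // ln_lt0 // t0; lra.
by rewrite -sE powR_mulrn ?(ltW t0) // ltNge le_max lexx orbT.
Qed.

End Nearest.

(** * The exponent *)

Section UpperBound.
Variable R : realType.
Local Notation C := (R[i]).
Implicit Types (phi psi chi : fps C) (a b : nat -> nat -> R).

(** On the real curve [x = phi(t)] the first germ vanishes, hence so does the second. If [phi] were
    not among its roots, the second would be bounded below there by a positive multiple of a power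
    of [t]. *)
Lemma real_root_incl a b N ra rb phi : factored a N ra -> factored b N rb ->
  zero_germ_incl a b -> phi \in ra -> real_fps phi -> phi \in rb.
Proof.
move=> Fa Fb [r [r0 Hr]] pra rp; apply: contraT => prb.
have [N0 _ raP _] := Fa; have [p0 cp] := raP _ pra; have [_ _ rbP _] := Fb.
pose o psi := odflt 0%N (root_dist phi psi).
have oP psi : psi \in rb -> cv1 psi /\ ford (phi - psi) (o psi).
  move=> h; split; first by case: (rbP _ h).
  rewrite /o; case E : (root_dist phi psi) => [n|] /=; first exact: root_dist_Some.
  by have := root_dist_None phi psi; rewrite E eqxx => /esym/eqP pp; rewrite -pp h in prb.
have [c [B [r1 [c0 B0 r10 H1]]]] := prod_sval_bounds cp oP.
have [ca [Ba [r2 [ca0 Ba0 r20 H2]]]] := pseval_bounds_a Fa.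
have [cb [Bb [r3 [cb0 Bb0 r30 H3]]]] := pseval_bounds_a Fb.
have [r4 [r40 H4]] := sval_real cp rp.
pose m := Num.min (r / 2) (Num.min r2 r3).
have m0 : 0 < m by rewrite !lt_min divr_gt0 ?r20.
have [r5 [r50 H5]] := sval_small cp p0 m0.
pose t := Num.min (Num.min (Num.min r1 1) (Num.min r4 r5)) m.
have t0 : 0 < t by rewrite !lt_min r10 ltr01 r40 r50 r20 r30 divr_gt0.
have : t <= t := lexx t; rewrite {2}/t !le_min.
move=> /andP[/andP[/andP[t1 tt1] /andP[t4 t5]] /and3P[tr t2 t3]].
have nt : nc t%:C = t by rewrite nc_real ger0_norm // ltW.
have na : `|t| = t by rewrite ger0_norm // ltW.
have := H4 t; rewrite na => /(_ t4) xE; set x := complex.Re _ in xE.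
have := H5 t%:C; rewrite nt xE nc_real !le_min => /(_ t5)/and3P[xr x2 x3].
have := H2 x t x2; rewrite na => /(_ t2)/andP[_].
rewrite (big_rem phi) //= -xE subrr nc0 mul0r mulr0 normr_le0 => /eqP fz.
have := H3 x t x3; rewrite na => /(_ t3)/andP[gb _].
have := H1 t%:C; rewrite nt => /(_ t1)/andP[low _].
have gz : pseval b x (t ^+ N) = 0.
  apply: Hr fz; have tN : t ^+ N <= t by rewrite -{2}(expr1 t) ler_wiXn2l // ltW.
  have tN0 : 0 <= t ^+ N by rewrite exprn_ge0 // ltW.
  have x2' : x ^+ 2 <= (r / 2) ^+ 2 by rewrite -(real_normK (num_real x)) lerXn2r ?nnegrE // divr_ge0 // ltW.
  have y2' : (t ^+ N) ^+ 2 <= (r / 2) ^+ 2.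
    by rewrite lerXn2r ?nnegrE ?divr_ge0 ?(ltW r0) // (le_trans tN).
  by have := mulr_gt0 r0 r0; move: x2' y2'; rewrite !expr2; lra.
move: gb; rewrite gz normr0 -xE => h.
have : 0 < cb * (c * t ^+ (\sum_(psi <- rb) o psi)) by rewrite !mulr_gt0 // exprn_gt0.
by rewrite ltNge (le_trans _ h) // ler_wpM2l // ltW.
Qed.

Lemma seq_max (V : seq R) : V != [::] -> exists2 L, L \in V & forall v, v \in V -> v <= L.
Proof.
elim: V => // v V IH _; have [->|nV] := eqVneq V [::].
  by exists v; rewrite ?mem_head // => w; rewrite inE => /eqP ->.
have [L LV HL] := IH nV; case: (leP v L) => vL.
  by exists L; [rewrite inE LV orbT | move=> w; rewrite inE => /orP[/eqP ->|/HL]].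
exists v; [exact: mem_head | move=> w; rewrite inE => /orP[/eqP -> //|/HL wL]].
by rewrite (le_trans wL) // ltW.
Qed.

Lemma seq_argmin (T : eqType) (l : seq T) (D : T -> R) : l != [::] ->
  exists2 i, i \in l & forall j, j \in l -> D i <= D j.
Proof.
elim: l => // i l IH _; have [->|nl] := eqVneq l [::].
  by exists i; rewrite ?mem_head // => j; rewrite inE => /eqP ->.
have [k kl Hk] := IH nl; case: (leP (D i) (D k)) => ik.
  exists i; rewrite ?mem_head // => j; rewrite inE => /orP[/eqP -> //|/Hk].
  exact: le_trans.
exists k; rewrite ?inE ?kl ?orbT // => j; rewrite inE => /orP[/eqP ->|/Hk //].
exact: ltW.
Qed.

(** [Q i] will say that the [i]-th root is the nearest one. Which root this is varies with the
    point, so the constants must be common to all roots. *)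
Lemma seq_uniform (T : eqType) (l : seq T) (Q : T -> R -> R -> Prop) (F G : R -> R -> R) :
  (forall x t, 0 <= G x t) ->
  (forall i, i \in l -> exists c r : R, [/\ 0 < c, 0 < r & forall x t : R,
     `|x| <= r -> 0 < t <= r -> Q i x t -> c * G x t <= F x t]) ->
  exists c r : R, [/\ 0 < c, 0 < r & forall (x t : R) i, i \in l ->
     `|x| <= r -> 0 < t <= r -> Q i x t -> c * G x t <= F x t].
Proof.
move=> G0; elim: l => [|i l IH] H; first by exists 1, 1; split.
have [c [r [c0 r0 Hr]]] := IH (fun j jl => H j (mem_behead (s := i :: l) jl)).
have [c' [r' [c'0 r'0 Hr']]] := H i (mem_head _ _).
exists (Num.min c c'), (Num.min r r'); rewrite !lt_min c0 r0; split=> // x t j.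
rewrite inE !le_min => jl /andP[x1 x2] /andP[t0 /andP[t1 t2]] q.
case/orP: jl => [/eqP ji|jl].
  apply: le_trans (Hr' x t x2 _ _); rewrite ?t0 -?ji //.
  by rewrite ler_wpM2r // ge_min lexx orbT.
apply: le_trans (Hr x t j jl x1 _ q); rewrite ?t0 //.
by rewrite ler_wpM2r // ge_min lexx.
Qed.

Lemma sum_mind_gt0 (rs : seq (fps C)) phi d : (0 < d)%N -> (0 < size rs)%N ->
  phi 0%N = 0 -> (forall psi, psi \in rs -> psi 0%N = 0) ->
  (0 < \sum_(psi <- rs) mind (root_dist phi psi) d)%N.
Proof.
case: rs => // chi rs d0 _ p0 H; rewrite big_cons addn_gt0; apply/orP; left.
case E : (root_dist phi chi) => [n|] //=; rewrite leq_min d0 /= lt0n.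
have [cn _] := root_dist_Some E; apply: contraNneq cn => ->.
by rewrite fps_coefB p0 (H _ (mem_head _ _)) subrr.
Qed.

Lemma root_dist_gt0 phi psi n : phi 0%N = 0 -> psi 0%N = 0 ->
  root_dist phi psi = Some n -> (0 < n)%N.
Proof.
move=> p0 q0 E; have [cn _] := root_dist_Some E; rewrite lt0n; apply: contraNneq cn => ->.
by rewrite fps_coefB p0 q0 subrr.
Qed.

Lemma conj_fps_real phi : conj_fps phi = phi -> real_fps phi.
Proof.
move=> E k; exists (complex.Re (phi k)); apply: complex_eqP => //=.
have := congr1 (fun f : fps C => complex.Im (f k)) E.
rewrite -[conj_fps phi k]/((phi k)^*); case: (phi k) => x y /= h.
by lra.
Qed.

Lemma real_below_conj phi e : root_dist phi (conj_fps phi) = Some e -> real_below phi e.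
Proof.
move=> /root_dist_Some[_ ve] k /ve.
rewrite fps_coefB -[conj_fps phi k]/((phi k)^*); case: (phi k) => x y /= [_ h].
by lra.
Qed.

Lemma Lplus_exists a b N ra rb : factored a N ra -> factored b N rb ->
  (0 < size ra)%N -> (0 < size rb)%N -> zero_germ_incl a b ->
  exists Lp : R, [/\ 0 < Lp, Lplus_set a b Lp &
    forall al, Lp <= al -> half_admissible a b al].
Proof.
move=> Fa Fb sa sb incl; pose rs := ra ++ rb.
have [N0 _ raP _] := Fa; have [_ _ rbP _] := Fb.
have rsP psi : psi \in rs -> psi 0%N = 0 /\ cv1 psi.
  by rewrite mem_cat => /orP[/raP|/rbP].
have in_a psi : psi \in ra -> psi \in rs by rewrite mem_cat => ->.
have in_b psi : psi \in rb -> psi \in rs by rewrite mem_cat orbC => ->.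
pose dist (p : fps C * fps C) := odflt 0%N (root_dist p.1 p.2).
pose okp p := p.1 != p.2 /\ real_below p.1 (dist p).
pose okr phi := [/\ real_fps phi, phi \in ra & phi \in rb].
pose V1 := [seq approx_ratio ra rb p.1 (dist p) |
  p <- [seq (phi, psi) | phi <- rs, psi <- rs] & `[< okp p >]].
pose V2 : seq R := [seq (count_mem phi ra)%:R / (count_mem phi rb)%:R | phi <- rs & `[< okr phi >]].
have distE phi psi : phi != psi -> root_dist phi psi = Some (dist (phi, psi)).
  move=> ne; rewrite /dist /=; case E : (root_dist phi psi) => //.
  by have := root_dist_None phi psi; rewrite E eqxx eq_sym (negPf ne).
have V1in phi psi d : phi \in rs -> psi \in rs -> root_dist phi psi = Some d ->
    real_below phi d -> approx_ratio ra rb phi d \in V1 ++ V2.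
  move=> h1 h2 E rb'; rewrite mem_cat; apply/orP; left.
  have dE : dist (phi, psi) = d by rewrite /dist /= E.
  rewrite -dE; apply: (map_f (fun p => approx_ratio ra rb p.1 (dist p)) (x := (phi, psi))).
  rewrite mem_filter; apply/andP; split; last by apply/allpairsP; exists (phi, psi).
  apply/asboolP; split; rewrite ?dE //=.
  by apply/eqP => pp; have := root_dist_None phi psi; rewrite E pp eqxx.
have V2in phi : phi \in ra -> phi \in rb -> real_fps phi ->
    (count_mem phi ra)%:R / (count_mem phi rb)%:R \in V1 ++ V2.
  move=> h1 h2 rp; rewrite mem_cat; apply/orP; right.
  apply: (map_f (fun phi => (count_mem phi ra)%:R / (count_mem phi rb)%:R)).
  by rewrite mem_filter in_a // andbT; apply/asboolP; split.
have VP v : v \in V1 ++ V2 -> 0 < v /\ Lplus_set a b v.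
  rewrite mem_cat => /orP[/mapP[[phi psi]]|/mapP[phi]]; rewrite mem_filter.
    move=> /andP[/asboolP[/= ne rp] /allpairsP[[x y] /= [h1 h2 [e1 e2]]]] ->.
    rewrite -e1 -e2 in h1 h2; have [p0 _] := rsP _ h1; have [q0 _] := rsP _ h2.
    have d0 := root_dist_gt0 p0 q0 (distE _ _ ne).
    split; last by left; apply: (approx_ratio_value Fa Fb h1 h2 (distE _ _ ne) rp).
    rewrite divr_gt0 // ltr0n; apply: sum_mind_gt0 => //.
      by move=> chi /raP[].
    by move=> chi /rbP[].
  move=> /andP[/asboolP[rp pa pb] _] ->; split; last by right; apply: (common_ratio_value Fa Fb).
  by rewrite divr_gt0 // ltr0n -has_count has_pred1.
(* A nonreal root forms a pair with its conjugate; if all roots are real, any root of f is a common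
   real root. *)
have Vne : V1 ++ V2 != [::].
  suff [v] : exists v, v \in V1 ++ V2 by case: (V1 ++ V2).
  case: (pselect (exists2 phi, phi \in rs & ~ real_fps phi)) => [[phi prs nr]|allreal].
    have cprs : conj_fps phi \in rs.
      by move: prs; rewrite !mem_cat => /orP[/(conj_root Fa) ->|/(conj_root Fb) ->] //; rewrite orbT.
    have ne : phi != conj_fps phi by apply/eqP => E; apply: nr; apply: conj_fps_real.
    exists (approx_ratio ra rb phi (dist (phi, conj_fps phi))).
    by apply: (V1in _ _ _ prs cprs (distE _ _ ne)); apply: real_below_conj; apply: distE.
  have [phi pra] : exists phi, phi \in ra by case: (ra) sa => // phi r _; exists phi; apply: mem_head.
  have rp : real_fps phi.
    by apply: contrapT => nr; apply: allreal; exists phi => //; apply: in_a.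
  have prb := real_root_incl Fa Fb incl pra rp.
  by eexists; apply: V2in pra prb rp.
have [Lp LpV Lpmax] := seq_max Vne; have [Lp0 LpS] := VP _ LpV.
exists Lp; split=> // al Lal; have al0 : 0 < al by apply: lt_le_trans Lal.
have alV v : v \in V1 ++ V2 -> v <= al by move=> /Lpmax h; apply: le_trans Lal.
have ex phi psi d : phi \in rs -> psi \in rs -> root_dist phi psi = Some d ->
    real_below phi d -> excess ra rb (root_dist phi) al d%:R <= 0.
  move=> h1 h2 E rp; have := alV _ (V1in _ _ _ h1 h2 E rp).
  have [p0 _] := rsP _ h1; have [q0 _] := rsP _ h2; have d0 := root_dist_gt0 p0 q0 E.
  rewrite /approx_ratio ler_pdivrMr ?ltr0n; last first.
    by apply: sum_mind_gt0 => // chi /rbP[].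
  have E' (l : seq (fps C)) : \sum_(chi <- l) kap (root_dist phi chi) d%:R
      = (\sum_(chi <- l) mind (root_dist phi chi) d)%:R :> R.
    by rewrite natr_sum; apply: eq_bigr => chi _; apply: kap_mind.
  by rewrite /excess !E' subr_le0.
pose near phi (x t : R) := forall psi, psi \in rs ->
  nc (x%:C - sval phi t%:C) <= nc (x%:C - sval psi t%:C).
(* The value at 1/2 is recorded in both cases because [mn] needs it for a root of unknown kind. *)
have key phi : phi \in rs -> (exists c r : R, [/\ 0 < c, 0 < r & forall x t : R,
     `|x| <= r -> 0 < t <= r -> near phi x t ->
     c * (`|pseval b x (t ^+ N)| `^ al) <= `|pseval a x (t ^+ N)|])
   /\ excess ra rb (root_dist phi) al 2^-1 <= 0.
  move=> prs; have h2 : 0 <= (2^-1 : R) by rewrite invr_ge0.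
  case: (pselect (real_fps phi)) => [rp|nr].
    have ab : phi \in ra -> phi \in rb.
      by move=> h; apply: (real_root_incl Fa Fb incl h rp).
    have H s : 0 <= s -> excess ra rb (root_dist phi) al s <= 0.
      apply: excess_unbounded.
        move=> e /breaksP[psi [n [h E ->]]]; apply: ex E _ => // k _.
        exact: real_fps_Im.
      rewrite !(eq_count (root_dist_None phi)).
      case: (boolP (phi \in ra)) => pra; last first.
        by rewrite (count_memPn pra) mulr_ge0 // ltW.
      have := alV _ (V2in _ pra (ab pra) rp); rewrite ler_pdivrMr //.
      by rewrite ltr0n -has_count has_pred1 ab.
    by split; [apply: (nearest_real Fa Fb al0 prs rp ab) | apply: H].
  have ne : phi != conj_fps phi by apply/eqP => E; apply: nr; apply: conj_fps_real.
  have De := distE _ _ ne; set e := dist _ in De.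
  have cprs : conj_fps phi \in rs.
    by move: prs; rewrite !mem_cat => /orP[/(conj_root Fa) ->|/(conj_root Fb) ->] //; rewrite orbT.
  have rbe := real_below_conj De.
  have H s : 0 <= s <= e%:R -> excess ra rb (root_dist phi) al s <= 0.
    apply: excess_bounded; first exact: mem_breaks De.
    move=> _ /breaksP[psi [n [h E ->]]]; rewrite ler_nat => ne'.
    by apply: ex E _ => // k kn; apply: rbe; apply: leq_trans ne'.
  split; first exact: (nearest_nonreal Fa Fb al0 prs De H).
  apply: H; rewrite h2 /=; have e0 := root_dist_gt0 (rsP _ prs).1 (rsP _ cprs).1 De.
  by apply: (@le_trans _ _ 1); [rewrite invf_le1 ?ler1n | rewrite ler1n].
have [c [r [c0 r0 Hr]]] := seq_uniform (fun x t => powR_ge0 `|pseval b x (t ^+ N)| al)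
  (fun phi prs => (key phi prs).1).
(* Break points are positive integers, so at 1/2 every [kap] equals 1/2 and the excess is half of
   [size ra - al * size rb]. The sizes are the orders of the two germs on the [x]-axis. *)
have mn : (size ra)%:R <= al * (size rb)%:R.
  have [phi pra] : exists phi, phi \in ra by case: (ra) sa => // phi r' _; exists phi; apply: mem_head.
  have [_] := key phi (in_a _ pra); have [p0 _] := raP _ pra.
  have E (l : seq (fps C)) : {subset l <= rs} ->
      \sum_(psi <- l) kap (root_dist phi psi) 2^-1 = (size l)%:R / 2 :> R.
    elim: l => [|psi l IH] lrs; first by rewrite big_nil mul0r.
    rewrite big_cons IH => [|chi h]; last by apply: lrs; rewrite inE h orbT.
    rewrite -[(size (psi :: l))%:R]natr1 mulrDl addrC mul1r; congr (_ + _).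
    case D : (root_dist phi psi) => [n|] //=; rewrite min_l //.
    have [q0 _] := rsP _ (lrs _ (mem_head _ _)); have n0 := root_dist_gt0 p0 q0 D.
    by apply: (@le_trans _ _ 1); [rewrite invf_le1 ?ler1n | rewrite ler1n].
  by rewrite /excess (E _ in_a) (E _ in_b) mulrA -mulrBl pmulr_lle0 ?invr_gt0 // subr_le0.
have [ca [Ba [r1 [ca0 Ba0 r10 H1]]]] := pseval_bounds_a Fa.
have [cb [Bb [r2 [cb0 Bb0 r20 H2]]]] := pseval_bounds_a Fb.
have Bal : 0 < Bb `^ al by rewrite powR_gt0.
(* [r ^+ N] bounds [y] so that [t = y^(1/N)] stays below [r]; the second constant serves the axis
   [y = 0]. *)
exists (Num.min c (ca / Bb `^ al)), (Num.min (Num.min r (r ^+ N)) (Num.min 1 (Num.min r1 r2))).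
split; [by rewrite lt_min c0 divr_gt0 | by rewrite !lt_min r0 exprn_gt0 // ltr01 r10 | ].
move=> x y; rewrite !le_min => /andP[/andP[xr _] /and3P[x1 xr1 xr2]] /andP[y0].
move=> /andP[/andP[yr yrN] _]; have [yz|ynz] := eqVneq y 0; last first.
  have yp : 0 < y by rewrite lt_def ynz.
  pose t := y `^ (N%:R)^-1; have t0 : 0 < t by rewrite powR_gt0.
  have tN : t ^+ N = y.
    by rewrite -powR_mulrn ?(ltW t0) // -powRrM mulVf ?powRr1 // pnatr_eq0 -lt0n.
  have tr : t <= r by rewrite -(ler_pXn2r N0) ?nnegrE ?(ltW t0) ?(ltW r0) // tN.
  have rsne : rs != [::] by rewrite /rs; case: (ra) sa.
  have [phi prs nphi] := seq_argmin (fun psi => nc (x%:C - sval psi t%:C)) rsne.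
  have tt : 0 < t <= r by rewrite t0.
  have := Hr x t phi prs xr tt nphi; rewrite tN; apply: le_trans.
  by rewrite ler_wpM2r ?powR_ge0 // ge_min lexx.
(* At [t = 0] all roots vanish, so on the axis both germs are comparable with powers of [|x|], and
   [mn] compares the exponents. *)
have zE (l : seq (fps C)) : (forall psi, psi \in l -> psi 0%N = 0 /\ cv1 psi) ->
    \prod_(psi <- l) nc (x%:C - sval psi 0%:C) = `|x| ^+ size l.
  move=> lP; elim: l lP => [|psi l IH] lP; first by rewrite big_nil expr0.
  rewrite big_cons IH => [|chi h]; last by apply: lP; rewrite inE h orbT.
  have [q0 cq] := lP _ (mem_head _ _).
  by rewrite sval0 // subr0 nc_real exprS.
have N00 : 0 ^+ N = 0 :> R by rewrite expr0n -[N == _]negbK -lt0n N0.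
have := H1 x 0 xr1; rewrite normr0 N00 (zE _ raP) => /(_ (ltW r10))/andP[fa _].
have := H2 x 0 xr2; rewrite normr0 N00 (zE _ rbP) => /(_ (ltW r20))/andP[_ gb].
rewrite yz; apply: le_trans fa.
have [x0|xn0] := eqVneq x 0.
  have -> : `|pseval b x 0| = 0.
    apply/eqP; rewrite eq_le normr_ge0 andbT; apply: le_trans gb _.
    by rewrite x0 normr0 expr0n -[size rb == _]negbK -lt0n sb mulr0.
  by rewrite powR0 ?gt_eqF // mulr0 mulr_ge0 ?exprn_ge0 // ltW.
have xp : 0 < `|x| by rewrite normr_gt0.
apply: (@le_trans _ _ (ca / Bb `^ al * (Bb * `|x| ^+ size rb) `^ al)).
  apply: ler_pM; rewrite ?powR_ge0 ?le_min ?(ltW c0) ?divr_ge0 ?(ltW ca0) ?(ltW Bal) //.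
    by rewrite ge_min lexx orbT.
  by apply: ge0_ler_powR; rewrite ?nnegrE ?mulr_ge0 ?exprn_ge0 ?(ltW al0) ?(ltW Bb0).
rewrite powRM ?exprn_ge0 ?(ltW Bb0) // mulrA divfK ?gt_eqF // ler_wpM2l ?(ltW ca0) //.
rewrite -!powR_mulrn // -powRrM ger_powR ?xp //.
by rewrite mulrC.
Qed.

(** * From the half plane to a full neighbourhood *)

Lemma pseval_origin a : cps a -> pseval a 0 0 = a 0%N 0%N.
Proof.
move=> ca; have [r [r0 H]] := pseval_line (ltn0Sn 0) ca.
have := H 0 0; rewrite normr0 expr1 => /(_ (ltW r0) (ltW r0)) s1.
have s2 : sumto (line 0%:C 0%:C (ram2 1 (germ a))) (a 0%N 0%N)%:C.
  move=> e e0; exists 1%N => -[|n] // _; rewrite big_ord_recl big1 => [|k _]; last first.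
    rewrite line_coef big1 // => -[j jk] _ /=.
    case: j jk => [|j] jk; last by rewrite exprS mul0r mulr0.
    by rewrite subn0 exprS mul0r mulr0 mul0r.
  rewrite line_coef big_ord_recl big_ord0 !addr0 subnn !expr0 !mulr1 ram2_1.
  by rewrite subrr nc0 ltW.
by have [] := sumto_uniq s1 s2.
Qed.

Lemma pseval_flipy a x y : pseval (flipy a) x y = pseval a x (- y).
Proof.
rewrite /pseval; congr (limn (series _)); apply: funext => n; apply: eq_bigr => i _.
by rewrite /flipy [in RHS]exprNn; ring.
Qed.

Lemma cps_flipy a : cps a -> cps (flipy a).
Proof.
by move=> [M [s [s0 H]]]; exists M, s; split=> // i j; rewrite normrM normrX normrN1 expr1n mul1r.
Qed.

Lemma regular_flipy a : regular_x a -> regular_x (flipy a).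
Proof.
move=> [m [low am]]; exists m; split=> [i j ij|]; first by rewrite /flipy low // mulr0.
by rewrite /flipy expr0 mul1r.
Qed.

Lemma zero_incl_flipy a b : zero_germ_incl a b -> zero_germ_incl (flipy a) (flipy b).
Proof.
move=> [r [r0 H]]; exists r; split=> // x y xy; rewrite !pseval_flipy; apply: H.
by rewrite sqrrN.
Qed.

Lemma Lplus_max a b : cps a -> cps b -> regular_x a -> regular_x b ->
  a 0%N 0%N = 0 -> zero_germ_incl a b ->
  exists Lp : R, [/\ 0 < Lp, is_max (Lplus_set a b) Lp,
    forall al, Lp <= al -> half_admissible a b al &
    forall al, 0 <= al -> half_admissible a b al -> Lp <= al].
Proof.
move=> ca cb ar br a0 incl.
(* The origin lies on both zero sets, so each germ has at least one root; this keeps the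
   denominators in the ratios of orders positive. *)
have b0 : b 0%N 0%N = 0.
  rewrite -pseval_origin //; have [r [r0]] := incl; apply; last by rewrite pseval_origin.
  by rewrite expr0n addr0 exprn_gt0.
have [N [ra [rb [Fa Fb sa sb]]]] := common_factored ca cb ar br a0 b0.
have [Lp [Lp0 LpS Lpal]] := Lplus_exists Fa Fb sa sb incl.
have le al L : 0 <= al -> half_admissible a b al -> Lplus_set a b L -> L <= al.
  move=> al0 Hal [h|h]; first exact: approx_value_le Fa Fb al0 Hal h.
  exact: common_root_ratio_le Fa Fb al0 Hal h.
exists Lp; split=> //; last by move=> al al0 Hal; apply: le.
by split=> // L; apply: le; [exact: ltW | exact: Lpal].
Qed.

Lemma loj_half a b al : loj_admissible a b al -> half_admissible a b al.
Proof.
move=> [al0 [K [r [K0 [r0 H]]]]]; exists K, (r / 2); split; rewrite ?divr_gt0 // => x y xr.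
move=> /andP[y0 yr]; apply: H; rewrite -[X in _ <= X](ger0_norm (ltW r0)) -sqrtr_sqr ler_wsqrtr //.
have x2 : x ^+ 2 <= (r / 2) ^+ 2.
  by rewrite -(real_normK (num_real x)) lerXn2r ?nnegrE // divr_ge0 // ltW.
have y2 : y ^+ 2 <= (r / 2) ^+ 2 by rewrite lerXn2r ?nnegrE // divr_ge0 // ltW.
by have := mulr_ge0 (ltW r0) (ltW r0); move: x2 y2; rewrite !expr2; lra.
Qed.

Lemma loj_admissible_flipy a b al : loj_admissible a b al -> loj_admissible (flipy a) (flipy b) al.
Proof.
move=> [al0 [K [r [K0 [r0 H]]]]]; split=> //; exists K, r; split=> //; split=> // x y xy.
by rewrite !pseval_flipy; apply: H; rewrite sqrrN.
Qed.

Lemma half_loj a b al : 0 < al -> half_admissible a b al ->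
  half_admissible (flipy a) (flipy b) al -> loj_admissible a b al.
Proof.
move=> al0 [K [r [K0 r0 H]]] [K' [r' [K'0 r'0 H']]]; split=> //.
exists (Num.min K K'), (Num.min r r'); rewrite !lt_min K0 r0; split=> //; split=> // x y.
rewrite le_min => /andP[h h'].
have absx : `|x| <= Num.sqrt (x ^+ 2 + y ^+ 2).
  by rewrite -sqrtr_sqr ler_wsqrtr // lerDl sqr_ge0.
have absy : `|y| <= Num.sqrt (x ^+ 2 + y ^+ 2).
  by rewrite -sqrtr_sqr ler_wsqrtr // lerDr sqr_ge0.
case: (leP 0 y) => y0.
  apply: le_trans (H x y (le_trans absx h) _).
    by rewrite ler_wpM2r ?powR_ge0 // ge_min lexx.
  by rewrite y0 /= -(ger0_norm y0) (le_trans absy).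
have := H' x (- y); rewrite !pseval_flipy !opprK => H''.
apply: le_trans (H'' (le_trans absx h') _).
  by rewrite ler_wpM2r ?powR_ge0 // ge_min lexx orbT.
by rewrite oppr_ge0 (ltW y0) /= -(ltr0_norm y0) (le_trans absy).
Qed.

End UpperBound.

Theorem theorem3p1 (R : realType) (a b : nat -> nat -> R) :
  cps a -> cps b ->
  nonzero_germ a -> nonzero_germ b ->
  regular_x a -> regular_x b ->
  a 0%N 0%N = 0 ->
  zero_germ_incl a b ->
  exists Lp Lm : R,
    is_max (Lplus_set a b) Lp /\
    is_max (Lplus_set (flipy a) (flipy b)) Lm /\
    loj_exponent_is a b (Num.max Lp Lm).
Proof.
move=> ca cb _ _ ar br a0 incl.
have [Lp [Lp0 maxp upp lop]] := Lplus_max ca cb ar br a0 incl.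
have fa0 : flipy a 0%N 0%N = 0 by rewrite /flipy a0 mulr0.
have [Lm [Lm0 maxm upm lom]] := Lplus_max (cps_flipy ca) (cps_flipy cb)
  (regular_flipy ar) (regular_flipy br) fa0 (zero_incl_flipy incl).
exists Lp, Lm; split=> //; split=> //; split=> [al Hal|e e0].
  have al0 : 0 <= al by case: Hal => /ltW.
  rewrite ge_max lop ?lom //; last exact: loj_half.
  by apply: loj_half; apply: loj_admissible_flipy.
(* The maximum is itself admissible: the infimum is attained. *)
exists (Num.max Lp Lm); rewrite ltrDl e0; split=> //; apply: half_loj.
- by rewrite lt_max Lp0.
- by apply: upp; rewrite le_max lexx.
- by apply: upm; rewrite le_max lexx orbT.
Qed.
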